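(* Let $X$ be a simply-laced Dynkin diagram and let $K$ be a diagram of $\mathrm{Ext}$ type. Then: (1) There exists a $\pi$-system in $X$ of type $K$ if and only if there exists an $\mathrm{Ext}$ type subdiagram $Z$ of $X$ such that $Z^\circ$ has a $\pi$-system of type $K^\circ$. (2) The number $\mathfrak m(K,X)$ of $W(X)$-orbits of $\pi$-systems of type $K$ in $X$ is given by $$\mathfrak m(K,X)=2\sum_{\substack{Z\subseteq X\\ Z\in\mathrm{Ext}}}\mathfrak m(K^\circ,Z^\circ),$$ where the sum is over all subdiagrams $Z$ of $X$ of $\mathrm{Ext}$ type and $K^\circ$, $Z^\circ$ denote the finite parts of $K$, $Z$.
   Context: A generalized Cartan matrix (GCM) is an integer square matrix $A=(a_{ij})$ with $a_{ii}=2$, $a_{ij}\le 0$ for $i\ne j$, and $a_{ij}=0$ whenever $a_{ji}=0$. $\mathfrak{g}(A)$ is the associated Kac-Moody algebra over $\mathbb C$, and $S(A)$ is the Dynkin diagram of $A$. For a symmetrizable GCM $A$ the diagram $X=S(A)$ is identified with $A$; we write $\mathfrak g(X)$, $W(X)$ (Weyl group), $\alpha_p$ ($p$ a vertex; simple roots), etc. $X$ is called simply-laced if $A$ is symmetric (entries less than $-1$ are allowed off the diagonal); then we use the bilinear form on the root lattice given by $(\alpha_i\mid\alpha_j)=a_{ij}$. A subdiagram of $X$ is a subset of the vertices together with all edges between them (i.e. a principal submatrix). A $\pi$-system in $X$ is a finite set of distinct real roots $\{\beta_1,\dots,\beta_m\}$ of $\mathfrak{g}(X)$ such that $\beta_i-\beta_j$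 is not a root for all $i\neq j$. Its type is the GCM $(\langle\beta_i^\vee,\beta_j\rangle)_{i,j}$ ($\beta^\vee$ the coroot of $\beta$), or the corresponding diagram, taken up to simultaneous permutation of rows and columns. $W(X)$ acts on the set of $\pi$-systems of a given type, and $\mathfrak m(B,X)$ denotes the number of $W(X)$-orbits of $\pi$-systems of type $B$ in $X$. A simply-laced Dynkin diagram $Z$ is of $\mathrm{Ext}$ type (an overextension) if there is a vertex $p$ of $Z$ such that $Y=Z\setminus\{p\}$ is of affine type and $(\delta_Y\mid\alpha_p)=-1$, where $\delta_Y$ is the null root of $Y$ (the positive imaginary root of $Y$ of minimal height). Such $p$ is unique, and there is a unique vertex $q$ of $Y$ with $(\alpha_q\mid\alpha_p)\ne0$. The finite part of $Z$ is the finite type diagram $Z^\circ=Y\setminus\{q\}$. *)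

(* Defs.v *)
From mathcomp Require Import all_boot all_order all_algebra.
From mathcomp Require Import finmap boolp classical_sets functions cardinality.
From mathcomp Require Import reals complex.

Set Implicit Arguments.
Unset Strict Implicit.
Unset Printing Implicit Defensive.

Import Order.TTheory GRing.Theory Num.Theory.
Local Open Scope ring_scope.

(* A Dynkin diagram is identified with its matrix; its vertices are 'I_n. *)

Definition gcm n (A : 'M[int]_n) : Prop :=
  [/\ forall i, A i i = 2,
      forall i j, i != j -> A i j <= 0 &
      forall i j, A j i = 0 -> A i j = 0].

Definition simply_laced n (A : 'M[int]_n) : Prop := gcm A /\ A^T = A.

Definition subdiagram n (A : 'M[int]_n) (Z : {set 'I_n}) : 'M[int]_#|Z| :=
  \matrix_(i, j) A (enum_val i) (enum_val j).

(* Elements of the root lattice are row vectors of coordinates in the simple  *)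
(* roots; elements of the coroot lattice are row vectors of coordinates in    *)
(* the simple coroots.                                                        *)

Definition simple n (i : 'I_n) : 'rV[int]_n := delta_mx 0 i.

Definition pairing n (A : 'M[int]_n) (c b : 'rV[int]_n) : int :=
  (c *m A *m b^T) 0 0.

Definition refl n (A : 'M[int]_n) (i : 'I_n) (b : 'rV[int]_n) : 'rV[int]_n :=
  b - pairing A (simple i) b *: simple i.

Definition corefl n (A : 'M[int]_n) (i : 'I_n) (c : 'rV[int]_n) : 'rV[int]_n :=
  c - pairing A c (simple i) *: simple i.

(* The simple reflections are involutions, so words in them exhaust W(A).     *)
Definition weyl n (A : 'M[int]_n) (w : seq 'I_n) (b : 'rV[int]_n) :=
  foldr (refl A) b w.

Definition coweyl n (A : 'M[int]_n) (w : seq 'I_n) (c : 'rV[int]_n) :=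
  foldr (corefl A) c w.

Definition real_root n (A : 'M[int]_n) (b : 'rV[int]_n) : Prop :=
  exists w i, b = weyl A w (simple i).

Definition is_coroot n (A : 'M[int]_n) (b c : 'rV[int]_n) : Prop :=
  exists w i, b = weyl A w (simple i) /\ c = coweyl A w (simple i).

Section KacMoodyAlgebra.
Variables (F : fieldType) (n : nat) (A : 'M[int]_n).

Let AF : 'M[F]_n := map_mx intr A.

(* A realization of A: h is the space of row vectors of dimension             *)
(* n + (n - rank A), the simple coroots are its first n basis vectors, and    *)
(* the simple roots are the linear forms given by the columns of km_rootmx;   *)
(* these are independent because the lower block spans a complement of the    *)
(* row space of A.                                                            *)
Definition km_h := 'rV[F]_(n + \rank (AF^C)%MS).

Definition km_rootmx : 'M[F]_(n + \rank (AF^C)%MS, n) :=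
  col_mx AF (row_base (AF^C)%MS).

Definition km_coroot (i : 'I_n) : km_h := delta_mx 0 (lshift _ i).

Definition km_eval (a : 'rV[int]_n) (h : km_h) : F :=
  (h *m km_rootmx *m (map_mx intr a)^T) 0 0.

Inductive km_term : Type :=
| KmE of 'I_n
| KmF of 'I_n
| KmH of km_h
| Km0
| KmAdd of km_term & km_term
| KmScale of F & km_term
| KmBr of km_term & km_term.

(* Equality in the Lie algebra g~(A) presented by the generators e_i, f_i, h  *)
(* and the relations [e_i, f_j] = delta_ij alpha_i^vee, [h, h'] = 0,          *)
(* [h, e_i] = alpha_i(h) e_i and [h, f_i] = - alpha_i(h) f_i.                 *)
Inductive km_eq : km_term -> km_term -> Prop :=
| km_refl x : km_eq x x
| km_sym x y : km_eq x y -> km_eq y x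
| km_trans x y z : km_eq x y -> km_eq y z -> km_eq x z
| km_congrD x x' y y' :
    km_eq x x' -> km_eq y y' -> km_eq (KmAdd x y) (KmAdd x' y')
| km_congrZ c x x' : km_eq x x' -> km_eq (KmScale c x) (KmScale c x')
| km_congrB x x' y y' :
    km_eq x x' -> km_eq y y' -> km_eq (KmBr x y) (KmBr x' y')
| km_addA x y z : km_eq (KmAdd x (KmAdd y z)) (KmAdd (KmAdd x y) z)
| km_addC x y : km_eq (KmAdd x y) (KmAdd y x)
| km_add0 x : km_eq (KmAdd Km0 x) x
| km_addN x : km_eq (KmAdd (KmScale (-1) x) x) Km0
| km_scaleA c d x : km_eq (KmScale c (KmScale d x)) (KmScale (c * d) x)
| km_scale1 x : km_eq (KmScale 1 x) x
| km_scaleDr c x y :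
    km_eq (KmScale c (KmAdd x y)) (KmAdd (KmScale c x) (KmScale c y))
| km_scaleDl c d x :
    km_eq (KmScale (c + d) x) (KmAdd (KmScale c x) (KmScale d x))
| km_brDl x y z : km_eq (KmBr (KmAdd x y) z) (KmAdd (KmBr x z) (KmBr y z))
| km_brDr x y z : km_eq (KmBr x (KmAdd y z)) (KmAdd (KmBr x y) (KmBr x z))
| km_brZl c x y : km_eq (KmBr (KmScale c x) y) (KmScale c (KmBr x y))
| km_brZr c x y : km_eq (KmBr x (KmScale c y)) (KmScale c (KmBr x y))
| km_brxx x : km_eq (KmBr x x) Km0
| km_jacobi x y z :
    km_eq (KmAdd (KmBr x (KmBr y z))
                 (KmAdd (KmBr y (KmBr z x)) (KmBr z (KmBr x y)))) Km0
| km_hD h h' : km_eq (KmH (h + h')) (KmAdd (KmH h) (KmH h'))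
| km_hZ c h : km_eq (KmH (c *: h)) (KmScale c (KmH h))
| km_efd i : km_eq (KmBr (KmE i) (KmF i)) (KmH (km_coroot i))
| km_ef i j : i != j -> km_eq (KmBr (KmE i) (KmF j)) Km0
| km_hh h h' : km_eq (KmBr (KmH h) (KmH h')) Km0
| km_he h i :
    km_eq (KmBr (KmH h) (KmE i)) (KmScale (km_eval (simple i) h) (KmE i))
| km_hf h i :
    km_eq (KmBr (KmH h) (KmF i)) (KmScale (- km_eval (simple i) h) (KmF i)).

Record km_ideal (J : km_term -> Prop) : Prop := KmIdeal {
  km_idealE : forall x y, km_eq x y -> J x -> J y;
  km_ideal0 : J Km0;
  km_idealD : forall x y, J x -> J y -> J (KmAdd x y);
  km_idealZ : forall c x, J x -> J (KmScale c x);
  km_idealB : forall x y, J y -> J (KmBr x y) }.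

(* x vanishes in g(A) = g~(A) / r, where r is the largest ideal meeting h     *)
(* trivially, i.e. the union of all such ideals.                              *)
Definition km_null (x : km_term) : Prop :=
  exists J, [/\ km_ideal J,
                forall h, J (KmH h) -> km_eq (KmH h) Km0 &
                J x].

Definition km_root_space (a : 'rV[int]_n) (x : km_term) : Prop :=
  forall h, km_null (KmAdd (KmBr (KmH h) x) (KmScale (- km_eval a h) x)).

Definition km_root (a : 'rV[int]_n) : Prop :=
  a <> 0 /\ exists x, km_root_space a x /\ ~ km_null x.

End KacMoodyAlgebra.

Section Types.
Variable R : realType.

Definition root n (A : 'M[int]_n) (a : 'rV[int]_n) : Prop :=
  km_root (complex R) A a.

Definition imaginary_root n (A : 'M[int]_n) (a : 'rV[int]_n) : Prop :=
  root A a /\ ~ real_root A a.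

Definition positive n (a : 'rV[int]_n) : Prop :=
  a <> 0 /\ forall i, 0 <= a 0 i.

Definition height n (a : 'rV[int]_n) : int := \sum_i a 0 i.

Definition null_root n (A : 'M[int]_n) (d : 'rV[int]_n) : Prop :=
  [/\ imaginary_root A d, positive d &
      forall b, imaginary_root A b -> positive b -> height d <= height b].

Definition indecomposable n (A : 'M[int]_n) : Prop :=
  forall J : {set 'I_n}, J != finset.set0 -> J != [set: 'I_n] ->
    exists i j, [/\ i \in J, j \notin J & A i j <> 0 \/ A j i <> 0].

(* Kac, Infinite dimensional Lie algebras, Theorem 4.3 (Aff). *)
Definition affine_type n (A : 'M[int]_n) : Prop :=
  let AR : 'M[R]_n := map_mx intr A in
  [/\ gcm A, indecomposable A, (\rank AR).+1 = n,
      exists u : 'cV[R]_n, (forall i, 0 < u i 0) /\ AR *m u = 0 &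
      forall v : 'cV[R]_n, (forall i, 0 <= (AR *m v) i 0) -> AR *m v = 0].

Definition ext_vertex n (Z : 'M[int]_n) (p : 'I_n) : Prop :=
  let Y := [set~ p] in
  affine_type (subdiagram Z Y) /\
  exists d, null_root (subdiagram Z Y) d /\
    \sum_(i < #|Y|) d 0 i * Z (enum_val i) p = -1.

Definition ext_type n (Z : 'M[int]_n) : Prop :=
  simply_laced Z /\ exists p, ext_vertex Z p.

(* For Z of Ext type, the vertex p and the vertex q of Z \ {p} joined to p    *)
(* are unique, so this is Z \ {p, q}.                                         *)
Definition finite_vertices n (Z : 'M[int]_n) : {set 'I_n} :=
  [set r | `[< forall p, ext_vertex Z p -> r <> p /\ Z r p = 0 >]].

Definition finite_part n (Z : 'M[int]_n) := subdiagram Z (finite_vertices Z).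

Definition pi_system n (A : 'M[int]_n) (S : {fset 'rV[int]_n}) : Prop :=
  (forall b, b \in S -> real_root A b) /\
  (forall b c, b \in S -> c \in S -> b <> c -> ~ root A (b - c)).

Definition has_type n (A : 'M[int]_n) (S : {fset 'rV[int]_n})
    m (B : 'M[int]_m) : Prop :=
  exists b : 'I_m -> 'rV[int]_n,
    [/\ injective b, forall x, x \in S <-> exists i, x = b i &
        forall i j, exists2 c, is_coroot A (b i) c & pairing A c (b j) = B i j].

Definition pi_systems m (B : 'M[int]_m) n (A : 'M[int]_n) :
    set {fset 'rV[int]_n} :=
  [set S | pi_system A S /\ has_type A S B]%classic.

Definition weyl_orbit n (A : 'M[int]_n) (S : {fset 'rV[int]_n}) :
    set {fset 'rV[int]_n} :=
  [set T | exists w, T = [fset weyl A w b | b in S]%fset]%classic.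

Definition pi_orbits m (B : 'M[int]_m) n (A : 'M[int]_n) :
    set (set {fset 'rV[int]_n}) :=
  [set weyl_orbit A S | S in pi_systems B A]%classic.

(* Meaningful only when pi_orbits B A is finite. *)
Definition mult m (B : 'M[int]_m) n (A : 'M[int]_n) : nat :=
  #|` fset_set (pi_orbits B A)|.

End Types.

(* Main.v *)
(* The roots of g(A) enter only through three facts, all read off the weight decomposition of
   g~(A): a root is positive or negative, it is real or has norm at most 0, and beta + alpha_i
   is a root when beta is a real root with (beta|alpha_i) < 0. In particular two real roots with
   nonpositive inner product never differ by a root, so that a pi-system of type K is just a
   family (b_i) of real roots with Gram matrix K.

   Let delta be the null root of the affine part of K and put D = sum_i delta_i b_i. The
   reflections in b_i and D - b_i generate the translations b_i + 2 m D, and these are all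
   positive or negative; hence so is D. Up to a sign and the action of W(X) the vector D is
   therefore positive and antidominant, its support is a connected subdiagram Y of affine type,
   and D = delta_Y because (D|b_p) = -1. Acting further by the stabilizer of D we get
   b_p = alpha_p for a vertex p of X, so Z = Y + p is of Ext type. The remaining roots b_i lie in
   the root lattice of Z^o, except b_q, which is D minus the highest root of the system of type
   K^o. Conversely a pi-system of type K^o in Z^o extends uniquely in this way, and since
   stabilizers of antidominant vectors are generated by simple reflections, the sign, Z and the
   W(Z^o)-orbit can be recovered from the W(X)-orbit.

   That the vertex p of an Ext diagram is unique is proved by comparing the marks of two
   candidate null vectors d, d' along the arms ending in p and p': they force two branch vertices
   in an affine diagram, one of which has a mark greater than twice the smallest one. *)

From HB Require Import structures.
Require Import Defs.
From mathcomp Require Import all_boot all_order all_algebra.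
From mathcomp Require Import generic_quotient zify ring.
From mathcomp Require Import finmap boolp classical_sets functions cardinality.
From mathcomp Require Import reals complex.

Set Implicit Arguments.
Unset Strict Implicit.
Unset Printing Implicit Defensive.

Import Order.TTheory GRing.Theory Num.Theory.
Local Open Scope ring_scope.

(** * The Lie algebra presented by the Chevalley relations *)

(** The count concerns unlabelled sets of roots, while Gram matrices need a labelling. No division
    by symmetries arises: a relabelling is an automorphism of K, which fixes the extending vertex
    and the null vector because these are unique; and an automorphism of K^o fixes the highest root,
    so that the root at q depends only on the set of the finite roots. The factor 2 comes from the
    sign of D: every Weyl translate of a nonnegative D is again nonnegative, so D and -D lie in
    different orbits. Affine type enters only through a strictly positive null vector on a connected
    diagram: it makes the form semidefinite with a kernel of rank one, and this replaces the
    classification. The Lie algebra is given as terms modulo an inductive relation, which might a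
    priori collapse h. An explicit module separates the elements of h; this is what makes the simple
    roots roots. *)

HB.instance Definition _ (F : fieldType) (n : nat) (A : 'M[int]_n) := gen_eqMixin (km_term F A).
HB.instance Definition _ (F : fieldType) (n : nat) (A : 'M[int]_n) := gen_choiceMixin (km_term F A).

Section FreeAlgebra.
Local Open Scope quotient_scope.
Variables (F : fieldType) (n : nat) (A : 'M[int]_n).
Local Notation T := (km_term F A).
Implicit Types x y z : T.

Definition km_eqb x y := `[< km_eq x y >].

Lemma km_eqb_equiv : equiv_class_of km_eqb.
Proof.
split=> [x|x y|y x z].
- exact/asboolP/km_refl.
- by apply/asbool_equiv_eq; split; apply: km_sym.
- by move=> /asboolP xy /asboolP yz; apply/asboolP/(km_trans xy).
Qed.
Canonical km_equivr := EquivRelPack km_eqb_equiv.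

Definition kmalg := {eq_quot km_equivr}.
HB.instance Definition _ := Choice.on kmalg.
HB.instance Definition _ := EqQuotient.on kmalg.

Definition kmpi (x : T) : kmalg := \pi_kmalg x.

Lemma kmpiP x y : kmpi x = kmpi y <-> km_eq x y.
Proof.
split=> [/eqquotP/asboolP //|xy].
exact/eqquotP/asboolP.
Qed.

Lemma kmpi_surj (a : kmalg) : exists x, a = kmpi x.
Proof. by exists (repr a); rewrite /kmpi reprK. Qed.

Lemma km_repr x : km_eq (repr (kmpi x)) x.
Proof. by apply/kmpiP; rewrite /kmpi reprK. Qed.

Definition qadd (a b : kmalg) := kmpi (KmAdd (repr a) (repr b)).
Definition qscale c (a : kmalg) := kmpi (KmScale c (repr a)).
Definition qbr (a b : kmalg) := kmpi (KmBr (repr a) (repr b)).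

Lemma qaddE x y : qadd (kmpi x) (kmpi y) = kmpi (KmAdd x y).
Proof. by apply/kmpiP/km_congrD; apply: km_repr. Qed.
Lemma qscaleE c x : qscale c (kmpi x) = kmpi (KmScale c x).
Proof. by apply/kmpiP/km_congrZ; apply: km_repr. Qed.
Lemma qbrE x y : qbr (kmpi x) (kmpi y) = kmpi (KmBr x y).
Proof. by apply/kmpiP/km_congrB; apply: km_repr. Qed.
Let qE := (qaddE, qscaleE, qbrE).

Lemma qaddA : associative qadd.
Proof.
move=> a b c; have [x ->] := kmpi_surj a; have [y ->] := kmpi_surj b.
by have [z ->] := kmpi_surj c; rewrite !qE; apply/kmpiP/km_addA.
Qed.
Lemma qaddC : commutative qadd.
Proof.
move=> a b; have [x ->] := kmpi_surj a; have [y ->] := kmpi_surj b.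
by rewrite !qE; apply/kmpiP/km_addC.
Qed.
Lemma qadd0 : left_id (kmpi (Km0 F A)) qadd.
Proof. by move=> a; have [x ->] := kmpi_surj a; rewrite qE; apply/kmpiP/km_add0. Qed.
Lemma qaddN : left_inverse (kmpi (Km0 F A)) (qscale (-1)) qadd.
Proof. by move=> a; have [x ->] := kmpi_surj a; rewrite !qE; apply/kmpiP/km_addN. Qed.
HB.instance Definition _ := GRing.isZmodule.Build kmalg qaddA qaddC qadd0 qaddN.

Lemma qscaleA c d a : qscale c (qscale d a) = qscale (c * d) a.
Proof. by have [x ->] := kmpi_surj a; rewrite !qE; apply/kmpiP/km_scaleA. Qed.
Lemma qscale1 : left_id 1 qscale.
Proof. by move=> a; have [x ->] := kmpi_surj a; rewrite !qE; apply/kmpiP/km_scale1. Qed.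
Lemma qscaleDr : right_distributive qscale +%R.
Proof.
move=> c a b; have [x ->] := kmpi_surj a; have [y ->] := kmpi_surj b.
by rewrite /GRing.add /= !qE; apply/kmpiP/km_scaleDr.
Qed.
Lemma qscaleDl a : {morph qscale^~ a : c d / c + d}.
Proof.
move=> c d; have [x ->] := kmpi_surj a; rewrite /= [in RHS]/GRing.add /= !qE.
exact/kmpiP/km_scaleDl.
Qed.
HB.instance Definition _ := GRing.Zmodule_isLmodule.Build F kmalg
  qscaleA qscale1 qscaleDr qscaleDl.

Lemma kmpi0 : kmpi (Km0 F A) = 0. Proof. by []. Qed.
Lemma kmpiD x y : kmpi (KmAdd x y) = kmpi x + kmpi y.
Proof. by rewrite -qaddE. Qed.
Lemma kmpiZ c x : kmpi (KmScale c x) = c *: kmpi x.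
Proof. by rewrite -qscaleE. Qed.
Lemma kmpiB x y : kmpi (KmBr x y) = qbr (kmpi x) (kmpi y).
Proof. by rewrite -qbrE. Qed.
End FreeAlgebra.

(** * Lie algebras with Chevalley generators *)

Section Evaluation.
Variables (F : numFieldType) (n : nat) (A : 'M[int]_n).
Local Notation h_ := (km_h F A).
Implicit Types (a b : 'rV[int]_n) (h : h_).

Lemma km_evalD a b h : km_eval (a + b) h = km_eval a h + km_eval b h.
Proof. by rewrite /km_eval map_mxD linearD mulmxDr mxE. Qed.

Lemma km_evalN a h : km_eval (- a) h = - km_eval a h.
Proof. by rewrite /km_eval map_mxN linearN mulmxN mxE. Qed.

Lemma km_eval0 h : km_eval 0 h = 0.
Proof. by rewrite /km_eval map_mx0 trmx0 mulmx0 mxE. Qed.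

Lemma km_evalB a b h : km_eval (a - b) h = km_eval a h - km_eval b h.
Proof. by rewrite km_evalD km_evalN. Qed.

Lemma km_eval_add a h k : km_eval a (h + k) = km_eval a h + km_eval a k.
Proof. by rewrite /km_eval !mulmxDl mxE. Qed.

Lemma km_eval_opp a h : km_eval a (- h) = - km_eval a h.
Proof. by rewrite /km_eval !mulNmx mxE. Qed.

Lemma km_eval_scale a c h : km_eval a (c *: h) = c * km_eval a h.
Proof. by rewrite /km_eval -!scalemxAl mxE. Qed.

Lemma km_eval_coroot a i :
  km_eval a (km_coroot F A i) = (pairing A (simple i) a)%:~R.
Proof.
rewrite /km_eval /km_coroot /km_rootmx /pairing /simple.
rewrite -rowE rowKu map_trmx -map_row -map_mxM mxE -rowE //.
Qed.

(** The lower block of [km_rootmx] completes the row space of A, so its rows span everything and a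
    vector killed by all h is 0 over F; integers embed in F because F has characteristic 0. *)
Lemma km_eval_sep a : a != 0 -> exists h : h_, km_eval a h != 0.
Proof.
move=> a0; apply: contrapT => /forallNP H0.
have fullR : row_full (km_rootmx F A).
  by rewrite /km_rootmx -sub1mx -addsmxE (adds_eqmx (eqmx_refl _) (eq_row_base _))
             sub1mx addsmx_compl_full.
have /row_fullP[B HB] := fullR.
case/negP: a0; apply/eqP.
suff: (map_mx intr a : 'rV[F]_n)^T = 0.
  move=> /(congr1 trmx); rewrite trmxK trmx0 => /matrixP a0.
  apply/matrixP=> i j; have := a0 i j; rewrite !mxE => /eqP.
  by rewrite intr_eq0 => /eqP.
rewrite -[LHS]mul1mx -HB; apply/matrixP => i j; rewrite [RHS]mxE.
have /negP/negPn/eqP := H0 (row i B).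
by rewrite /km_eval -!row_mul mxE (ord1 j).
Qed.
End Evaluation.

Record lie_axioms (F : numFieldType) (L : lmodType F) (br : L -> L -> L) : Prop :=
  LieAxioms {
  lie_Dl : forall x y z, br (x + y) z = br x z + br y z;
  lie_Dr : forall x y z, br x (y + z) = br x y + br x z;
  lie_Zl : forall c x y, br (c *: x) y = c *: br x y;
  lie_Zr : forall c x y, br x (c *: y) = c *: br x y;
  lie_xx : forall x, br x x = 0;
  lie_jacobi : forall x y z,
    br x (br y z) + (br y (br z x) + br z (br x y)) = 0 }.

Section LieTheory.
Variables (F : numFieldType) (L : lmodType F) (br : L -> L -> L).
Hypothesis Lie : lie_axioms br.

Lemma lie_0r x : br x 0 = 0.
Proof. by have := lie_Zr Lie 0 x 0; rewrite !scale0r. Qed.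
Lemma lie_0l x : br 0 x = 0.
Proof. by have := lie_Zl Lie 0 0 x; rewrite !scale0r. Qed.
Lemma lie_Nr x y : br x (- y) = - br x y.
Proof. by rewrite -scaleN1r (lie_Zr Lie) scaleN1r. Qed.
Lemma lie_Nl x y : br (- x) y = - br x y.
Proof. by rewrite -scaleN1r (lie_Zl Lie) scaleN1r. Qed.
Lemma lie_anti x y : br x y = - br y x.
Proof.
apply/eqP; rewrite -addr_eq0; apply/eqP; have := lie_xx Lie (x + y).
by rewrite (lie_Dl Lie) !(lie_Dr Lie) !(lie_xx Lie) add0r addr0.
Qed.
Lemma lie_deriv x y z : br x (br y z) = br (br x y) z + br y (br x z).
Proof.
have := lie_jacobi Lie x y z.
rewrite [br z x]lie_anti lie_Nr [br z (br x y)]lie_anti => /eqP.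
by rewrite -opprD addr_eq0 opprK addrC => /eqP.
Qed.
Lemma lie_sum (I : Type) (s : seq I) (P : pred I) x (f : I -> L) :
  br x (\sum_(i <- s | P i) f i) = \sum_(i <- s | P i) br x (f i).
Proof. exact: (big_morph _ (lie_Dr Lie x) (lie_0r x)). Qed.

Record lie_ideal (J : L -> Prop) : Prop := LieIdeal {
  lie_ideal0 : J 0;
  lie_idealD : forall x y, J x -> J y -> J (x + y);
  lie_idealZ : forall c x, J x -> J (c *: x);
  lie_idealB : forall x y, J y -> J (br x y) }.

Lemma lie_idealN J x : lie_ideal J -> J x -> J (- x).
Proof. by move=> HJ Jx; rewrite -scaleN1r; apply: lie_idealZ. Qed.
Lemma lie_idealBB J x y : lie_ideal J -> J x -> J y -> J (x - y).
Proof. by move=> HJ Jx Jy; apply: (lie_idealD HJ) => //; apply: lie_idealN. Qed.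
Lemma lie_idealZK J c x : lie_ideal J -> c != 0 -> J (c *: x) -> J x.
Proof.
move=> HJ c0 /(lie_idealZ HJ c^-1); by rewrite scalerA mulVf // scale1r.
Qed.
Lemma lie_ideal_iter J x y k : lie_ideal J -> J y -> J (iter k (br x) y).
Proof. by move=> HJ Jy; elim: k => //= k; apply: lie_idealB. Qed.

(** Leibniz rule: one application of ad x to [y, z] lowers one of the two exponents. Hence
    nilpotence of ad x modulo J passes from y and z to [y, z]. *)
Lemma lie_iter_bracket J x y z k m : lie_ideal J ->
  J (iter k (br x) y) -> J (iter m (br x) z) -> J (iter (k + m) (br x) (br y z)).
Proof.
move=> HJ; have [N] := ubnP (k + m); elim: N => // N IH in k m y z *.
have iterD u v p : iter p (br x) (u + v) = iter p (br x) u + iter p (br x) v.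
  by elim: p => //= p ->; rewrite (lie_Dr Lie).
case: k => [_ /= Jy _|k].
  apply: (@lie_ideal_iter J _ _ _ HJ); rewrite lie_anti.
  by apply: (lie_idealN HJ); apply: (lie_idealB HJ).
case: m => [_ _ Jz|m].
  by apply: (@lie_ideal_iter J _ _ _ HJ); apply: (lie_idealB HJ).
rewrite ltnS => le Jy Jz; rewrite addSn iterSr lie_deriv iterD.
apply: (lie_idealD HJ); first by apply: IH => //; rewrite -iterSr.
by rewrite addnS -addSn; apply: IH; rewrite -?iterSr // addSn -addnS.
Qed.
End LieTheory.

(* chev E G H: the Chevalley generators e = E, f = G, h = H of a Lie algebra. *)
Record chev (F : numFieldType) (L : lmodType F) (br : L -> L -> L) (n : nat)
    (A : 'M[int]_n) (E G : 'I_n -> L) (H : km_h F A -> L) : Prop := Chev {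
  chev_HD : forall h k, H (h + k) = H h + H k;
  chev_HZ : forall c h, H (c *: h) = c *: H h;
  chev_eg : forall i, br (E i) (G i) = H (km_coroot F A i);
  chev_eg0 : forall i j, i != j -> br (E i) (G j) = 0;
  chev_hh : forall h k, br (H h) (H k) = 0;
  chev_he : forall h i, br (H h) (E i) = km_eval (simple i) h *: E i;
  chev_hg : forall h i, br (H h) (G i) = - km_eval (simple i) h *: G i;
  chev_gen : forall P : L -> Prop, P 0 -> (forall x y, P x -> P y -> P (x + y)) ->
    (forall c x, P x -> P (c *: x)) -> (forall x y, P x -> P y -> P (br x y)) ->
    (forall i, P (E i)) -> (forall i, P (G i)) -> (forall h, P (H h)) ->
    forall x, P x;
  chev_inj : forall h, H h = 0 -> h = 0 }.

(** The Chevalley involution: what is proved for one half of the algebra transfers to the other, at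
    the price of the sign in [H (- h)]. *)
Lemma chev_swap (F : numFieldType) (L : lmodType F) (br : L -> L -> L) n
    (A : 'M[int]_n) E G (H : km_h F A -> L) :
  lie_axioms br -> chev br E G H -> chev br G E (fun h => H (- h)).
Proof.
move=> Lie C.
have HN h : H (- h) = - H h by rewrite -(scaleN1r h) (chev_HZ C) scaleN1r.
split.
- by move=> h k; rewrite opprD (chev_HD C).
- by move=> c h; rewrite -(scalerN c h) (chev_HZ C).
- by move=> i; rewrite (lie_anti Lie) (chev_eg C) HN.
- by move=> i j ij; rewrite (lie_anti Lie) (chev_eg0 C) ?oppr0 // eq_sym.
- by move=> h k; rewrite (chev_hh C).
- by move=> h i; rewrite (chev_hg C) km_eval_opp opprK.
- by move=> h i; rewrite (chev_he C) km_eval_opp.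
- move=> P P0 PD PZ PB PG PE PH; apply: (chev_gen C) => // h.
  by rewrite -(opprK h).
- by move=> h /(chev_inj C) /eqP; rewrite oppr_eq0 => /eqP.
Qed.

(** * Triangular decomposition and gradation *)

Definition nonneg n (a : 'rV[int]_n) : Prop := forall i, 0 <= a 0 i.

Section Monomials.
Variables (F : numFieldType) (L : lmodType F) (br : L -> L -> L) (n : nat).
Implicit Types (a b : 'rV[int]_n) (x y : L) (E : 'I_n -> L).

(** Right-nested brackets suffice to span the subalgebra of the E i; sums stay within one weight, so
    that each element is a weight vector. *)
Inductive mono E : 'rV[int]_n -> L -> Prop :=
| mono_base i : mono E (simple i) (E i)
| mono_step i a y : mono E a y -> mono E (simple i + a) (br (E i) y)
| mono_add a x y : mono E a x -> mono E a y -> mono E a (x + y)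
| mono_scale a c x : mono E a x -> mono E a (c *: x).

Lemma heightD a b : height (a + b) = height a + height b.
Proof. by rewrite /height -big_split; apply: eq_bigr => i _; rewrite mxE. Qed.

Lemma height_simple (i : 'I_n) : height (simple i) = 1.
Proof.
rewrite /height (bigD1 i) //= big1 ?addr0; first by rewrite /simple mxE !eqxx.
by move=> j ji; rewrite /simple mxE (negPf ji) andbF.
Qed.

Lemma mono_pos E a x : mono E a x -> nonneg a /\ 0 < height a.
Proof.
have simple_ge0 i : nonneg (simple i : 'rV[int]_n).
  by move=> j; rewrite /simple mxE; case: (_ && _).
elim=> // [i|i {}a y _ [a0 ha]].
  by rewrite height_simple.
split; last by rewrite heightD height_simple addr_gt0.
by move=> j; rewrite mxE addr_ge0 //; apply: simple_ge0.
Qed.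

Definition dec (P : 'rV[int]_n -> L -> Prop) x :=
  exists s : seq ('rV[int]_n * L),
    (forall t, t \in s -> P t.1 t.2) /\ x = \sum_(t <- s) t.2.

Lemma dec0 P : dec P 0.
Proof. by exists [::]; rewrite big_nil. Qed.
Lemma dec1 (P : 'rV[int]_n -> L -> Prop) a x : P a x -> dec P x.
Proof.
by move=> Px; exists [:: (a, x)]; rewrite big_seq1; split=> // t /[!inE] /eqP ->.
Qed.
Lemma decD P x y : dec P x -> dec P y -> dec P (x + y).
Proof.
move=> [s [Ps ->]] [t [Pt ->]]; exists (s ++ t); rewrite big_cat; split=> // u.
by rewrite mem_cat => /orP[/Ps|/Pt].
Qed.
Lemma dec_sum P (I : eqType) (s : seq I) (f : I -> L) :
  (forall i, i \in s -> dec P (f i)) -> dec P (\sum_(i <- s) f i).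
Proof.
move=> Pf; rewrite big_seq; elim/big_ind: _ => //; [exact: dec0|exact: decD].
Qed.
Lemma dec_trans (P Q : 'rV[int]_n -> L -> Prop) x : (forall a y, P a y -> dec Q y) -> dec P x -> dec Q x.
Proof. by move=> PQ [s [Ps ->]]; apply: dec_sum => t /Ps; apply: PQ. Qed.
Lemma dec_br (Lie : lie_axioms br) (P Q : 'rV[int]_n -> L -> Prop) x y :
  (forall a z, P a z -> dec Q (br x z)) -> dec P y -> dec Q (br x y).
Proof.
by move=> PQ [s [Ps ->]]; rewrite (lie_sum Lie); apply: dec_sum => t /Ps; apply: PQ.
Qed.

End Monomials.

Section Structure.
Variables (F : numFieldType) (L : lmodType F) (br : L -> L -> L) (n : nat).
Variables (A : 'M[int]_n) (E G : 'I_n -> L) (H : km_h F A -> L).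
Hypothesis Lie : lie_axioms br.
Hypothesis C : chev br E G H.
Implicit Types (a b : 'rV[int]_n) (x y z : L).

Lemma chev_H0 : H 0 = 0.
Proof. by have := chev_HZ C 0 0; rewrite !scale0r. Qed.

Definition wt a x := forall h, br (H h) x = km_eval a h *: x.

Lemma wt_br a b x y : wt a x -> wt b y -> wt (a + b) (br x y).
Proof.
move=> wx wy h; rewrite (lie_deriv Lie) wx wy (lie_Zl Lie) (lie_Zr Lie).
by rewrite -scalerDl -km_evalD.
Qed.
Lemma wtD a x y : wt a x -> wt a y -> wt a (x + y).
Proof. by move=> wx wy h; rewrite (lie_Dr Lie) wx wy scalerDr. Qed.
Lemma wtZ a c x : wt a x -> wt a (c *: x).
Proof. by move=> wx h; rewrite (lie_Zr Lie) wx !scalerA mulrC. Qed.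
Lemma wtE i : wt (simple i) (E i).
Proof. by move=> h; rewrite (chev_he C). Qed.
Lemma wtG i : wt (- simple i) (G i).
Proof. by move=> h; rewrite (chev_hg C) km_evalN. Qed.
Lemma wtH h : wt 0 (H h).
Proof. by move=> k; rewrite (chev_hh C) km_eval0 scale0r. Qed.

Lemma mono_wt a x : mono br E a x -> wt a x.
Proof.
elim=> [i|i {}a y _ IH|{}a {}x y _ wx _ wy|{}a c {}x _ wx].
- exact: wtE.
- by apply: wt_br => //; apply: wtE.
- exact: wtD.
- exact: wtZ.
Qed.

(** The outermost bracket of a monomial of weight k alpha_i is [e_i, y] with y of weight (k - 1)
    alpha_i; by induction y is 0 or a multiple of e_i, so the bracket vanishes. *)
Lemma mono_simple a x : mono br E a x -> forall i k, a = simple i *+ k ->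
  x = 0 \/ k = 1%N /\ exists c, x = c *: E i.
Proof.
have se (i j : 'I_n) : (simple i : 'rV[int]_n) 0 j = (j == i)%:R.
  by rewrite /simple mxE.
have smul (i j : 'I_n) k : (simple i *+ k : 'rV[int]_n) 0 j = ((j == i) * k)%N%:R.
  by elim: k => [|k IH]; rewrite ?muln0 ?mulr0n ?mxE // mulrS mxE IH se mulnS natrD.
elim=> [j|j {}a y ma IH|{}a {}x y _ IHx _ IHy|{}a c {}x _ IHx] i k.
- move=> /rowP /(_ j); rewrite se eqxx smul; case: eqVneq => [->|_] //=.
  rewrite mul1n => /eqP; rewrite eqr_nat => /eqP <-.
  by right; split=> //; exists 1; rewrite scale1r.
- move=> eqa; have [a0 _] := mono_pos ma.
  have := congr1 (fun v : 'rV_n => v 0 j) eqa; rewrite mxE se eqxx smul.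
  case: eqVneq => [ji|_]; last first.
    by rewrite mul0n mulr0n /= => e; have := a0 j; lia.
  rewrite {}ji in eqa *; case: k eqa => [|k] eqa _.
    by move/rowP/(_ i): eqa; rewrite mulr0n !mxE !eqxx /=; have := a0 i; lia.
  move: eqa; rewrite mulrS => /addrI /IH [->|[_ [c ->]]].
    by left; rewrite (lie_0r Lie).
  by left; rewrite (lie_Zr Lie) (lie_xx Lie) scaler0.
- move=> ea; case: (IHx _ _ ea) => [->|[-> [c ->]]].
    by rewrite add0r; apply: IHy.
  case: (IHy _ _ ea) => [->|[_ [d ->]]].
    by right; split=> //; exists c; rewrite addr0.
  by right; split=> //; exists (c + d); rewrite scalerDl.
- move=> ea; case: (IHx _ _ ea) => [->|[-> [d ->]]]; first by left; rewrite scaler0.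
  by right; split=> //; exists (c * d); rewrite scalerA.
Qed.

(** The half n_- + h: bracketing n_- with e_i leaves n_- only through [e_i, f_i], which lies in
    h. *)
Definition halfcomp a x := mono br G a x \/ a = 0 /\ exists h, x = H h.

Lemma halfdec_G i x : dec halfcomp x -> dec halfcomp (br (G i) x).
Proof.
apply: (dec_br Lie) => a z [mz|[_ [h ->]]].
  by apply: (@dec1 _ _ _ _ (simple i + a)); left; apply: mono_step.
rewrite (lie_anti Lie) (chev_hg C) -scaleNr.
by apply: (@dec1 _ _ _ _ (simple i)); left; apply/mono_scale/mono_base.
Qed.

Lemma halfdec_E i a x : mono br G a x -> dec halfcomp (br (E i) x).
Proof.
elim=> [j|j {}a y my IH|{}a {}x y _ IHx _ IHy|{}a c {}x _ IHx].
- have [<-|ij] := eqVneq i j; last by rewrite (chev_eg0 C ij); apply: dec0.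
  by rewrite (chev_eg C); apply: (@dec1 _ _ _ _ 0); right; split=> //; exists (km_coroot F A i).
- rewrite (lie_deriv Lie); apply: decD; last exact: halfdec_G.
  have [<-|ij] := eqVneq i j; last by rewrite (chev_eg0 C ij) (lie_0l Lie); apply: dec0.
  rewrite (chev_eg C).
  suff [c ->] : exists c, br (H (km_coroot F A i)) y = c *: y.
    by apply: (@dec1 _ _ _ _ a); left; apply: mono_scale.
  exists (- km_eval a (km_coroot F A i)).
  elim: my => [k|k {}a z _ IHz|{}a z t _ IHz _ IHt|{}a c z _ IHz].
  + by rewrite (chev_hg C).
  + by rewrite (lie_deriv Lie) IHz (chev_hg C) (lie_Zl Lie) (lie_Zr Lie)
               -scalerDl km_evalD opprD.
  + by rewrite (lie_Dr Lie) IHz IHt scalerDr.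
  + by rewrite (lie_Zr Lie) IHz !scalerA mulrC.
- by rewrite (lie_Dr Lie); apply: decD.
- rewrite (lie_Zr Lie); have [s [Ps ->]] := IHx.
  rewrite scaler_sumr; apply: dec_sum => t /Ps [mt|[t0 [h th]]].
    by apply: (@dec1 _ _ _ _ t.1); left; apply: mono_scale.
  apply: (@dec1 _ _ _ _ t.1); right; split=> //; exists (c *: h).
  by rewrite th (chev_HZ C).
Qed.
End Structure.

Section Gradation.
Variables (F : numFieldType) (L : lmodType F) (br : L -> L -> L) (n : nat).
Variables (A : 'M[int]_n) (E G : 'I_n -> L) (H : km_h F A -> L).
Hypothesis Lie : lie_axioms br.
Hypothesis C : chev br E G H.
Implicit Types (a b : 'rV[int]_n) (x y z : L).
Local Notation wt := (wt br H).

Definition wcomp a x :=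
  [\/ mono br E a x, mono br G (- a) x | a = 0 /\ exists h, x = H h].

Lemma halfcomp_G a x : halfcomp br G H a x -> dec wcomp x.
Proof.
case=> [mx|hx]; last by apply: (@dec1 _ _ _ _ a); apply: Or33.
by apply: (@dec1 _ _ _ _ (- a)); apply: Or32; rewrite opprK.
Qed.

Lemma halfcomp_E a x : halfcomp br E (fun h => H (- h)) a x -> dec wcomp x.
Proof.
case=> [mx|[a0 [h ->]]]; first by apply: (@dec1 _ _ _ _ a); apply: Or31.
by apply: (@dec1 _ _ _ _ a); apply: Or33; split=> //; exists (- h).
Qed.


Lemma compZ a c x : wcomp a x -> wcomp a (c *: x).
Proof.
case=> [m|m|[a0 [h ->]]]; [exact/Or31/mono_scale|exact/Or32/mono_scale|].
by apply: Or33; split=> //; exists (c *: h); rewrite (chev_HZ C).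
Qed.

Lemma decZ c x : dec wcomp x -> dec wcomp (c *: x).
Proof.
move=> [s [Ps ->]]; rewrite scaler_sumr; apply: dec_sum => t /Ps /(compZ c).
exact: dec1.
Qed.

Lemma comp_wt a x : wcomp a x -> wt a x.
Proof.
case=> [/(mono_wt Lie C) //|my h|[-> [k ->]]]; last exact: (wtH C).
have := mono_wt Lie (chev_swap Lie C) my (- h).
by rewrite opprK km_evalN km_eval_opp opprK.
Qed.

(** The sum n_+ + h + n_- is stable under the generators, and the x that preserve it form a
    subalgebra. *)
Lemma dec_brl x y : dec wcomp y -> dec wcomp (br x y).
Proof.
move: x y; apply: (chev_gen C).
- by move=> y _; rewrite (lie_0l Lie); apply: dec0.
- by move=> x y IHx IHy z dz; rewrite (lie_Dl Lie); apply: decD; auto.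
- by move=> c x IHx z dz; rewrite (lie_Zl Lie); apply: decZ; auto.
- move=> x y IHx IHy z dz.
  have -> : br (br x y) z = br x (br y z) + (-1) *: br y (br x z).
    by rewrite (lie_deriv Lie) scaleN1r addrK.
  by apply: decD; [|apply: decZ]; auto.
- move=> i y; apply: (dec_br Lie) => a z.
  case=> [m|m|[_ [h ->]]].
  + by apply: (@dec1 _ _ _ _ (simple i + a)); apply/Or31/mono_step.
  + by apply: dec_trans (halfdec_E Lie C i m); apply: halfcomp_G.
  + rewrite (lie_anti Lie) (chev_he C) -scaleNr; apply: (@dec1 _ _ _ _ (simple i)).
    exact/Or31/mono_scale/mono_base.
- move=> i y; apply: (dec_br Lie) => a z.
  case=> [m|m|[_ [h ->]]].
  + by apply: dec_trans (halfdec_E Lie (chev_swap Lie C) i m); apply: halfcomp_E.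
  + apply: (@dec1 _ _ _ _ (- simple i + a)); apply: Or32.
    by rewrite opprD opprK; apply: mono_step.
  + rewrite (lie_anti Lie) (chev_hg C) -scaleNr; apply: (@dec1 _ _ _ _ (- simple i)).
    by apply: Or32; rewrite opprK; apply/mono_scale/mono_base.
- move=> h y; apply: (dec_br Lie) => a z m; rewrite (comp_wt m).
  by apply: (@dec1 _ _ _ _ a); apply: compZ.
Qed.

Lemma dec_all x : dec wcomp x.
Proof.
apply: (chev_gen C _ _ _ _ _ _ _ x).
- exact: dec0.
- exact: decD.
- exact: decZ.
- by move=> y z _; apply: dec_brl.
- by move=> i; apply: (@dec1 _ _ _ _ (simple i)); apply/Or31/mono_base.
- move=> i; apply: (@dec1 _ _ _ _ (- simple i)); apply: Or32.
  by rewrite opprK; apply: mono_base.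
- by move=> h; apply: (@dec1 _ _ _ _ 0); apply: Or33; split=> //; exists h.
Qed.

Section Independence.
Variable J : L -> Prop.
Hypothesis HJ : lie_ideal br J.

(* T is a product of operators ad h - b(h) with a(h) <> b(h), b running over bs. *)
Lemma wt_projector a (bs : seq 'rV[int]_n) : a \notin bs ->
  exists (T : L -> L) (tau : 'rV[int]_n -> F),
    [/\ {morph T : x y / x + y}, T 0 = 0, forall x, J x -> J (T x) &
        [/\ forall b x, wt b x -> T x = tau b *: x,
            tau a != 0 & forall b, b \in bs -> tau b = 0]].
Proof.
elim: bs => [_|b bs IH].
  exists id, (fun=> 1); split=> //; split=> //; last exact: oner_neq0.
  by move=> b x _; rewrite scale1r.
rewrite inE negb_or => /andP[ab /IH [T [tau [TD T0 TJ [Twt taua taub]]]]].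
have ab0 : a - b != 0 by rewrite subr_eq0.
have [h hab] := km_eval_sep F A ab0.
exists (fun x => br (H h) (T x) - km_eval b h *: T x).
exists (fun c => (km_eval c h - km_eval b h) * tau c); split.
- by move=> x y; rewrite TD (lie_Dr Lie) scalerDr opprD addrACA.
- by rewrite T0 (lie_0r Lie) scaler0 subrr.
- move=> x Jx; apply: (lie_idealBB HJ); first by apply: (lie_idealB HJ); apply: TJ.
  by apply: (lie_idealZ HJ); apply: TJ.
split.
- move=> c x wx; rewrite (Twt _ _ wx) (lie_Zr Lie) wx !scalerA -scalerBl.
  by congr (_ *: _); ring.
- by rewrite mulf_neq0 // -km_evalB.
- by move=> c; rewrite inE => /orP[/eqP ->|/taub ->]; rewrite ?subrr ?mul0r ?mulr0.
Qed.

(** The projector that kills the other weights of s preserves J and multiplies the a-part by a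
    nonzero scalar. *)
Lemma graded (s : seq ('rV[int]_n * L)) a :
  (forall t, t \in s -> wt t.1 t.2) -> J (\sum_(t <- s) t.2) ->
  J (\sum_(t <- s | t.1 == a) t.2).
Proof.
move=> ws Js.
pose bs := [seq t.1 | t <- s & t.1 != a].
have aN : a \notin bs.
  by apply/mapP=> -[t]; rewrite mem_filter => /andP[ta _] e; rewrite e eqxx in ta.
have [T [tau [TD T0 TJ [Twt taua taub]]]] := wt_projector aN.
apply: (lie_idealZK HJ taua).
suff -> : tau a *: \sum_(t <- s | t.1 == a) t.2 = T (\sum_(t <- s) t.2) by apply: TJ.
rewrite (big_morph _ TD T0) [RHS](bigID (fun t => t.1 == a)) /=.
rewrite [X in _ + X]big_seq_cond [X in _ + X]big1 ?addr0 => [|t].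
  rewrite scaler_sumr big_seq_cond [RHS]big_seq_cond; apply: eq_bigr.
  by move=> t /andP[ts /eqP ta]; rewrite -ta (Twt _ _ (ws _ ts)).
move=> /andP[ts ta]; rewrite (Twt _ _ (ws _ ts)) taub ?scale0r //.
by apply: map_f; rewrite mem_filter ta.
Qed.
End Independence.

Lemma comp0 x : wcomp 0 x -> exists h, x = H h.
Proof.
have h0 : height (0 : 'rV[int]_n) = 0 by rewrite /height big1 // => i _; rewrite mxE.
by case=> [/mono_pos[_]|/mono_pos[_]|[_ //]]; rewrite ?oppr0 h0.
Qed.

Lemma comp0_sum (s : seq ('rV[int]_n * L)) : (forall t, t \in s -> wcomp t.1 t.2) ->
  exists h, \sum_(t <- s | t.1 == 0) t.2 = H h.
Proof.
elim: s => [|t s IH] sc; first by exists 0; rewrite big_nil (chev_H0 C).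
have [|h hs] := IH; first by move=> u us; apply: sc; rewrite inE us orbT.
rewrite big_cons hs; case: eqVneq => [t0|_]; last by exists h.
have [|k ->] := @comp0 t.2; first by rewrite -t0; apply: sc; rewrite mem_head.
by exists (k + h); rewrite (chev_HD C).
Qed.

Definition nul x := exists J, [/\ lie_ideal br J, forall h, J (H h) -> H h = 0 & J x].

(** The point is that the sum of two ideals meeting h trivially meets h trivially: if h = u + v, the
    weight-0 parts of u and v lie in the respective ideals and in h, so both vanish. *)
Lemma nul_ideal : lie_ideal br nul.
Proof.
have ideal0 : lie_ideal br (eq 0).
  split=> // [x y <- <-|c x <-|x y <-]; first by rewrite addr0.
    by rewrite scaler0.
  by rewrite (lie_0r Lie).
split.
- by exists (eq 0); split.
- move=> x y [J1 [I1 d1 J1x]] [J2 [I2 d2 J2y]].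
  exists (fun z => exists u v, [/\ J1 u, J2 v & z = u + v]); split.
  + split.
    * by exists 0, 0; rewrite addr0; split=> //; [apply: (lie_ideal0 I1)|apply: (lie_ideal0 I2)].
    * move=> _ _ [u [v [Ju Jv ->]]] [u' [v' [Ju' Jv' ->]]].
      exists (u + u'), (v + v'); rewrite addrACA.
      by split=> //; [apply: (lie_idealD I1)|apply: (lie_idealD I2)].
    * move=> c _ [u [v [Ju Jv ->]]]; exists (c *: u), (c *: v); rewrite scalerDr.
      by split=> //; [apply: (lie_idealZ I1)|apply: (lie_idealZ I2)].
    * move=> z _ [u [v [Ju Jv ->]]]; exists (br z u), (br z v); rewrite (lie_Dr Lie).
      by split=> //; [apply: (lie_idealB I1)|apply: (lie_idealB I2)].
  + move=> h [u [v [Ju Jv huv]]].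
    have [[s [cs us]] [t [ct vt]]] := (dec_all u, dec_all v).
    have wss r (cr : forall p, p \in r -> wcomp p.1 p.2) : forall p, p \in r -> wt p.1 p.2.
      by move=> p /cr /comp_wt.
    have [[hs sh] [ht th]] := (comp0_sum cs, comp0_sum ct).
    have Js : J1 (H hs) by rewrite -sh; apply: (graded (J:=J1) I1); [exact: wss|rewrite -us].
    have Jt : J2 (H ht) by rewrite -th; apply: (graded (J:=J2) I2); [exact: wss|rewrite -vt].
    (* The zero ideal is graded as well, so the weight-0 part of u + v - H h is zero. *)
    have := @graded (eq 0) ideal0 ((0, - H h) :: s ++ t) 0.
    rewrite !big_cons !big_cat /= -us -vt eqxx sh th (d1 _ Js) (d2 _ Jt) !addr0 -huv.
    rewrite addNr => /(_ _ erefl) e; apply/eqP; rewrite -oppr_eq0 -e // => p.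
    rewrite inE mem_cat => /orP[/eqP -> /=|/orP[/wss|/wss]]; last 2 first.
    * exact.
    * exact.
    by rewrite -scaleN1r; apply/(wtZ Lie)/(wtH C).
  + by exists x, y.
- by move=> c x [J [I d Jx]]; exists J; split=> //; apply: (lie_idealZ I).
- by move=> x y [J [I d Jx]]; exists J; split=> //; apply: (lie_idealB I).
Qed.

Definition lroot a :=
  a <> 0 /\ exists x, (forall h, nul (br (H h) x - km_eval a h *: x)) /\ ~ nul x.

(** A weight vector modulo the radical lifts to a genuine one. For b <> a, the b-component of x
    times (b - a)(h) is the b-component of [h, x] - a(h) x, hence null. *)
Lemma lrootP a : lroot a <-> a <> 0 /\ exists x, wcomp a x /\ ~ nul x.
Proof.
have NI := nul_ideal.
split=> -[a0 [x [xa nx]]]; split=> //; last first.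
  exists x; split=> // h; rewrite (comp_wt xa) subrr; exact: (lie_ideal0 NI).
have [s [cs xs]] := dec_all x.
apply: contrapT => /forallNP na; apply: nx.
have nb b : nul (\sum_(t <- s | t.1 == b) t.2).
  have [->|ba] := eqVneq b a.
    rewrite big_seq_cond; elim/big_ind: _ => [|y z|t /andP[ts /eqP ta]].
    - exact: (lie_ideal0 NI).
    - exact: (lie_idealD NI).
    - apply: contrapT => nt; apply: (na t.2); split=> //; rewrite -ta; exact: cs.
  have ba0 : b - a != 0 by rewrite subr_eq0.
  have [h hab] := km_eval_sep F A ba0.
  apply: (lie_idealZK NI hab).
  pose s' := [seq (t.1, (km_eval t.1 h - km_eval a h) *: t.2) | t <- s].
  have := @graded nul NI s' b; rewrite !big_map /= => /(_ _ _).
  have -> : \sum_(t <- s | t.1 == b) (km_eval t.1 h - km_eval a h) *: t.2 =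
     km_eval (b - a) h *: (\sum_(t <- s | t.1 == b) t.2).
    by rewrite scaler_sumr; apply: eq_bigr => t /eqP ->; rewrite km_evalB.
  apply.
    by move=> t /mapP[u us ->] /=; apply/(wtZ Lie)/comp_wt/cs.
  suff -> : \sum_(t <- s) (km_eval t.1 h - km_eval a h) *: t.2 =
            br (H h) x - km_eval a h *: x by [].
  rewrite xs (lie_sum Lie) scaler_sumr -sumrB big_seq [RHS]big_seq.
  by apply: eq_bigr => t ts; rewrite (comp_wt (cs _ ts)) scalerBl.
rewrite xs.
have -> : \sum_(t <- s) t.2 =
    \sum_(a <- undup [seq t.1 | t <- s]) \sum_(t <- s | t.1 == a) t.2.
  rewrite (exchange_big_dep xpredT) //= big_seq [RHS]big_seq.
  apply: eq_bigr => t ts.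
  under eq_bigl do rewrite eq_sym.
  by rewrite -big_filter filter_pred1_uniq ?undup_uniq ?mem_undup ?map_f // big_seq1.
elim/big_ind: _ => [|y z|b _ //]; first exact: (lie_ideal0 NI).
exact: (lie_idealD NI).
Qed.
End Gradation.

(** * Integrability *)

Lemma pairing_simple n (A : 'M[int]_n) i j :
  pairing A (simple i) (simple j) = A i j.
Proof. by rewrite /pairing /simple -rowE trmx_delta -colE !mxE. Qed.

Section Pairing.
Variables (n : nat) (A : 'M[int]_n).
Implicit Types x y z : 'rV[int]_n.

Lemma pairingDl x y z : pairing A (x + y) z = pairing A x z + pairing A y z.
Proof. by rewrite /pairing !mulmxDl mxE. Qed.
Lemma pairingDr x y z : pairing A x (y + z) = pairing A x y + pairing A x z.
Proof. by rewrite /pairing linearD mulmxDr mxE. Qed.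
Lemma pairingZl c x y : pairing A (c *: x) y = c * pairing A x y.
Proof. by rewrite /pairing -!scalemxAl mxE. Qed.
Lemma pairingZr c x y : pairing A x (c *: y) = c * pairing A x y.
Proof. by rewrite /pairing linearZ -scalemxAr mxE. Qed.
Lemma pairingNl x y : pairing A (- x) y = - pairing A x y.
Proof. by rewrite /pairing !mulNmx mxE. Qed.
Lemma pairingNr x y : pairing A x (- y) = - pairing A x y.
Proof. by rewrite /pairing linearN mulmxN mxE. Qed.
Lemma pairing0l x : pairing A 0 x = 0.
Proof. by rewrite /pairing !mul0mx mxE. Qed.
Lemma pairing0r x : pairing A x 0 = 0.
Proof. by rewrite /pairing trmx0 mulmx0 mxE. Qed.
Definition pairingE := (pairingDl, pairingDr, pairingNl, pairingNr, pairingZl, pairingZr).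
End Pairing.

Section Integrability.
Variables (F : numFieldType) (L : lmodType F) (br : L -> L -> L) (n : nat).
Variables (A : 'M[int]_n).
Hypothesis Lie : lie_axioms br.
Implicit Types (E G : 'I_n -> L) (H : km_h F A -> L).
Implicit Types (a b : 'rV[int]_n) (x y z : L).

Lemma nul_swap H x : nul br (fun h => H (- h)) x <-> nul br H x.
Proof.
split=> -[J [I d Jx]]; exists J; split=> // h Jh; last exact: d.
by rewrite -(opprK h); apply: d; rewrite opprK.
Qed.

Lemma wt_swap H a x : wt br (fun h => H (- h)) a x <-> wt br H (- a) x.
Proof.
split=> w h; first by rewrite -{1}(opprK h) w km_eval_opp km_evalN.
by rewrite w km_eval_opp km_evalN opprK.
Qed.

Section Sl2.
Variables (E G : 'I_n -> L) (H : km_h F A -> L).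
Hypothesis C : chev br E G H.
Variables (i : 'I_n) (Aii : A i i = 2).
Let hi := km_coroot F A i.

Lemma wt_iterG a x k : wt br H a x -> wt br H (a - simple i *+ k) (iter k (br (G i)) x).
Proof.
move=> wx; elim: k => [|k IH]; first by rewrite mulr0n subr0.
rewrite mulrS opprD addrCA; apply: (wt_br Lie) => //; exact: (wtG C).
Qed.

Lemma sl2_commutation a x k : wt br H a x ->
  br (E i) (iter k.+1 (br (G i)) x) = iter k.+1 (br (G i)) (br (E i) x)
    + (k.+1%:R * (km_eval a hi - k%:R)) *: iter k (br (G i)) x.
Proof.
move=> wx; elim: k => [|k IH].
  by rewrite /= (lie_deriv Lie) (chev_eg C) wx addrC mul1r subr0.
rewrite iterS (lie_deriv Lie) IH (chev_eg C) (wt_iterG k.+1 wx).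
rewrite (lie_Dr Lie) (lie_Zr Lie) addrCA; congr (_ + _).
rewrite -iterS -scalerDl km_evalB.
have -> : km_eval (simple i *+ k.+1) (km_coroot F A i) = 2 * k.+1%:R.
  have e m : km_eval (simple i *+ m) hi = 2 * m%:R.
    elim: m => [|m IHm]; first by rewrite mulr0n km_eval0 mulr0.
    rewrite mulrS km_evalD IHm km_eval_coroot pairing_simple Aii.
    by rewrite -[m.+1%:R]natr1; ring.
  exact: e.
congr (_ *: _); rewrite -/hi -![in LHS]natr1 -![in RHS]natr1; ring.
Qed.

(* Modulo J this says that f^m is injective on the weight space m >= 0 of an e-locally *)
(* nilpotent module; the induction on k passes from x to e x.                         *)
Lemma sl2_inj J a x m k : lie_ideal br J -> wt br H a x -> km_eval a hi = m%:R ->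
  J (iter k (br (E i)) x) -> J (iter m (br (G i)) x) -> J x.
Proof.
move=> HJ; elim: k => // k IH in a x m *.
move=> wx am JE JG.
have JEx : J (br (E i) x).
  apply: (IH (simple i + a) _ m.+2).
  - apply: (wt_br Lie) => //; exact: (wtE C).
  - rewrite km_evalD am km_eval_coroot pairing_simple Aii.
    by rewrite -![in RHS]natr1; ring.
  - by rewrite -iterSr.
  - have -> : iter m.+2 (br (G i)) (br (E i) x) =
        br (E i) (iter m.+2 (br (G i)) x) -
        (m.+2%:R * (km_eval a hi - m.+1%:R)) *: iter m.+1 (br (G i)) x.
      by rewrite (sl2_commutation m.+1 wx) addrK.
    apply: (lie_idealBB HJ).
      by apply: (lie_idealB HJ); rewrite !iterS; do 2 apply: (lie_idealB HJ).
    by apply: (lie_idealZ HJ); rewrite iterS; apply: (lie_idealB HJ).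
(* With e x in J, applying e to f^(p+1) x gives a nonzero multiple of f^p x modulo J, because p < m;
   so one descends from f^m x to x. *)
elim: m am JG {IH} => // m' IHm am JG.
have {}IHm : forall k, (k <= m'.+1)%N -> J (iter (m'.+1 - k) (br (G i)) x).
  elim=> [_|j IHj jm]; first by rewrite subn0.
  have {IHj} := IHj (ltnW jm).
  rewrite -(subnSK jm); set p := (m'.+1 - j.+1)%N => Jp.
  have pm : (p < m'.+1)%N by rewrite /p; lia.
  have c0 : p.+1%:R * (km_eval a hi - p%:R) != 0.
    by rewrite mulf_neq0 ?pnatr_eq0 // am subr_eq0 eqr_nat; lia.
  apply: (lie_idealZK HJ c0).
  have -> : (p.+1%:R * (km_eval a hi - p%:R)) *: iter p (br (G i)) x =
     br (E i) (iter p.+1 (br (G i)) x) - iter p.+1 (br (G i)) (br (E i) x).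
    by rewrite (sl2_commutation p wx) addrAC subrr add0r.
  by apply: (lie_idealBB HJ); [apply: (lie_idealB HJ)|apply: (@lie_ideal_iter _ _ br J _ _ _ HJ)].
by have := IHm m'.+1 (leqnn _); rewrite subnn.
Qed.
End Sl2.
End Integrability.

Section Nilpotence.
Variables (F : numFieldType) (L : lmodType F) (br : L -> L -> L) (n : nat).
Variables (A : 'M[int]_n) (E G : 'I_n -> L) (H : km_h F A -> L).
Hypothesis Lie : lie_axioms br.
Hypothesis C : chev br E G H.
Hypothesis sl : simply_laced A.
Implicit Types (a b : 'rV[int]_n) (x y z : L).

Lemma sl_diag i : A i i = 2. Proof. by case: sl => -[]. Qed.
Lemma sl_off i j : i != j -> A i j <= 0. Proof. by case: sl => -[_ + _] _; apply. Qed.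
Lemma sl_sym i j : A i j = A j i.
Proof. by case: sl => _ /matrixP /(_ i j); rewrite mxE. Qed.

Inductive e_span (v : L) : L -> Prop :=
| espan_base : e_span v v
| espan0 : e_span v 0
| espanD x y : e_span v x -> e_span v y -> e_span v (x + y)
| espanZ c x : e_span v x -> e_span v (c *: x)
| espanE i x : e_span v x -> e_span v (br (E i) x).

(* The ideal generated by such a v is spanned by vectors of positive weight, hence misses h. *)
Lemma e_span_nul v a : mono br E a v -> (forall k, br (G k) v = 0) -> nul br H v.
Proof.
move=> mv Gv; have wv := mono_wt Lie C mv.
have spanH h x : e_span v x -> e_span v (br (H h) x).
  elim=> [||{}x y _ IHx _ IHy|c {}x _ IHx|i {}x sx IHx].
  - by rewrite wv; apply/espanZ/espan_base.
  - by rewrite (lie_0r Lie); apply: espan0.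
  - by rewrite (lie_Dr Lie); apply: espanD.
  - by rewrite (lie_Zr Lie); apply: espanZ.
  - rewrite (lie_deriv Lie) (chev_he C) (lie_Zl Lie).
    by apply: espanD; [apply/espanZ/espanE|apply: espanE].
have spanG k x : e_span v x -> e_span v (br (G k) x).
  elim=> [||{}x y _ IHx _ IHy|c {}x _ IHx|i {}x sx IHx].
  - by rewrite Gv; apply: espan0.
  - by rewrite (lie_0r Lie); apply: espan0.
  - by rewrite (lie_Dr Lie); apply: espanD.
  - by rewrite (lie_Zr Lie); apply: espanZ.
  - rewrite (lie_deriv Lie) (lie_anti Lie (G k)) (lie_Nl Lie).
    apply: espanD; last exact: espanE.
    rewrite -scaleN1r; apply: espanZ.
    have [->|ik] := eqVneq i k; first by rewrite (chev_eg C); apply: spanH.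
    by rewrite (chev_eg0 C ik) (lie_0l Lie); apply: espan0.
have I : lie_ideal br (e_span v).
  split; [exact: espan0|exact: espanD|exact: espanZ|].
  move=> x; move: x; apply: (chev_gen C).
  - by move=> y _; rewrite (lie_0l Lie); apply: espan0.
  - by move=> x y IHx IHy z sz; rewrite (lie_Dl Lie); apply: espanD; auto.
  - by move=> c x IHx z sz; rewrite (lie_Zl Lie); apply: espanZ; auto.
  - move=> x y IHx IHy z sz.
    have -> : br (br x y) z = br x (br y z) + (-1) *: br y (br x z).
      by rewrite (lie_deriv Lie) scaleN1r addrK.
    by apply: espanD; [|apply: espanZ]; auto.
  - by move=> i y; apply: espanE.
  - by move=> i y; apply: spanG.
  - by move=> h y; apply: spanH.
have ideal0 : lie_ideal br (eq 0).
  split=> // [x y <- <-|c x <-|x y <-]; first by rewrite addr0.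
    by rewrite scaler0.
  by rewrite (lie_0r Lie).
exists (e_span v); split; [exact: I| |exact: espan_base].
move=> h sh.
have [s [ms Hs]] : dec (mono br E) (H h).
  elim: sh => [||x y _ IHx _ IHy|c x _ IHx|i x sx IHx].
  - exact: dec1 mv.
  - exact: dec0.
  - exact: decD.
  - case: IHx => s [ms ->]; rewrite scaler_sumr; apply: dec_sum => t /ms m.
    by apply: (@dec1 _ _ _ _ t.1); apply: mono_scale.
  - apply: (dec_br Lie) IHx => b z mz.
    by apply: (@dec1 _ _ _ _ (simple i + b)); apply: mono_step.
have := @graded F L br n A H Lie (eq 0) ideal0 ((0, - H h) :: s) 0.
rewrite !big_cons -Hs eqxx addNr /= => /(_ _ erefl) e.
have s0 : \sum_(t <- s | t.1 == 0) t.2 = 0.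
  rewrite big_seq_cond big1 // => t /andP[/ms /mono_pos[_ ht] /eqP t0].
  by move: ht; rewrite t0 /height big1 ?ltxx // => i _; rewrite mxE.
apply/eqP; rewrite -oppr_eq0; apply/eqP; rewrite -[LHS]addr0 -s0 -e // => t.
rewrite inE => /orP[/eqP -> /=|/ms]; last exact: (mono_wt Lie C).
by rewrite -scaleN1r; apply/(wtZ Lie)/(wtH C).
Qed.

(** The vector is killed by every f_k. For k = i the coefficient in [sl2_commutation] vanishes
    exactly at this exponent; for k = j the bracket [f_j, e_j] lies in h, where two applications of
    ad e_i give 0, and a single one does if a_ij = 0. *)
Lemma serre i j : i != j -> nul br H (iter (absz (1 - A i j)) (br (E i)) (E j)).
Proof.
move=> ij; set m := absz _.
have Am : A i j = 1 - m%:Z by have := sl_off ij; rewrite /m; lia.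
have mono_it k : exists a, mono br E a (iter k (br (E i)) (E j)).
  elim: k => [|k [a IH]]; first by exists (simple j); apply: mono_base.
  by exists (simple i + a); apply: mono_step.
have [a ma] := mono_it m; apply: (e_span_nul ma) => k.
have CS := chev_swap Lie C.
have [->|ki] := eqVneq k i.
  have m0 : (0 < m)%N by have := sl_off ij; rewrite /m; lia.
  rewrite -(prednK m0).
  have wj : wt br (fun h => H (- h)) (- simple j) (E j).
    by apply/wt_swap; rewrite opprK; apply: (wtE C).
  rewrite (sl2_commutation Lie CS (sl_diag i) m.-1 wj).
  rewrite (chev_eg0 CS ij).
  have -> : iter m.-1.+1 (br (E i)) 0 = 0.
    by elim: (m.-1.+1) => //= p ->; rewrite (lie_0r Lie).
  rewrite km_evalN km_eval_coroot pairing_simple Am.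
  have -> : - (1 - m%:Z)%:~R - m.-1%:R = 0 :> F.
    have -> : 1 - m%:Z = - m.-1%:Z by lia.
    by rewrite rmorphN /= opprK -pmulrn subrr.
  by rewrite mulr0 scale0r addr0.
have comm x : br (G k) (br (E i) x) = br (E i) (br (G k) x).
  by rewrite (lie_deriv Lie) (chev_eg0 CS ki) (lie_0l Lie) add0r.
have -> : br (G k) (iter m (br (E i)) (E j)) = iter m (br (E i)) (br (G k) (E j)).
  by elim: m {Am ma} => //= p IH; rewrite comm IH.
have [->|kj] := eqVneq k j; last first.
  by rewrite (chev_eg0 CS kj); elim: m {Am ma} => //= p ->; rewrite (lie_0r Lie).
rewrite (chev_eg CS).
have step h : br (E i) (H h) = - km_eval (simple i) h *: E i.
  by rewrite (lie_anti Lie) (chev_he C) scaleNr.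
have [m2|m2] := leqP 2 m.
  rewrite -(subnK m2) iterD /= step (lie_Zr Lie) (lie_xx Lie) scaler0.
  by elim: (m - 2)%N => //= p ->; rewrite (lie_0r Lie).
have m1 : m = 1%N by have := sl_off ij; lia.
rewrite m1 /= step km_eval_opp km_eval_coroot pairing_simple sl_sym Am m1.
by rewrite subrr /= !oppr0 scale0r.
Qed.

(** By [lie_iter_bracket] the x with this property form a subalgebra, so it is enough to look at
    generators; the Serre relations settle e_j. *)
Lemma nil_E i x : exists k, nul br H (iter k (br (E i)) x).
Proof.
have NI := nul_ideal Lie C.
have mon k m y : nul br H (iter k (br (E i)) y) -> nul br H (iter (m + k) (br (E i)) y).
  by move=> Nk; rewrite iterD; apply: (@lie_ideal_iter _ _ br _ _ _ _ NI).
move: x; apply: (chev_gen C).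
- by exists 0%N; apply: (lie_ideal0 NI).
- move=> x y [k Nk] [m Nm]; exists (m + k)%N.
  have -> : iter (m + k) (br (E i)) (x + y) = iter (m + k) (br (E i)) x + iter (m + k) (br (E i)) y.
    by elim: (m + k)%N => //= p ->; rewrite (lie_Dr Lie).
  by apply: (lie_idealD NI); [apply: mon|rewrite addnC; apply: mon].
- move=> c x [k Nk]; exists k.
  have -> : iter k (br (E i)) (c *: x) = c *: iter k (br (E i)) x.
    by elim: k {Nk} => //= p ->; rewrite (lie_Zr Lie).
  exact: (lie_idealZ NI).
- by move=> x y [k Nk] [m Nm]; exists (k + m)%N; apply: (lie_iter_bracket Lie NI).
- move=> j; have [->|ij] := eqVneq i j.
    by exists 1%N; rewrite /= (lie_xx Lie); apply: (lie_ideal0 NI).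
  by exists (absz (1 - A i j)); apply: serre.
- have step h : br (E i) (H h) = - km_eval (simple i) h *: E i.
    by rewrite (lie_anti Lie) (chev_he C) scaleNr.
  move=> j; have [<-|ij] := eqVneq i j; last first.
    by exists 1%N; rewrite /= (chev_eg0 C ij); apply: (lie_ideal0 NI).
  exists 3%N; rewrite /= (chev_eg C) step (lie_Zr Lie) (lie_xx Lie) scaler0.
  exact: (lie_ideal0 NI).
- move=> h; exists 2%N; rewrite /= (lie_anti Lie (E i) (H h)) (chev_he C) (lie_Nr Lie).
  rewrite (lie_Zr Lie) (lie_xx Lie) scaler0 oppr0; exact: (lie_ideal0 NI).
Qed.
End Nilpotence.

Section Roots.
Variables (F : numFieldType) (L : lmodType F) (br : L -> L -> L) (n : nat).
Variables (A : 'M[int]_n) (E G : 'I_n -> L) (H : km_h F A -> L).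
Hypothesis Lie : lie_axioms br.
Hypothesis C : chev br E G H.
Hypothesis sl : simply_laced A.
Implicit Types (a b : 'rV[int]_n) (x y z : L).
Local Notation lroot := (lroot br H).
Local Notation nul := (nul br H).
Let NI := nul_ideal Lie C.
Let CS := chev_swap Lie C.

Lemma simple_neq0 (i : 'I_n) : simple i <> 0.
Proof. by move/rowP/(_ i)/eqP; rewrite /simple !mxE !eqxx. Qed.

Lemma lroot_simple i : lroot (simple i).
Proof.
apply/(lrootP Lie C); split; first exact: simple_neq0.
exists (E i); split; first exact/Or31/mono_base.
move=> [J [I d JE]].
have /(chev_inj C)/rowP/(_ (lshift _ i))/eqP : H (km_coroot F A i) = 0.
  apply: d; rewrite -(chev_eg C) (lie_anti Lie); apply: (lie_idealN I).
  exact: (lie_idealB I).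
by rewrite !mxE !eqxx oner_eq0.
Qed.

Lemma lroot_sign a : lroot a -> nonneg a \/ nonneg (- a).
Proof.
case/(lrootP Lie C) => a0 [x [[/mono_pos[p _]|/mono_pos[p _]|[//]] nx]].
  by left.
by right.
Qed.

Lemma lroot_multiple i k : lroot (simple i *+ k) \/ lroot (- (simple i *+ k)) -> k = 1%N.
Proof.
have N0 := lie_ideal0 NI.
have hk : height (simple i *+ k : 'rV[int]_n) = k%:Z.
  elim: k => [|k IH]; last by rewrite mulrS heightD IH height_simple; lia.
  by rewrite mulr0n /height big1 // => j _; rewrite mxE.
have hN a : height (- a) = - height a.
  by rewrite /height -sumrN; apply: eq_bigr => j _; rewrite mxE.
case=> /(lrootP Lie C) [a0 [x [[m|m|[//]] nx]]].
- by case: (mono_simple Lie m erefl) => [x0|[//]]; rewrite x0 in nx.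
- by have [_] := mono_pos m; rewrite hN hk; lia.
- by have [_] := mono_pos m; rewrite hN hk; lia.
- move: m; rewrite opprK => m.
  by case: (mono_simple Lie m erefl) => [x0|[//]]; rewrite x0 in nx.
Qed.

Lemma lroot_wt a : a <> 0 -> (exists x, wt br H a x /\ ~ nul x) -> lroot a.
Proof.
move=> a0 [x [wx nx]]; split=> //; exists x; split=> // h.
by rewrite wx subrr; apply: (lie_ideal0 NI).
Qed.

(** With p the pairing of a with alpha_i^vee and p >= 0, the vector f_i^p x has weight s_i a and is
    not null by [sl2_inj]; the Chevalley involution handles p < 0. This replaces exponentials of ad
    e_i. *)
Lemma lroot_refl i a : lroot a -> lroot (refl A i a).
Proof.
move=> ra; apply: lroot_wt.
  have [a0 _] := ra; move=> e; apply: a0.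
  have : pairing A (simple i) (refl A i a) = 0.
    by rewrite e pairing0r.
  rewrite /refl !pairingE pairing_simple (sl_diag sl) => e'.
  by rewrite /refl (_ : pairing A _ a = 0) ?scale0r ?subr0 // in e; lia.
have [a0 [x [cx nx]]] := (lrootP Lie C a).1 ra.
have wx := comp_wt Lie C cx.
have ev := km_eval_coroot F A a i.
rewrite /refl; set p := pairing A (simple i) a in ev *.
have [p0|p0] := leP 0 p.
  exists (iter (absz p) (br (G i)) x); split.
    have -> : p *: simple i = simple i *+ absz p.
      by rewrite -{1}(gez0_abs p0) -scaler_nat natz.
    exact: (wt_iterG Lie C).
  move=> N; apply: nx; have [k Nk] := nil_E Lie C sl i x.
  apply: (sl2_inj Lie C (sl_diag sl i) NI wx _ Nk N).
  by rewrite ev pmulrn gez0_abs.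
have w : wt br (fun h => H (- h)) (- a) x by apply/wt_swap; rewrite opprK.
exists (iter (absz p) (br (E i)) x); split.
  have -> : p *: simple i = - (simple i *+ absz p).
    by rewrite -scaler_nat natz -scaleNr; congr (_ *: _); lia.
  rewrite opprK.
  by have /wt_swap := wt_iterG Lie CS i (absz p) w; rewrite opprB opprK addrC.
move=> N; apply: nx; have [k /nul_swap Nk] := nil_E Lie CS sl i x.
apply: (sl2_inj Lie CS (sl_diag sl i) NI w _ Nk N).
by rewrite km_evalN ev -rmorphN /= pmulrn; congr (_%:~R); lia.
Qed.

(** If e_i x were null, so would be e_i^|p| x, against [sl2_inj] with e_i and f_i exchanged. *)
Lemma lroot_add i a : lroot a -> pairing A (simple i) a < 0 -> a + simple i <> 0 ->
  lroot (a + simple i).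
Proof.
move=> ra p0 n0; apply: lroot_wt => //.
have [a0 [x [cx nx]]] := (lrootP Lie C a).1 ra.
have wx := comp_wt Lie C cx.
have ev := km_eval_coroot F A a i.
set p := pairing A (simple i) a in ev p0.
exists (br (E i) x); split; first by rewrite addrC; apply: (wt_br Lie) => //; apply: (wtE C).
move=> N; apply: nx; have [k /nul_swap Nk] := nil_E Lie CS sl i x.
have w : wt br (fun h => H (- h)) (- a) x by apply/wt_swap; rewrite opprK.
apply: (sl2_inj Lie CS (sl_diag sl i) NI w (m := absz p) _ Nk).
  by rewrite km_evalN ev -rmorphN /= pmulrn; congr (_%:~R); lia.
have -> : absz p = (absz p).-1.+1 by lia.
by rewrite iterSr; apply: (@lie_ideal_iter _ _ br _ _ _ _ NI).
Qed.
End Roots.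

(** * Roots *)

Section WordModule.
Variables (F : numFieldType) (n : nat) (A : 'M[int]_n) (lam : km_h F A -> F).
Hypothesis lamD : forall h k, lam (h + k) = lam h + lam k.
Hypothesis lamZ : forall c h, lam (c *: h) = c * lam h.
Local Notation V := (seq 'I_n -> F).
Implicit Types (f g : V) (w : seq 'I_n) (h : km_h F A).

(* Functions on words; this is dual to the Verma module of highest weight lam of the free *)
(* algebra on the f_i, on which f_i acts by prepending the letter i.                       *)
Definition word_wt w h := lam h - \sum_(j <- w) km_eval (simple j) h.

(** The transpose of e_i on the Verma module: e_i deletes one letter i, with coefficient the weight
    of the tail at alpha_i^vee. Exchanging e and f under transposition keeps this a left action. *)
Fixpoint word_f (i : 'I_n) f w : F :=
  if w is j :: u then
    (i == j)%:R * word_wt u (km_coroot F A i) * f u + word_f i (fun v => f (j :: v)) u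
  else 0.

Fixpoint word_act (t : km_term F A) : V -> V :=
  match t with
  | KmE i => fun f w => f (i :: w)
  | KmF i => word_f i
  | KmH h => fun f w => word_wt w h * f w
  | Km0 => fun _ _ => 0
  | KmAdd x y => fun f w => word_act x f w + word_act y f w
  | KmScale c x => fun f w => c * word_act x f w
  | KmBr x y => fun f w => word_act x (word_act y f) w - word_act y (word_act x f) w
  end.

Lemma word_f_linear i c f g w :
  word_f i (fun v => c * f v + g v) w = c * word_f i f w + word_f i g w.
Proof.
elim: w f g => [|j w IH] f g /=; first by rewrite mulr0 addr0.
by rewrite (IH (fun v => f (j :: v)) (fun v => g (j :: v))); ring.
Qed.

Lemma word_act_linear t c f g w :
  word_act t (fun v => c * f v + g v) w = c * word_act t f w + word_act t g w.
Proof.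
elim: t f g w => [i|i|h||x IHx y IHy|d x IHx|x IHx y IHy] f g w //=.
- exact: word_f_linear.
- by ring.
- by rewrite mulr0 addr0.
- by rewrite IHx IHy; ring.
- by rewrite IHx; ring.
- have e z k u : (forall f g w, word_act z (fun v => c * f v + g v) w
      = c * word_act z f w + word_act z g w) ->
      word_act k (word_act z (fun v => c * f v + g v)) u =
      word_act k (fun v => c * word_act z f v + word_act z g v) u.
    by move=> h; congr (word_act k _ u); apply: funext => v; apply: h.
  by rewrite (e y) // IHx (e x) // IHy; ring.
Qed.

Lemma word_actD t f g w :
  word_act t (fun v => f v + g v) w = word_act t f w + word_act t g w.
Proof.
have := word_act_linear t 1 f g w; rewrite mul1r => <-.
by congr (word_act t _ w); apply: funext => v; rewrite mul1r.
Qed.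

Lemma word_act0 t w : word_act t (fun=> 0) w = 0.
Proof.
have := word_actD t (fun=> 0) (fun=> 0) w.
have -> : (fun=> 0 + 0) = (fun=> 0) :> V by apply: funext => v; rewrite addr0.
by move/eqP; rewrite -subr_eq subrr eq_sym => /eqP.
Qed.

Lemma word_actZ t c f w :
  word_act t (fun v => c * f v) w = c * word_act t f w.
Proof.
have := word_act_linear t c f (fun=> 0) w; rewrite word_act0 addr0 => <-.
by congr (word_act t _ w); apply: funext => v; rewrite addr0.
Qed.

Lemma word_actB t f g w :
  word_act t (fun v => f v - g v) w = word_act t f w - word_act t g w.
Proof.
have := word_act_linear t (-1) g f w; rewrite mulN1r addrC => <-.
by congr (word_act t _ w); apply: funext => v; rewrite mulN1r addrC.
Qed.

Lemma word_wt_cons j w h : word_wt (j :: w) h = word_wt w h - km_eval (simple j) h.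
Proof. by rewrite /word_wt big_cons; ring. Qed.

Lemma word_wt_f h i f w : word_wt w h * word_f i f w - word_f i (fun v => word_wt v h * f v) w
  = - km_eval (simple i) h * word_f i f w.
Proof.
elim: w f => [|j w IH] f /=; first by rewrite !mulr0 subr0.
have -> : word_f i (fun v => word_wt (j :: v) h * f (j :: v)) w =
   - km_eval (simple j) h * word_f i (fun v => f (j :: v)) w +
   word_f i (fun v => word_wt v h * f (j :: v)) w.
  rewrite -word_f_linear; congr word_f; apply: funext => v.
  by rewrite word_wt_cons; ring.
have := IH (fun v => f (j :: v)).
set Y := word_f i (fun v => word_wt v h * f (j :: v)) w.
set X := word_f i (fun v => f (j :: v)) w => IH'.
have -> : Y = word_wt w h * X + km_eval (simple i) h * X.
  by rewrite -[LHS](subKr (word_wt w h * X)) IH'; ring.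
rewrite word_wt_cons; case: eqVneq => [->|_] /=; ring.
Qed.

Lemma word_act_eq x y : km_eq x y -> word_act x = word_act y.
Proof.
elim=> {x y}.
- by [].
- by move=> x y _ ->.
- by move=> x y z _ -> _ ->.
- by move=> x x' y y' _ + _ + /= => -> ->.
- by move=> c x x' _ /= ->.
- by move=> x x' y y' _ + _ + /= => -> ->.
- by move=> x y z; apply: funext => f; apply: funext => w /=; ring.
- by move=> x y; apply: funext => f; apply: funext => w /=; ring.
- by move=> x; apply: funext => f; apply: funext => w /=; ring.
- by move=> x; apply: funext => f; apply: funext => w /=; ring.
- by move=> c d x; apply: funext => f; apply: funext => w /=; ring.
- by move=> x; apply: funext => f; apply: funext => w /=; ring.
- by move=> c x y; apply: funext => f; apply: funext => w /=; ring.
- by move=> c d x; apply: funext => f; apply: funext => w /=; ring.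
- by move=> x y z; apply: funext => f; apply: funext => w /=; rewrite word_actD; ring.
- by move=> x y z; apply: funext => f; apply: funext => w /=; rewrite word_actD; ring.
- by move=> c x y; apply: funext => f; apply: funext => w /=; rewrite word_actZ; ring.
- by move=> c x y; apply: funext => f; apply: funext => w /=; rewrite word_actZ; ring.
- by move=> x; apply: funext => f; apply: funext => w /=; ring.
- by move=> x y z; apply: funext => f; apply: funext => w /=; rewrite !word_actB; ring.
- move=> h k; apply: funext => f; apply: funext => w /=.
  rewrite /word_wt lamD; under eq_bigr do rewrite km_eval_add.
  by rewrite big_split /=; ring.
- move=> c h; apply: funext => f; apply: funext => w /=.
  rewrite /word_wt lamZ; under eq_bigr do rewrite km_eval_scale.
  by rewrite -mulr_sumr; ring.
- move=> i; apply: funext => f; apply: funext => w /=; rewrite eqxx /=; ring.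
- move=> i j ij; apply: funext => f; apply: funext => w /=.
  by rewrite eq_sym (negPf ij) /=; ring.
- by move=> h k; apply: funext => f; apply: funext => w /=; ring.
- by move=> h i; apply: funext => f; apply: funext => w /=; rewrite word_wt_cons; ring.
- by move=> h i; apply: funext => f; apply: funext => w /=; rewrite word_wt_f.
Qed.
End WordModule.

(** * Roots of g(A) *)

Section KacMoodyRoots.
Variables (F : numFieldType) (n : nat) (A : 'M[int]_n).
Local Notation T := (km_term F A).
Local Notation L := (kmalg F A).
Local Notation br := (@qbr F n A).
Let E (i : 'I_n) : L := kmpi (KmE F A i).
Let G (i : 'I_n) : L := kmpi (KmF F A i).
Let H (h : km_h F A) : L := kmpi (KmH h).

(** For lam the j-th coordinate, h multiplies the value of the constant function 1 at the empty word
    by h_j. *)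
Lemma km_h_inj (h : km_h F A) : km_eq (KmH h) (Km0 F A) -> h = 0.
Proof.
move=> e; apply/rowP => j; rewrite mxE.
have := @word_act_eq F n A (fun k => k 0 j) _ _ _ _ e.
move=> /(_ (fun h k => mxE _ _ _ _) (fun c h => mxE _ _ _ _)).
move=> /(congr1 (fun p => p (fun=> 1) [::])) /=.
by rewrite /word_wt big_nil subr0 mulr1.
Qed.

Lemma qbr_lie : lie_axioms br.
Proof.
split.
- move=> a b c; have [[x ->] [y ->] [z ->]] := And3 (kmpi_surj a) (kmpi_surj b) (kmpi_surj c).
  by have /kmpiP := km_brDl x y z; rewrite !(kmpiB, kmpiD).
- move=> a b c; have [[x ->] [y ->] [z ->]] := And3 (kmpi_surj a) (kmpi_surj b) (kmpi_surj c).
  by have /kmpiP := km_brDr x y z; rewrite !(kmpiB, kmpiD).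
- move=> c a b; have [[x ->] [y ->]] := conj (kmpi_surj a) (kmpi_surj b).
  by have /kmpiP := km_brZl c x y; rewrite !(kmpiB, kmpiZ).
- move=> c a b; have [[x ->] [y ->]] := conj (kmpi_surj a) (kmpi_surj b).
  by have /kmpiP := km_brZr c x y; rewrite !(kmpiB, kmpiZ).
- by move=> a; have [x ->] := kmpi_surj a; have /kmpiP := km_brxx x; rewrite !kmpiB.
- move=> a b c; have [[x ->] [y ->] [z ->]] := And3 (kmpi_surj a) (kmpi_surj b) (kmpi_surj c).
  by have /kmpiP := km_jacobi x y z; rewrite !(kmpiB, kmpiD).
Qed.

Lemma kmalg_chev : chev br E G H.
Proof.
split.
- by move=> h k; have /kmpiP := km_hD h k; rewrite kmpiD.
- by move=> c h; have /kmpiP := km_hZ c h; rewrite kmpiZ.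
- by move=> i; have /kmpiP := km_efd F A i; rewrite kmpiB.
- by move=> i j ij; have /kmpiP := km_ef F A ij; rewrite kmpiB.
- by move=> h k; have /kmpiP := km_hh h k; rewrite kmpiB.
- by move=> h i; have /kmpiP := km_he h i; rewrite kmpiB kmpiZ.
- by move=> h i; have /kmpiP := km_hf h i; rewrite kmpiB kmpiZ.
- move=> P P0 PD PZ PB PE PG PH a; have [x ->] := kmpi_surj a.
  elim: x => [i|i|h||x IHx y IHy|c x IHx|x IHx y IHy].
  + exact: PE.
  + exact: PG.
  + exact: PH.
  + exact: P0.
  + by rewrite kmpiD; apply: PD.
  + by rewrite kmpiZ; apply: PZ.
  + by rewrite kmpiB; apply: PB.
- by move=> h; rewrite -kmpi0 => /kmpiP /km_h_inj.
Qed.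

Lemma km_nullE (x : T) : km_null x <-> nul br H (kmpi x).
Proof.
split=> -[J [I d Jx]].
  exists (fun a => exists2 y, a = kmpi y & J y); split; last by exists x.
    split.
    - by exists (Km0 F A) => //; apply: km_ideal0 I.
    - by move=> _ _ [y -> Jy] [z -> Jz]; exists (KmAdd y z); rewrite ?kmpiD //; apply: km_idealD I _ _ _ _.
    - by move=> c _ [y -> Jy]; exists (KmScale c y); rewrite ?kmpiZ //; apply: km_idealZ I _ _ _.
    - move=> a _ [y -> Jy]; have [z ->] := kmpi_surj a.
      by exists (KmBr z y); rewrite ?kmpiB //; apply: km_idealB I _ _ _.
  move=> h [y /kmpiP hy Jy]; rewrite /H -kmpi0; apply/kmpiP/d.
  exact: km_idealE I _ _ (km_sym hy) Jy.
exists (fun y => J (kmpi y)); split=> //.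
  split.
  - by move=> y z /kmpiP ->.
  - exact: lie_ideal0 I.
  - by move=> y z Jy Jz; rewrite kmpiD; apply: (lie_idealD I).
  - by move=> c y Jy; rewrite kmpiZ; apply: (lie_idealZ I).
  - by move=> y z Jz; rewrite kmpiB; apply: (lie_idealB I).
by move=> h /d; rewrite /H -kmpi0 => /kmpiP.
Qed.

Lemma km_rootE a : km_root F A a <-> lroot br H a.
Proof.
split=> -[a0 [x [xa nx]]]; split=> //.
  exists (kmpi x); split; last by move=> /km_nullE.
  by move=> h; have /km_nullE := xa h; rewrite kmpiD kmpiB kmpiZ scaleNr.
have [y e] := kmpi_surj x; rewrite {}e in xa nx.
exists y; split; last by move=> /km_nullE.
by move=> h; apply/km_nullE; rewrite kmpiD kmpiB kmpiZ scaleNr; apply: xa.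
Qed.

Hypothesis sl : simply_laced A.

Lemma km_root_simple i : km_root F A (simple i).
Proof. by apply/km_rootE; apply: (lroot_simple qbr_lie kmalg_chev). Qed.

Lemma km_root_sign a : km_root F A a -> nonneg a \/ nonneg (- a).
Proof. by move/km_rootE; apply: (lroot_sign qbr_lie kmalg_chev). Qed.

Lemma km_root_multiple i k :
  km_root F A (simple i *+ k) \/ km_root F A (- (simple i *+ k)) -> k = 1%N.
Proof. by move=> rk; apply: (lroot_multiple qbr_lie kmalg_chev (i := i)); case: rk => /km_rootE; [left|right]. Qed.

Lemma km_root_refl i a : km_root F A a -> km_root F A (refl A i a).
Proof. by move/km_rootE/(lroot_refl qbr_lie kmalg_chev sl i)/km_rootE. Qed.

Lemma km_root_add i a : km_root F A a -> pairing A (simple i) a < 0 ->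
  a + simple i <> 0 -> km_root F A (a + simple i).
Proof. by move/km_rootE=> ra p0 n0; apply/km_rootE/(lroot_add qbr_lie kmalg_chev sl). Qed.
End KacMoodyRoots.

(** * The root lattice and the Weyl group *)

Section Form.
Variables (n : nat) (A : 'M[int]_n).
Hypothesis sl : simply_laced A.
Local Notation V := 'rV[int]_n.
Local Notation B := (pairing A).
Implicit Types (x y z a b : V) (i j : 'I_n) (w u : seq 'I_n).

Lemma pairingC x y : (B x y) = (B y x).
Proof.
rewrite /pairing -[LHS]trace_mx11 -mxtrace_tr trace_mx11 !trmx_mul trmxK mulmxA.
by have [_ ->] := sl.
Qed.

Lemma simpleE i j : (simple i : V) 0 j = (j == i)%:R.
Proof. by rewrite /simple mxE. Qed.

Lemma row_simple x : x = \sum_i x 0 i *: simple i.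
Proof. exact: row_sum_delta. Qed.

Lemma pairing_suml (I : Type) (r : seq I) (P : pred I) (f : I -> V) y :
  B (\sum_(i <- r | P i) f i) y = \sum_(i <- r | P i) B (f i) y.
Proof. exact: (big_morph (fun x => (B x y)) (fun x x' => pairingDl A x x' y) (pairing0l A y)). Qed.

Lemma pairing_coord x y : (B x y) = \sum_i x 0 i * (B (simple i) y).
Proof.
rewrite {1}(row_simple x) pairing_suml; apply: eq_bigr => i _.
by rewrite pairingZl.
Qed.

Lemma pairing_simple_coord i x : (B (simple i) x) = \sum_j A i j * x 0 j.
Proof.
rewrite pairingC pairing_coord; apply: eq_bigr => j _.
by rewrite pairing_simple (sl_sym sl) mulrC.
Qed.

Lemma norm_simple i : (B (simple i) (simple i)) = 2.
Proof. by rewrite pairing_simple (sl_diag sl). Qed.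

Lemma norm_even x : exists m, (B x x) = 2 * m.
Proof.
rewrite (row_simple x); elim/big_ind: _ => [|y z [k yk] [m zm]|i _].
- by exists 0; rewrite pairing0l.
- exists (k + m + (B y z)).
  by rewrite pairingDl !pairingDr yk zm (pairingC z y); lia.
- by exists (x 0 i * x 0 i); rewrite pairingZl pairingZr norm_simple; lia.
Qed.

Lemma reflD i x y : refl A i (x + y) = refl A i x + refl A i y.
Proof. by rewrite /refl pairingDr scalerDl opprD addrACA. Qed.
Lemma reflZ i c x : refl A i (c *: x) = c *: refl A i x.
Proof. by rewrite /refl pairingZr scalerBr scalerA. Qed.
Lemma reflN i x : refl A i (- x) = - refl A i x.
Proof. by rewrite -!scaleN1r reflZ. Qed.
Lemma refl_simple i : refl A i (simple i) = - simple i.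
Proof. by rewrite /refl norm_simple scaler_nat mulr2n opprD addrA subrr add0r. Qed.
Lemma reflK i : involutive (refl A i).
Proof.
by move=> x; rewrite {2}/refl reflD reflN reflZ refl_simple /refl scalerN opprK subrK.
Qed.
Lemma refl_isom i x y : (B (refl A i x) (refl A i y)) = (B x y).
Proof.
rewrite /refl !(pairingE) norm_simple (pairingC x (simple i)); ring.
Qed.

Lemma weylD w x y : weyl A w (x + y) = weyl A w x + weyl A w y.
Proof. by elim: w => //= i w ->; rewrite reflD. Qed.
Lemma weylZ w c x : weyl A w (c *: x) = c *: weyl A w x.
Proof. by elim: w => //= i w ->; rewrite reflZ. Qed.
Lemma weylN w x : weyl A w (- x) = - weyl A w x.
Proof. by rewrite -!scaleN1r weylZ. Qed.
Lemma weylB w x y : weyl A w (x - y) = weyl A w x - weyl A w y.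
Proof. by rewrite weylD weylN. Qed.
Lemma weyl0 w : weyl A w 0 = 0.
Proof. by rewrite -(scale0r 0) weylZ !scale0r. Qed.
Lemma weyl_sum w (I : Type) (r : seq I) (P : pred I) (f : I -> V) :
  weyl A w (\sum_(i <- r | P i) f i) = \sum_(i <- r | P i) weyl A w (f i).
Proof. exact: (big_morph _ (weylD w) (weyl0 w)). Qed.
Lemma weyl_isom w x y : (B (weyl A w x) (weyl A w y)) = (B x y).
Proof. by elim: w => //= i w <-; rewrite refl_isom. Qed.
Lemma weyl_cat u w x : weyl A (u ++ w) x = weyl A u (weyl A w x).
Proof. by rewrite /weyl foldr_cat. Qed.
Lemma weyl_rcons w i x : weyl A (rcons w i) x = weyl A w (refl A i x).
Proof. by rewrite -cats1 weyl_cat. Qed.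
Lemma weyl_revK w x : weyl A (rev w) (weyl A w x) = x.
Proof.
elim: w x => //= i w IH x.
by rewrite rev_cons weyl_rcons reflK.
Qed.
Lemma weylK w x : weyl A w (weyl A (rev w) x) = x.
Proof. by rewrite -{1}(revK w) weyl_revK. Qed.
Lemma weyl_inj w : injective (weyl A w).
Proof. by move=> x y e; rewrite -(weyl_revK w x) e weyl_revK. Qed.

Lemma real_root_simple i : real_root A (simple i).
Proof. by exists [::], i. Qed.
Lemma real_root_weyl w b : real_root A b -> real_root A (weyl A w b).
Proof. by case=> u [i ->]; exists (w ++ u), i; rewrite weyl_cat. Qed.
Lemma real_root_refl i b : real_root A b -> real_root A (refl A i b).
Proof. exact: (real_root_weyl [:: i]). Qed.
Lemma real_root_opp b : real_root A b -> real_root A (- b).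
Proof.
case=> u [i ->]; rewrite -weylN -refl_simple.
by apply: real_root_weyl; apply/real_root_refl/real_root_simple.
Qed.
Lemma norm_real_root b : real_root A b -> (B b b) = 2.
Proof. by case=> u [i ->]; rewrite weyl_isom norm_simple. Qed.

Lemma real_root_reflection b : real_root A b ->
  exists w, forall x, weyl A w x = x - (B b x) *: b.
Proof.
case=> u [i ->]; exists (u ++ i :: rev u) => x.
rewrite weyl_cat /= /refl weylB weylZ weylK; congr (_ - _ *: _).
by rewrite -{2}(weylK u x) weyl_isom.
Qed.

Lemma real_root_km (F : numFieldType) b : real_root A b -> km_root F A b.
Proof.
case=> u [i ->]; elim: u => [|j u IH] /=; first exact: km_root_simple.
exact: km_root_refl.
Qed.

Lemma real_root_sign b : real_root A b -> nonneg b \/ nonneg (- b).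
(* Being a real root does not involve the field, so any field serves here. *)
Proof. by move/(real_root_km rat); apply: km_root_sign. Qed.

Lemma heightN x : height (- x) = - height x.
Proof. by rewrite /height -sumrN; apply: eq_bigr => j _; rewrite mxE. Qed.
Lemma heightZ c x : height (c *: x) = c * height x.
Proof. by rewrite /height mulr_sumr; apply: eq_bigr => j _; rewrite mxE. Qed.
Lemma height_ge0 x : nonneg x -> 0 <= height x.
Proof. by move=> x0; apply: sumr_ge0. Qed.
Lemma height_refl i x : height (refl A i x) = height x - (B (simple i) x).
Proof. by rewrite /refl heightD heightN heightZ height_simple mulr1. Qed.
Lemma refl_coord i x j : refl A i x 0 j = x 0 j - (B (simple i) x) * (j == i)%:R.
Proof. by rewrite !mxE. Qed.

(** Descent on the height: while some i has v_i > 0 and (alpha_i|v) > 0, the reflection s_i lowers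
    the height, and s_i v is negative only if v is a multiple of alpha_i, hence alpha_i itself. If
    no such i exists, (v|v) is a sum of nonpositive terms. *)
Lemma km_root_real_or (F : numFieldType) a :
  km_root F A a -> real_root A a \/ (B a a) <= 0.
Proof.
(* The sign c treats positive and negative roots at once: c v is the root, and v is nonnegative. *)
suff claim N v c : c = 1 \/ c = -1 -> nonneg v -> (absz (height v) < N)%N ->
    km_root F A (c *: v) -> real_root A (c *: v) \/ (B v v) <= 0.
  move=> ra; have [a0|a0] := km_root_sign ra.
    by have := @claim _ a 1 (or_introl erefl) a0 (ltnSn _); rewrite scale1r; apply.
  have := @claim _ (- a) (-1) (or_intror erefl) a0 (ltnSn _).
  by rewrite scaleN1r opprK !pairingE opprK; apply.
elim: N v => // N IH v c1 v0 hv rv.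
have [[i [vi ai]]|none] := pselect (exists i, 0 < v 0 i /\ 0 < (B (simple i) v)); last first.
  right; rewrite pairing_coord; apply: sumr_le0 => i _.
  have := v0 i; rewrite le_eqVlt => /orP[/eqP <-|vi]; first by rewrite mul0r.
  apply: mulr_ge0_le0; first exact: ltW.
  by rewrite leNgt; apply/negP => ai; apply: none; exists i.
have ru : km_root F A (c *: refl A i v) by rewrite -reflZ; apply: km_root_refl.
have [u0|u0] : nonneg (refl A i v) \/ nonneg (- refl A i v).
  by have := km_root_sign ru; case: c1 => ->; rewrite ?scale1r // scaleN1r opprK; case; auto.
- have hu := height_ge0 u0; have hv0 := height_ge0 v0.
  have hlt : (absz (height (refl A i v)) < N)%N by move: hu hv; rewrite height_refl; lia.
  have [/(real_root_refl i)|] := IH _ c1 u0 hlt ru; last by rewrite refl_isom; right.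
  by rewrite reflZ reflK; left.
- have ev : v = simple i *+ absz (v 0 i).
    apply/rowP => j; rewrite -scaler_nat !mxE natz (gez0_abs (v0 i)) eqxx /=.
    case: (eqVneq j i) => [->|ji]; first by rewrite mulr1.
    rewrite mulr0; have := u0 j; have := v0 j.
    by rewrite mxE refl_coord (negPf ji); lia.
  have e1 : absz (v 0 i) = 1%N.
    apply: (km_root_multiple (F := F) (A := A) (i := i)); rewrite -ev.
    by case: c1 rv => ->; rewrite ?scale1r ?scaleN1r; auto.
  rewrite e1 in ev; left; rewrite ev; case: c1 => ->; rewrite ?scale1r ?scaleN1r.
    exact: real_root_simple.
  by apply/real_root_opp/real_root_simple.
Qed.

End Form.

(** * Exchange condition, stabilizers and supports of real roots *)

Section Words.
Variables (n : nat) (A : 'M[int]_n).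
Hypothesis sl : simply_laced A.
Local Notation V := 'rV[int]_n.
Local Notation B := (pairing A).
Implicit Types (x y z a b : V) (i j : 'I_n) (w u : seq 'I_n) (J Y : {set 'I_n}).

Lemma norm2_witness b : nonneg b -> 0 < B b b ->
  exists i, 0 < b 0 i /\ 0 < B (simple i) b.
Proof.
move=> b0; apply: contraPP => /forallNP none; apply/negP; rewrite -leNgt pairing_coord //.
apply: sumr_le0 => i _; have := b0 i.
rewrite le_eqVlt => /orP[/eqP <-|bi]; first by rewrite mul0r.
apply: mulr_ge0_le0; first exact: ltW.
by rewrite leNgt; apply/negP => ai; apply: (none i).
Qed.

(** s_i changes only the i-th coordinate, so the other ones are both nonnegative and nonpositive;
    norm 2 then fixes the multiple of alpha_i. *)
Lemma refl_neg_simple v i : B v v = 2 -> nonneg v -> nonneg (- refl A i v) ->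
  v = simple i.
Proof.
move=> v2 v0 u0.
have ev : v = v 0 i *: simple i.
  apply/rowP => j; rewrite mxE simpleE.
  case: (eqVneq j i) => [->|ji]; first by rewrite mulr1.
  rewrite mulr0; have := u0 j; have := v0 j.
  by rewrite mxE refl_coord (negPf ji); lia.
have vi := v0 i; move: v2; rewrite {1 2}ev pairingZl pairingZr norm_simple // => v2.
suff v1 : v 0 i = 1 by rewrite ev v1 scale1r.
nia.
Qed.

(** Some letter j turns a positive root u(alpha_i) negative, so u(alpha_i) = alpha_j and s_j u s_i =
    u: this letter and s_i cancel. *)
Lemma exchange w i : nonneg (- weyl A w (simple i)) ->
  exists w', [/\ (size w' < size w)%N, {subset w' <= w} &
    forall x, weyl A w (refl A i x) = weyl A w' x].
Proof.
elim: w => [/(_ i)|j u IH neg] /=.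
  by rewrite mxE simpleE eqxx.
have rv : real_root A (weyl A u (simple i)) by apply/real_root_weyl/real_root_simple.
have [pos|/IH [u' [su uu e]]] := real_root_sign sl rv; last first.
  exists (j :: u'); split=> //= [k|x]; last by rewrite e.
  by rewrite !inE => /orP[->//|/uu ->]; rewrite orbT.
have ej := refl_neg_simple (norm_real_root sl rv) pos neg.
exists u; split=> // [k|x]; first by rewrite inE orbC => ->.
rewrite {2}/refl weylB // weylZ ej -(weyl_isom sl u) ej.
by rewrite -[X in refl A j X]/(refl A j (weyl A u x)) (reflK sl).
Qed.

Lemma weyl_coord w x j : j \notin w -> weyl A w x 0 j = x 0 j.
Proof.
elim: w => //= i w IH; rewrite inE negb_or => /andP[ji /IH e].
by rewrite refl_coord (negPf ji) mulr0 subr0.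
Qed.

(** Write the word as w s_i. If w(alpha_i) < 0, exchange shortens it. Otherwise -(alpha_i|lam) is
    the pairing of the positive root w(alpha_i) with the antidominant image of lam, so (alpha_i|lam)
    >= 0 and must be 0. The set J allows a second use inside a stabilizer. *)
Lemma weyl_stabilizer J w lam : {subset w <= J} ->
  (forall j, j \in J -> B (simple j) lam <= 0) ->
  (forall j, j \in J -> B (simple j) (weyl A w lam) <= 0) ->
  weyl A w lam = lam /\ exists w',
    {subset w' <= [set j in J | B (simple j) lam == 0]} /\
    forall x, weyl A w x = weyl A w' x.
Proof.
have [N] := ubnP (size w); elim: N w => // N IH w.
case/lastP: w => [|w i] sN wJ lJ mJ; first by split=> //; exists [::].
have iJ : i \in J by apply: wJ; rewrite mem_rcons mem_head.
have {}wJ : {subset w <= J} by move=> k kw; apply: wJ; rewrite mem_rcons inE kw orbT.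
rewrite size_rcons ltnS in sN.
have rv : real_root A (weyl A w (simple i)) by apply/real_root_weyl/real_root_simple.
have [pos|neg] := real_root_sign sl rv; last first.
  have [u [su uw e]] := exchange neg.
  have eu x : weyl A (rcons w i) x = weyl A u x by rewrite weyl_rcons e.
  have [||||el [w' [w'J e']]] := IH u => //.
  - exact: leq_trans su (ltnW sN).
  - by move=> k /uw /wJ.
  - by rewrite -eu.
  - by rewrite eu; split=> //; exists w'; split=> // x; rewrite eu.
have il : B (simple i) lam = 0.
  apply/eqP; rewrite eq_le lJ //= -oppr_le0.
  have -> : - B (simple i) lam = B (weyl A w (simple i)) (weyl A (rcons w i) lam).
    rewrite weyl_rcons weyl_isom // -[in RHS](reflK sl i (simple i)) refl_isom //.
    by rewrite refl_simple // pairingNl.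
  rewrite pairing_coord //; apply: sumr_le0 => k _.
  have [kJ|kJ] := boolP (k \in J); first by apply: mulr_ge0_le0; [apply: pos|apply: mJ].
  rewrite weyl_coord ?simpleE; last by apply: contra kJ; apply: wJ.
  by case: eqVneq kJ => [->|_ _]; rewrite ?iJ // mul0r.
have rl : refl A i lam = lam by rewrite /refl il scale0r subr0.
have [//||||el [w' [w'J e']]] := IH w => //.
  by move: mJ; rewrite weyl_rcons rl.
rewrite weyl_rcons rl; split=> //; exists (rcons w' i); split=> [k|x].
  by rewrite mem_rcons inE => /orP[/eqP ->|/w'J //]; rewrite inE iJ il eqxx.
by rewrite !weyl_rcons e'.
Qed.

Definition supp x : {set 'I_n} := [set i | x 0 i != 0].

Definition conn Y := forall J, J \subset Y -> J != finset.set0 -> J != Y ->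
  exists i j, [/\ i \in J, j \in Y, j \notin J & A i j != 0].

(** Reflecting b down changes the support at most by dropping i, and i is then joined to the
    remaining support because (alpha_i|s_i b) < 0. *)
Lemma real_root_conn b : real_root A b -> nonneg b -> conn (supp b).
Proof.
have [N] := ubnP (absz (height b)); elim: N b => // N IH b hb rb b0 J Jb J0 JN.
have [|i [bi ai]] := norm2_witness b0; first by rewrite norm_real_root.
have ru := real_root_refl i rb.
have [u0|u0] := real_root_sign sl ru; last first.
  have e := refl_neg_simple (norm_real_root sl rb) b0 u0.
  case/eqP: JN; apply/eqP; rewrite finset.eqEsubset Jb /=; apply/fintype.subsetP => k.
  have [l lJ] := set0Pn _ J0.
  have sb m : m \in supp b -> m = i.
    by rewrite e inE simpleE; case: (eqVneq m i).
  by move=> /sb ->; rewrite -(sb l) // (fintype.subsetP Jb).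
set u := refl A i b in u0 ru.
have hlt : (absz (height u) < N)%N.
  have := height_ge0 u0; have := height_ge0 b0.
  by rewrite /u height_refl; move: hb; lia.
have cu := IH u hlt ru u0.
have su k : k != i -> (k \in supp b) = (k \in supp u).
  by move=> ki; rewrite !inE /u refl_coord (negPf ki) mulr0 subr0.
have ib : i \in supp b by rewrite inE gt_eqF.
have [iu|iu] := boolP (i \in supp u).
  have e : supp b = supp u.
    by apply/setP => k; have [->|ki] := eqVneq k i; [rewrite ib iu|apply: su].
  by rewrite e in Jb JN *; apply: cu.
have [k [ki ku Aik]] : exists k, [/\ k != i, k \in supp u & A i k != 0].
  have : B (simple i) u < 0.
    by rewrite /u -(refl_isom sl i) (reflK sl) refl_simple // pairingNl oppr_lt0.
  rewrite pairing_simple_coord // => neg.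
  apply: contrapT => /forallNP none; move: neg; rewrite big1 ?ltxx // => k _.
  have [->|ki] := eqVneq k i; first by move: iu; rewrite inE negbK => /eqP ->; rewrite mulr0.
  have := none k; apply: contra_notP => Ak; split=> //.
    by rewrite inE; apply/eqP => u0'; rewrite u0' mulr0 in Ak.
  by apply/eqP => A0; rewrite A0 mul0r in Ak.
have kb : k \in supp b by rewrite su.
have [kJ|kJ] := boolP (k \in J); have [iJ|iJ] := boolP (i \in J); last 3 first.
- by exists k, i; rewrite (sl_sym sl).
- by exists i, k.
- have Ju : J \subset supp u.
    apply/fintype.subsetP => l lJ; rewrite -su ?(fintype.subsetP Jb) //.
    by apply: contraNneq iJ => <-.
  have [|l [m [lJ mu mJ lm]]] := cu J Ju J0; first by apply: contraNneq kJ => ->.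
  exists l, m; split=> //; rewrite su //.
  by apply: contraNneq iu => <-.
(* Both i and its neighbour k lie in J: remove i and use a cut of the smaller support. *)
have [D0|D0] := eqVneq (J :\ i) (supp u).
  case/eqP: JN; apply/setP => l; have [->|li] := eqVneq l i; first by rewrite ib.
  by rewrite su // -D0 !inE li.
have [|||l [m [lJ mu mJ lm]]] := cu (J :\ i) => //.
- apply/fintype.subsetP => l; rewrite !inE => /andP[li lJ]; have := fintype.subsetP Jb _ lJ.
  by rewrite su // inE.
- by apply/set0Pn; exists k; rewrite !inE ki.
have mi : m != i by apply: contraNneq iu => <-.
exists l, m; split=> //; first by move: lJ; rewrite !inE => /andP[].
  by rewrite su.
by move: mJ; rewrite !inE mi.
Qed.
End Words.

(** * Affine subdiagrams *)

Section PositiveSemidefinite.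
Variables (F : realFieldType) (T : finType) (Y : {set T}) (a : T -> T -> F) (u x : T -> F).
Hypothesis asym : forall i j, a i j = a j i.
Hypothesis aoff : forall i j, i != j -> a i j <= 0.
Hypothesis u0 : forall i, i \in Y -> 0 < u i.
Hypothesis au : forall i, i \in Y -> \sum_(j in Y) a i j * u j = 0.

Let y i := x i / u i.

(** Dividing by u turns the kernel vector into the constants, and the form becomes a graph Laplacian
    with weights - a_ij u_i u_j. *)
Lemma psd_identity : 2 * (\sum_(i in Y) \sum_(j in Y) a i j * x i * x j) =
  - \sum_(i in Y) \sum_(j in Y) a i j * u i * u j * (y i - y j) ^+ 2.
Proof.
have S0 : \sum_(i in Y) \sum_(j in Y) a i j * u j * (u i * y i ^+ 2) = 0.
  by apply: big1 => i iY; rewrite -mulr_suml au // mul0r.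
have S1 : \sum_(i in Y) \sum_(j in Y) a i j * u i * (u j * y j ^+ 2) = 0.
  rewrite exchange_big -[RHS]S0; apply: eq_bigr => i _; apply: eq_bigr => j _.
  by rewrite asym.
apply/eqP; rewrite -subr_eq0 opprK; apply/eqP.
have S : \sum_(i in Y) \sum_(j in Y) (a i j * u j * (u i * y i ^+ 2)
    + a i j * u i * (u j * y j ^+ 2)) = 0.
  by under eq_bigr do rewrite big_split; rewrite big_split /= S0 S1 addr0.
rewrite mulr_sumr -big_split -[RHS]S /=.
apply: eq_bigr => i iY; rewrite mulr_sumr -big_split; apply: eq_bigr => j jY /=.
rewrite /y; field.
by rewrite (gt_eqF (u0 iY)) (gt_eqF (u0 jY)).
Qed.

Lemma psd_ge0 : 0 <= \sum_(i in Y) \sum_(j in Y) a i j * x i * x j.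
Proof.
rewrite -(pmulr_rge0 _ (ltr0n F 2)) psd_identity oppr_ge0.
apply: sumr_le0 => i iY; apply: sumr_le0 => j jY.
have [->|ij] := eqVneq i j; first by rewrite subrr expr0n mulr0.
rewrite -!mulrA; apply: mulr_le0_ge0; first exact: aoff.
exact: mulr_ge0 (ltW (u0 iY)) (mulr_ge0 (ltW (u0 jY)) (sqr_ge0 _)).
Qed.

Hypothesis aconn : forall J : {set T}, J \subset Y -> J != finset.set0 -> J != Y ->
  exists i j, [/\ i \in J, j \in Y, j \notin J & a i j != 0].

(** Every square in the identity vanishes, so x / u is constant along edges; a level set of x / u
    has no outgoing edge and is therefore all of Y. *)
Lemma psd_eq0 : \sum_(i in Y) \sum_(j in Y) a i j * x i * x j = 0 ->
  forall i j, i \in Y -> j \in Y -> x i * u j = x j * u i.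
Proof.
move=> n0.
have := psd_identity; rewrite n0 mulr0 => /esym/eqP; rewrite oppr_eq0 -oppr_eq0 -sumrN.
have ge i j : i \in Y -> j \in Y -> 0 <= - (a i j * u i * u j * (y i - y j) ^+ 2).
  move=> iY jY; have [->|ij] := eqVneq i j; first by rewrite subrr expr0n mulr0 oppr0.
  rewrite oppr_ge0 -!mulrA; apply: mulr_le0_ge0; first exact: aoff.
  exact: mulr_ge0 (ltW (u0 iY)) (mulr_ge0 (ltW (u0 jY)) (sqr_ge0 _)).
rewrite psumr_eq0 => [/allP all0|i iY]; last by rewrite -sumrN sumr_ge0 // => j jY; apply: ge.
have eqy i j : i \in Y -> j \in Y -> a i j != 0 -> y i = y j.
  move=> iY jY aij; have := all0 i (mem_index_enum _); rewrite iY /= -sumrN.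
  rewrite psumr_eq0 => [/allP /(_ j (mem_index_enum _))|k kY]; last exact: ge.
  rewrite jY oppr_eq0 !mulf_eq0 (negPf aij) (gt_eqF (u0 iY)) (gt_eqF (u0 jY)) /= orbb subr_eq0.
  by move/eqP.
move=> i j iY jY.
suff yij : y i = y j.
  by move: yij; rewrite /y => /eqP; rewrite eqr_div ?(gt_eqF (u0 _)) // => /eqP.
pose J := [set k in Y | y k == y i].
have [JY|JY] := eqVneq J Y.
  by have : j \in J by [rewrite JY]; rewrite inE => /andP[_ /eqP].
have sJ : J \subset Y by apply/fintype.subsetP => k; rewrite inE => /andP[].
have J0 : J != finset.set0 by apply/set0Pn; exists i; rewrite inE iY eqxx.
have [k [l [kJ lY lJ akl]]] := aconn sJ J0 JY.
move: kJ lJ; rewrite !inE lY /= => /andP[kY /eqP <-].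
by rewrite (eqy k l) ?eqxx.
Qed.
End PositiveSemidefinite.

Section Affine.
Variables (n : nat) (A : 'M[int]_n).
Hypothesis sl : simply_laced A.
Local Notation V := 'rV[int]_n.
Local Notation B := (pairing A).
Implicit Types (x y z a b d : V) (i j : 'I_n) (w u : seq 'I_n) (J Y : {set 'I_n}).

Definition inside Y x := forall j, j \notin Y -> x 0 j = 0.

(** Together with [conn] this encodes that Y is of affine type. Primitivity of d is not built in;
    where it matters, a mark equal to 1 provides it. *)
Definition null_on Y d := [/\ forall j, j \in Y -> 0 < d 0 j, inside Y d &
  forall j, j \in Y -> B (simple j) d = 0].

Definition signed x := nonneg x \/ nonneg (- x).

(** Height descent again. Only the sign property of norm-2 vectors enters, so the lemma serves
    affine and finite diagrams alike. *)
Lemma norm2_real Y : (forall v, inside Y v -> B v v = 2 -> signed v) ->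
  forall v, inside Y v -> B v v = 2 -> real_root A v.
Proof.
move=> sgn.
suff pos N v : inside Y v -> B v v = 2 -> nonneg v -> (absz (height v) < N)%N ->
    real_root A v.
  move=> v vY v2; case: (sgn v vY v2) => v0; first exact: (pos _ _ vY v2 v0 (ltnSn _)).
  rewrite -(opprK v); apply: real_root_opp => //; apply: pos v0 (ltnSn _).
    by move=> j jY; rewrite mxE vY ?oppr0.
  by rewrite pairingNl pairingNr opprK.
elim: N v => // N IH v vY v2 v0 hv.
have [|i [vi ai]] := norm2_witness (A := A) v0; first by rewrite v2.
have iY : i \in Y by apply: contraTT vi => iY; rewrite vY.
have uY : inside Y (refl A i v).
  move=> j jY; rewrite refl_coord vY //; case: eqVneq jY => [->|_ _]; first by rewrite iY.
  by rewrite mulr0 subr0.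
have u2 : B (refl A i v) (refl A i v) = 2 by rewrite refl_isom.
have [u0|u0] := sgn _ uY u2.
  rewrite -(reflK sl i v); apply: real_root_refl; apply: (IH _ uY u2 u0).
  by have := height_ge0 u0; have := height_ge0 v0; move: hv; rewrite height_refl; lia.
by rewrite (refl_neg_simple sl v2 v0 u0); apply: real_root_simple.
Qed.

Lemma pairing_inside Y x y : inside Y x -> inside Y y ->
  B x y = \sum_(i in Y) \sum_(j in Y) A i j * x 0 i * y 0 j.
Proof.
move=> xY yY; rewrite pairing_coord // (bigID (mem Y)) /= [X in _ + X]big1 ?addr0; last first.
  by move=> i iY; rewrite xY // mul0r.
apply: eq_bigr => i iY; rewrite pairing_simple_coord // (bigID (mem Y)) /=.
rewrite [X in _ + X]big1 ?addr0; last by move=> j jY; rewrite yY // mulr0.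
by rewrite mulr_sumr; apply: eq_bigr => j _; ring.
Qed.

Section NullOn.
Variables (Y : {set 'I_n}) (d : V).
Hypothesis dY : null_on Y d.

Let a (i j : 'I_n) : rat := (A i j)%:~R.
Let u (i : 'I_n) : rat := (d 0 i)%:~R.

Let asym i j : a i j = a j i. Proof. by rewrite /a (sl_sym sl). Qed.
Let aoff i j : i != j -> a i j <= 0. Proof. by move=> ij; rewrite lerz0 (sl_off sl). Qed.
Let u0 i : i \in Y -> 0 < u i. Proof. by case: dY => d0 _ _ iY; rewrite ltr0z d0. Qed.
Let au i : i \in Y -> \sum_(j in Y) a i j * u j = 0.
Proof.
case: dY => _ d0 dn iY; have := dn i iY; rewrite pairing_simple_coord // (bigID (mem Y)) /=.
rewrite [X in _ + X]big1 ?addr0; last by move=> j jY; rewrite d0 // mulr0.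
move/(congr1 (intr : int -> rat)); rewrite rmorph_sum /= => e.
by rewrite -[RHS]e; apply: eq_bigr => j _; rewrite -intrM.
Qed.

Let sumE x y : inside Y x -> inside Y y -> (B x y)%:~R =
   \sum_(i in Y) \sum_(j in Y) a i j * (x 0 i)%:~R * (y 0 j)%:~R :> rat.
Proof.
move=> xY yY; rewrite (pairing_inside xY yY) rmorph_sum /=; apply: eq_bigr => i _.
by rewrite rmorph_sum /=; apply: eq_bigr => j _; rewrite !intrM.
Qed.

Lemma affine_norm_ge0 x : inside Y x -> 0 <= B x x.
Proof.
move=> xY; rewrite -(ler0z rat) sumE //.
exact: (psd_ge0 _ asym aoff u0 au).
Qed.

Hypothesis cY : conn A Y.

Lemma affine_norm0 x : inside Y x -> B x x = 0 ->
  forall i j, x 0 i * d 0 j = x 0 j * d 0 i.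
Proof.
move=> xY x0.
have dY' : inside Y d by case: dY.
have aconn J : J \subset Y -> J != finset.set0 -> J != Y ->
    exists i j, [/\ i \in J, j \in Y, j \notin J & a i j != 0].
  by move=> JY J0 JN; have [i [j [iJ jY jJ Aij]]] := cY JY J0 JN; exists i, j; rewrite intr_eq0.
have := @psd_eq0 _ _ Y a u (fun i => (x 0 i)%:~R) asym aoff u0 au aconn.
rewrite -sumE // x0 => /(_ erefl) e i j.
have [iY|iY] := boolP (i \in Y); last by rewrite [x 0 i]xY // [d 0 i]dY' // mulr0 mul0r.
have [jY|jY] := boolP (j \in Y); last by rewrite [x 0 j]xY // [d 0 j]dY' // mulr0 mul0r.
by have /eqP := e i j iY jY; rewrite /u -!intrM eqr_int => /eqP.
Qed.

(** Split x = p - m into positive and negative parts. Then (p|m) <= 0 and both norms are even and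
    nonnegative, so (x|x) = 2 forces one part to be isotropic, hence proportional to d: it is 0 or
    positive on all of Y, and in the latter case the other part is 0. *)
Lemma affine_norm2_signed x : inside Y x -> B x x = 2 -> signed x.
Proof.
move=> xY x2.
pose p : V := \row_i Num.max (x 0 i) 0; pose m : V := \row_i Num.max (- x 0 i) 0.
have pm : x = p - m by apply/rowP => i; rewrite !mxE; lia.
have pY : inside Y p by move=> i /xY; rewrite mxE => ->; rewrite maxxx.
have mY : inside Y m by move=> i /xY; rewrite mxE => ->; rewrite oppr0 maxxx.
have Bpm : B p m <= 0.
  rewrite (pairing_inside pY mY); apply: sumr_le0 => i _; apply: sumr_le0 => j _.
  rewrite !mxE; have [->|ij] := eqVneq i j; last first.
    by rewrite -mulrA; apply: mulr_le0_ge0; [apply: (sl_off sl)|rewrite mulr_ge0 // le_max lexx orbT].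
  by have [xj|xj] := leP 0 (x 0 j); rewrite le_eqVlt -mulrA; apply/orP; left;
    rewrite mulf_eq0; apply/orP; right; nia.
have := affine_norm_ge0 pY; have := affine_norm_ge0 mY.
have [k ek] := norm_even sl p; have [l el] := norm_even sl m.
have d0 : forall j, j \in Y -> 0 < d 0 j by case: dY.
move: x2; rewrite {1 2}pm !pairingE (pairingC sl m p) => x2 mge pge.
have [p0|p0] := eqVneq (B p p) 0.
  have e := affine_norm0 pY p0.
  have [[j xj]|none] := pselect (exists j, x 0 j < 0); last first.
    by left=> i; rewrite leNgt; apply/negP => xi; apply: none; exists i.
  right=> i; rewrite mxE oppr_ge0.
  have jY : j \in Y by apply: contraTT xj => jY; rewrite xY.
  have := e i j; rewrite !mxE [Num.max (x 0 j) 0](_ : _ = 0); last by lia.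
  by rewrite mul0r => /eqP; rewrite mulf_eq0 (gt_eqF (d0 _ jY)) orbF => /eqP; move: (x 0 i) => t; clear; lia.
have m0 : B m m = 0 by lia.
have e := affine_norm0 mY m0.
have [[j xj]|none] := pselect (exists j, 0 < x 0 j); last first.
  by right=> i; rewrite mxE oppr_ge0 leNgt; apply/negP => xi; apply: none; exists i.
left=> i.
have jY : j \in Y by apply: contraTT xj => jY; rewrite xY.
have := e i j; rewrite !mxE [Num.max (- x 0 j) 0](_ : _ = 0); last by lia.
by rewrite mul0r => /eqP; rewrite mulf_eq0 (gt_eqF (d0 _ jY)) orbF => /eqP; move: (x 0 i) => t; clear; lia.
Qed.

Lemma affine_norm2_real x : inside Y x -> B x x = 2 -> real_root A x.
Proof. exact: (norm2_real affine_norm2_signed). Qed.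
End NullOn.
End Affine.

(** * Overextensions *)

Section Extension.
Variables (n : nat) (A : 'M[int]_n).
Hypothesis sl : simply_laced A.
Local Notation V := 'rV[int]_n.
Local Notation B := (pairing A).
Implicit Types (x y z a b d : V) (i j p : 'I_n) (w u : seq 'I_n) (J P Y Z : {set 'I_n}).

(** Ext type read inside the ambient diagram, with d the null root of the affine part; [ext_vertexP]
    links it to the definition. *)
Definition ext_in Z p d := [/\ p \in Z, conn A (Z :\ p), null_on A (Z :\ p) d &
  B (simple p) d = -1].

Lemma null_on_ge0 Y d : null_on A Y d -> nonneg d.
Proof.
case=> d0 dY _ j; have [jY|jY] := boolP (j \in Y); first exact: ltW (d0 _ jY).
by rewrite dY.
Qed.

Lemma null_on_antidominant Y d j : null_on A Y d -> B (simple j) d <= 0.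
Proof.
move=> nd; have [d0 dY dn] := nd; have [/dn -> //|jY] := boolP (j \in Y).
rewrite pairing_simple_coord //; apply: sumr_le0 => i _.
have [<-|ji] := eqVneq j i; first by rewrite dY // mulr0.
by apply: mulr_le0_ge0; [apply: (sl_off sl)|apply: null_on_ge0 nd _].
Qed.

Lemma null_on_norm Y d : null_on A Y d -> B d d = 0.
Proof.
case=> d0 dY dn; rewrite pairing_coord big1 // => i _.
have [/dn ->|iY] := boolP (i \in Y); first by rewrite mulr0.
by rewrite dY // mul0r.
Qed.

(** The nonpositive integers a_pj d_j sum to -1, so exactly one of them is nonzero, and its factors
    are -1 and 1. *)
Lemma ext_neighbor Z p d : ext_in Z p d -> exists q,
  [/\ q \in Z :\ p, d 0 q = 1, A q p = -1 & forall j, j \in Z :\ p -> j != q -> A j p = 0].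
Proof.
move=> [pZ cY nd dp]; have [d0 dY dn] := nd.
have term j : A p j * d 0 j <= 0.
  have [->|jp] := eqVneq j p; first by rewrite dY ?mulr0 // !inE eqxx.
  by apply: mulr_le0_ge0; [apply: (sl_off sl); rewrite eq_sym|apply: null_on_ge0 nd _].
have [q Aq] : exists q, A p q * d 0 q != 0.
  apply: contrapT => /forallNP none; move: dp; rewrite pairing_simple_coord // big1 //.
  by move=> i _; apply/eqP/negPn/negP/none.
have e : A p q * d 0 q + \sum_(j | j != q) A p j * d 0 j = -1.
  by rewrite -dp pairing_simple_coord // [RHS](bigD1 q).
have s0 : \sum_(j | j != q) A p j * d 0 j <= 0 by apply: sumr_le0.
have z0 : \sum_(j | j != q) A p j * d 0 j = 0 by have := term q; move: Aq; lia.
have qY : q \in Z :\ p by apply: contraNT Aq => qY; rewrite dY // mulr0.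
have dq := d0 _ qY.
rewrite z0 addr0 in e; have Aneg : A p q <= -1 by nia.
have dq1 : d 0 q = 1 by nia.
exists q; split=> //.
- by rewrite (sl_sym sl); rewrite dq1 mulr1 in e.
- move=> j jY jq; rewrite (sl_sym sl); have dj := d0 _ jY.
  have : A p j * d 0 j = 0.
    apply/eqP; rewrite -oppr_eq0; move/eqP: z0; rewrite -oppr_eq0 -sumrN.
    rewrite psumr_eq0 => [/allP /(_ j (mem_index_enum _))|i _]; last by rewrite oppr_ge0.
    by rewrite jq.
  by move/eqP; rewrite mulf_eq0 (gt_eqF dj) orbF => /eqP.
Qed.

(** The neighbour q depends only on Z and p; d and d' are proportional and both have mark 1
    there. *)
Lemma ext_null_unique Z p d d' : ext_in Z p d -> ext_in Z p d' -> d = d'.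
Proof.
move=> ed ed'; have [q [qY dq _ Ajp]] := ext_neighbor ed.
have [q' [qY' dq' Aq' _]] := ext_neighbor ed'.
have qq : q' = q by apply/eqP; apply: contraTT isT => /(Ajp _ qY') e; rewrite e in Aq'.
rewrite {}qq in dq'.
have [_ cY nd _] := ed; have [_ _ [_ dY' dn'] _] := ed'; have [_ _ nd' _] := ed'.
apply/rowP => i; have := affine_norm0 sl nd cY dY' (null_on_norm nd') i q.
by rewrite dq dq' mulr1 mul1r.
Qed.

Definition deg Y j : int := \sum_(i in Y | i != j) - A j i.

Definition ind P : V := \row_i (i \in P)%:R.

Lemma indE P i : ind P 0 i = (i \in P)%:R. Proof. by rewrite mxE. Qed.

Lemma pairing_ind Y j : B (simple j) (ind Y) = \sum_(i in Y) A j i.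
Proof.
rewrite pairing_simple_coord // [RHS]big_mkcond; apply: eq_bigr => i _.
by rewrite indE; case: (i \in Y); rewrite ?mulr1 ?mulr0.
Qed.

Lemma pairing_ind_deg Y j : j \in Y -> B (simple j) (ind Y) = 2 - deg Y j.
Proof. by move=> jY; rewrite pairing_ind (bigD1 j) //= (sl_diag sl) /deg sumrN opprK. Qed.

Lemma pairing_indl P y : B (ind P) y = \sum_(j in P) B (simple j) y.
Proof.
rewrite pairing_coord [RHS]big_mkcond; apply: eq_bigr => i _.
by rewrite indE; case: (i \in P); rewrite ?mul1r ?mul0r.
Qed.

Lemma null_on_deg Y d j : null_on A Y d -> j \in Y ->
  2 * d 0 j = \sum_(i in Y | i != j) - A j i * d 0 i.
Proof.
move=> [_ dY dn] jY; have := dn j jY; rewrite pairing_simple_coord // (bigD1 j) //=.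
rewrite (sl_diag sl) => /eqP; rewrite addr_eq0 => /eqP ->; rewrite -sumrN.
rewrite (bigID (mem Y)) /= addrC big1 ?add0r => [|i /andP[_ iY]]; last first.
  by rewrite dY // mulr0 oppr0.
by apply: eq_big => [i|i _]; [rewrite andbC|rewrite mulNr].
Qed.

Lemma off_ge0 i j : i != j -> 0 <= - A j i.
Proof. by move=> ij; rewrite oppr_ge0 (sl_off sl) // eq_sym. Qed.

(** At a vertex of mark 1 the marks of the neighbours, counted with edge multiplicity, sum to 2;
    degree at least 2 makes them all 1. A neighbour of degree at most 1 would give 2 = 1, so the
    property spreads over Y. *)
Lemma mark1_all Y d j : conn A Y -> null_on A Y d -> j \in Y -> d 0 j = 1 ->
  2 <= deg Y j -> forall i, i \in Y -> d 0 i = 1.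
Proof.
move=> cY nd jY dj degj; have [d0 dY dn] := nd.
pose M := [set k in Y | (d 0 k == 1) && (2 <= deg Y k)].
suff MY : M = Y by move=> i; rewrite -MY inE => /and3P[_ /eqP].
apply/eqP; apply: contraT => MN.
have sM : M \subset Y by apply/fintype.subsetP => k; rewrite inE => /andP[].
have M0 : M != finset.set0 by apply/set0Pn; exists j; rewrite inE jY dj degj.
have [k [l [kM lY lM Akl]]] := cY _ sM M0 MN.
have lk : l != k by apply: contraNneq lM => ->.
case/negP: lM; move: kM; rewrite inE => /and3P[kY /eqP dk degk].
have dl : d 0 l = 1.
  have := null_on_deg nd kY; rewrite dk (bigD1 l) ?lY //=; set S2 := (X in _ = _ + X) => e.
  have := degk; rewrite /deg (bigD1 l) ?lY //=; set S1 := (X in _ <= _ + X) => dk2.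
  have le : S1 <= S2.
    by apply: ler_sum => i /andP[/andP[iY ik] _]; have := off_ge0 ik; have := d0 _ iY; nia.
  have a0 : 0 < - A k l by have := off_ge0 lk; move: Akl; clear; lia.
  have : - A k l * d 0 l <= - A k l by move: e dk2 le; clear; lia.
  rewrite ger_pMr //; have := d0 _ lY; clear; lia.
rewrite inE lY dl eqxx /= leNgt; apply/negP => degl.
have kl : k != l by rewrite eq_sym.
have := null_on_deg nd lY; rewrite dl (bigD1 k) ?kY //= dk; set S2 := (X in _ = _ + X) => e.
move: degl; rewrite /deg (bigD1 k) ?kY //=; set S1 := (X in _ + X < _) => degl.
have Akl' : A l k != 0 by rewrite (sl_sym sl).
have s0 : 0 <= S1 by apply: sumr_ge0 => i /andP[/andP[_ il] _]; apply: off_ge0.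
have z0 : S1 = 0.
  by have := off_ge0 kl; move: Akl' degl s0; lia.
have z1 : S2 = 0.
  apply: big1 => i /andP[/andP[iY il] ik].
  suff -> : - A l i = 0 by rewrite mul0r.
  apply/eqP; move/eqP: z0; rewrite psumr_eq0 => [/allP/(_ i (mem_index_enum _))|m /andP[/andP[_ ml] _]].
    by rewrite iY il ik.
  exact: off_ge0.
rewrite z0 z1 in e degl; have := off_ge0 kl; move: Akl'; lia.
Qed.

(** Adding to P a vertex j joined to it changes the norm by 2 + 2 (alpha_j|1_P) <= 0, so a largest
    such P is Y. *)
Lemma ind_norm Y (x : 'I_n) : conn A Y -> x \in Y -> B (ind Y) (ind Y) <= 2.
Proof.
move=> cY xY.
pose C P := [&& x \in P, P \subset Y & B (ind P) (ind P) <= 2].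
have Cx : C [set x].
  rewrite /C set11 finset.sub1set xY /= pairing_indl big_set1.
  by rewrite pairing_ind big_set1 (sl_diag sl).
case: (arg_maxnP (fun P : {set 'I_n} => #|P|) Cx) => P /and3P[xP PY nP] maxP.
have [<- //|PN] := eqVneq P Y.
have P0 : P != finset.set0 by apply/set0Pn; exists x.
have [i [j [iP jY jP Aij]]] := cY _ PY P0 PN.
suff : C (j |: P) by move/maxP; rewrite cardsU1 jP; lia.
have eP : ind (j |: P) = simple j + ind P.
  apply/rowP => k; rewrite !mxE !inE eqxx /=.
  by have [->|_] := eqVneq k j; rewrite ?(negPf jP) ?addr0 ?add0r.
rewrite /C inE xP orbT /= finset.subUset finset.sub1set jY PY /= eP !pairingE norm_simple //.
have ij : i != j by apply: contraNneq jP => <-.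
have : B (simple j) (ind P) <= A j i.
  rewrite pairing_ind (bigD1 i) //= gerDl; apply: sumr_le0 => k /andP[kP ki].
  by apply: (sl_off sl); apply: contraNneq jP => ->.
rewrite (pairingC sl (ind P) (simple j)).
by have := off_ge0 ij; move: Aij nP; rewrite (sl_sym sl i j); lia.
Qed.

(* If L is the set of leaves of Y, then z = 2 * 1_Y - 1_L has (z|z) <= 0, so z is proportional *)
(* to d, while z = 2 at x and z >= 1 on Y.                                                      *)
Lemma two_branches Y d (x y : 'I_n) : conn A Y -> null_on A Y d -> x \in Y -> y \in Y -> x != y ->
  3 <= deg Y x -> 3 <= deg Y y -> forall j, j \in Y -> d 0 x <= 2 * d 0 j.
Proof.
move=> cY nd xY yY xy dx dy j jY.
pose L := [set i in Y | deg Y i <= 1].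
pose z := 2 *: ind Y - ind L.
have zY : inside Y z.
  by move=> i iY; rewrite !mxE !inE (negPf iY).
(* (1_Y|1_Y) is the sum over Y of 2 - deg: the leaves give (1_L|1_Y), x and y give at most -1 each,
   and the rest at most 0. *)
have sN : B (ind Y) (ind Y) <= B (ind L) (ind Y) - 2.
  rewrite !pairing_indl (bigID (mem L)) /=.
  have -> : \sum_(i in Y | i \in L) B (simple i) (ind Y) = \sum_(i in L) B (simple i) (ind Y).
    by apply: eq_bigl => i; rewrite inE; case: (i \in Y).
  rewrite lerD2l (bigD1 x) /=; last by rewrite xY inE xY -ltNge; lia.
  rewrite (bigD1 y) /=; last by rewrite yY inE yY eq_sym xy andbT -ltNge; lia.
  apply: (@le_trans _ _ (-1 + (-1 + 0))); last by [].
  apply: lerD; first by rewrite pairing_ind_deg //; lia.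
  apply: lerD; first by rewrite pairing_ind_deg //; lia.
  apply: sumr_le0 => i /andP[/andP[/andP[iY iL] _] _].
  by rewrite pairing_ind_deg //; move: iL; rewrite inE iY -ltNge; lia.
have sL : B (ind L) (ind L) <= 2 * B (ind L) (ind Y).
  rewrite !pairing_indl mulr_sumr; apply: ler_sum => i; rewrite inE => /andP[iY iL].
  rewrite (pairing_ind_deg iY) pairing_ind (bigD1 i) ?inE ?iY //= (sl_diag sl).
  apply: (@le_trans _ _ (2 + 0)); last by lia.
  rewrite lerD2l; apply: sumr_le0 => k /andP[_ ki].
  by apply: (sl_off sl); rewrite eq_sym.
have N2 := ind_norm cY xY.
(* (z|z) <= 4 (1_Y|1_Y) - 2 (1_L|1_Y) <= 2 (1_Y|1_Y) - 4 <= 0. *)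
have z0 : B z z = 0.
  apply/eqP; rewrite eq_le (affine_norm_ge0 sl nd zY) andbT.
  by rewrite /z !pairingE (pairingC sl (ind Y) (ind L)); lia.
have := affine_norm0 sl nd cY zY z0 x j.
have [d0 _ _] := nd; have := d0 _ jY; have := d0 _ xY.
rewrite !mxE !inE xY jY /= (_ : deg Y x <= 1 = false); last by apply/negbTE; rewrite -ltNge; lia.
by case: (deg Y j <= 1); lia.
Qed.
End Extension.

(** * Uniqueness of the extending vertex *)

Section Uniqueness.
Variables (n : nat) (A : 'M[int]_n).
Hypothesis sl : simply_laced A.
Local Notation V := 'rV[int]_n.
Local Notation B := (pairing A).
Local Notation I := [set: 'I_n].
Local Notation deg := (deg A).
Implicit Types (d f : V) (b i j p q x z : 'I_n).

Lemma deg_remove x p : x != p -> deg I x = deg (I :\ p) x - A x p.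
Proof.
move=> xp; rewrite /deg (bigD1 p) ?inE //= 1?eq_sym // addrC; congr (_ + _).
by apply: eq_bigl => i; rewrite !inE /= andbT andbC.
Qed.

Lemma deg2_neighbors x b z : b != x -> z != x -> z != b -> A x b = -1 -> A x z != 0 ->
  deg I x <= 2 -> A x z = -1 /\ forall i, i != x -> i != b -> i != z -> A x i = 0.
Proof.
move=> bx zx zb Axb Axz; rewrite /deg (bigD1 b) ?inE //= (bigD1 z) ?inE ?zx ?zb //= Axb.
set S := (X in _ + (_ + X)); have off i : i != x -> 0 <= - A x i by apply: off_ge0.
have S0 : 0 <= S by apply: sumr_ge0 => i /andP[/andP[/andP[_ ix] _] _]; apply: off.
move=> d2; have oz := off z zx.
have z0 : S = 0 by move: Axz d2; lia.
split; first by move: Axz d2; lia.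
move=> i ix ib iz; apply/eqP; rewrite -oppr_eq0; move/eqP: z0.
rewrite psumr_eq0 => [/allP/(_ i (mem_index_enum _))|m /andP[/andP[/andP[_ mx] _] _]].
  by rewrite inE ix ib iz.
exact: off.
Qed.

Lemma pairing_one_neighbor x b f : b != x -> A x b = -1 ->
  (forall i, i != x -> i != b -> A x i * f 0 i = 0) ->
  B (simple x) f = 2 * f 0 x - f 0 b.
Proof.
move=> bx Axb oth; rewrite pairing_simple_coord // (bigD1 x) //= (bigD1 b) //= big1.
  by rewrite (sl_diag sl) Axb; lia.
by move=> i /andP[ix ib]; apply: oth.
Qed.

Lemma pairing_two_neighbors x b z f : b != x -> z != x -> z != b -> A x b = -1 ->
  A x z = -1 -> (forall i, i != x -> i != b -> i != z -> A x i = 0) ->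
  B (simple x) f = 2 * f 0 x - f 0 b - f 0 z.
Proof.
move=> bx zx zb Axb Axz oth.
rewrite pairing_simple_coord // (bigD1 x) //= (bigD1 b) //= (bigD1 z) ?zx //= big1.
  by rewrite (sl_diag sl) Axb Axz; lia.
by move=> i /andP[/andP[ix ib] iz]; rewrite oth // mul0r.
Qed.

Section TwoVertices.
Variables (p p' : 'I_n) (d d' : V).
Hypotheses (E : ext_in A I p d) (E' : ext_in A I p' d') (pp : p != p').

(** Both marks are minus the inner product of d and d': d pairs with the simple roots to -1 at p and
    to 0 elsewhere, and d' likewise at p'. *)
Lemma ext_cross : d' 0 p = d 0 p' /\ 0 < d 0 p'.
Proof.
have half a b e f : ext_in A I a e -> ext_in A I b f -> B f e = - f 0 a.
  move=> [_ _ [_ ea en] ed] _; rewrite pairing_coord (bigD1 a) //= ed big1 ?addr0 => [|i ia].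
    by rewrite mulrN1.
  by rewrite en ?mulr0 // !inE ia.
have := half _ _ _ _ E E'; rewrite (pairingC sl) (half _ _ _ _ E' E).
have [_ _ [d0 _ _] _] := E; have := d0 p'; rewrite !inE eq_sym pp => /(_ isT).
by move=> ? ?; split; lia.
Qed.

(* The marks of the two null vectors along the arm of the diagram starting at p' are *)
(* d' = 0, 1, 2, ... and d = c, 2c, 3c, ..., up to the first branch vertex.           *)
Lemma ext_arm : exists x s, [/\ 2 <= s, d' 0 x = s, d 0 x = d 0 p' * (s + 1) & 3 <= deg I x].
Proof.
have [c' c0] := ext_cross; set c := d 0 p' in c' c0 *.
have [_ cY nd dp] := E; have [d0 dY dn] := nd.
have [_ cY' nd' dp'] := E'; have [d0' dY' dn'] := nd'.
have [q [qY dq Aq Ajp]] := ext_neighbor sl E.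
have [q' [qY' dq' Aq' Ajp']] := ext_neighbor sl E'.
have dp0 : d 0 p = 0 by apply: dY; rewrite !inE eqxx.
have dp0' : d' 0 p' = 0 by apply: dY'; rewrite !inE eqxx.
have dqc : d' 0 q = 2 * c.
  have := dn' p; rewrite !inE pp => /(_ isT).
  have qp : q != p by move: qY; rewrite !inE andbT.
  have Apq : A p q = -1 by rewrite (sl_sym sl).
  have oth i : i != p -> i != q -> A p i * d' 0 i = 0.
    by move=> ip iq; rewrite (sl_sym sl) Ajp ?mul0r // !inE ip.
  by rewrite (pairing_one_neighbor qp Apq oth) c'; move: (d' 0 q); clear; lia.
have dqc' : d 0 q' = 2 * c.
  have := dn p'; rewrite !inE eq_sym pp => /(_ isT).
  have qp : q' != p' by move: qY'; rewrite !inE andbT.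
  have Apq : A p' q' = -1 by rewrite (sl_sym sl).
  have oth i : i != p' -> i != q' -> A p' i * d 0 i = 0.
    by move=> ip iq; rewrite (sl_sym sl) Ajp' ?mul0r // !inE ip.
  by rewrite (pairing_one_neighbor qp Apq oth) -/c; move: (d 0 q'); clear; lia.
have dle i : d' 0 i <= height d'.
  rewrite /height (bigD1 i) //= lerDl; apply: sumr_ge0 => j _.
  exact: null_on_ge0 nd' _.
(* b is the vertex just left and x the current one. The marks of d' grow by 1 at each step and are
   bounded by its height, so the walk ends at a branch vertex. *)
have walk N : forall s x b, (absz (height d' - s) < N)%N -> 1 <= s -> b != x -> A x b = -1 ->
    d' 0 x = s -> d 0 x = c * (s + 1) -> d' 0 b = s - 1 -> d 0 b = c * s ->
    exists x s, [/\ 1 <= s, d' 0 x = s, d 0 x = c * (s + 1) & 3 <= deg I x].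
  elim: N => // N IH s x b hN s1 bx Axb dx' dx db' db.
  have [d3|d3] := leP 3 (deg I x); first by exists x, s.
  have xp : x != p by apply/eqP => e; rewrite e dp0 in dx; nia.
  have xp' : x != p' by apply/eqP => e; rewrite e dp0' in dx'; lia.
  have x0' : B (simple x) d' = 0 by apply: dn'; rewrite !inE xp'.
  have x0 : B (simple x) d = 0 by apply: dn; rewrite !inE xp.
  (* If b were the only neighbour of x, then 2 s = s - 1. *)
  have [z [zx zb Axz]] : exists z, [/\ z != x, z != b & A x z != 0].
    apply: contrapT => /forallNP none.
    have oth i : i != x -> i != b -> A x i * d' 0 i = 0.
      move=> ix ib; have := none i; rewrite ix ib; case: eqVneq => [->|]; first by rewrite mul0r.
      by move=> _ h; case: h.
    by have := x0'; rewrite (pairing_one_neighbor bx Axb oth); lia.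
  have [//|Axz1 oth] := deg2_neighbors bx zx zb Axb Axz.
  have e1 := pairing_two_neighbors d bx zx zb Axb Axz1 oth.
  have e2 := pairing_two_neighbors d' bx zx zb Axb Axz1 oth.
  apply: (IH (s + 1) z x) => //.
  - by have := dle z; have := dle x; rewrite x0' in e2; lia.
  - by lia.
  - by rewrite eq_sym.
  - by rewrite (sl_sym sl).
  - by rewrite x0' in e2; lia.
  - by rewrite x0 in e1; lia.
  - by rewrite dx'; lia.
have qp' : q' != p' by move: qY'; rewrite !inE andbT.
have [|||||||x [s [s1 dx' dx d3]]] := walk _ 1 q' p' (ltnSn _) => //.
- by rewrite eq_sym.
- by rewrite dqc'; lia.
- by rewrite /c mulr1.
exists x, s; split=> //; rewrite leNgt; apply/negP => s2.
(* At s = 1 the vertex x would have mark 1 and degree at least 2 without p', so all marks of d' on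
   the affine part would be 1; but q has mark 2 c. *)
have {s2}s1' : s = 1 by lia.
have xp' : x != p' by apply/eqP => e; rewrite e dp0' in dx'; lia.
have degY : 2 <= deg (I :\ p') x.
  move: d3; rewrite (deg_remove xp').
  have [->|xq] := eqVneq x q'; first by rewrite Aq'; lia.
  by rewrite Ajp' ?subr0 ?inE ?xp' //; lia.
have qY2 : q \in I :\ p'.
  by rewrite !inE andbT; apply/eqP => e; rewrite e dp0' in dqc; lia.
have xY : x \in I :\ p' by rewrite !inE xp'.
have := mark1_all sl cY' nd' xY _ degY qY2; rewrite dx' => /(_ s1').
by rewrite dqc; lia.
Qed.
End TwoVertices.

Lemma ext_vertex_unique p p' d d' : ext_in A I p d -> ext_in A I p' d' -> p = p'.
Proof.
move=> E E'; apply/eqP; apply: contraT => pp.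
have pp' : p' != p by rewrite eq_sym.
have [ce c0] := ext_cross E E' pp.
have [x [s [s2 dx' dx xdeg]]] := ext_arm E E' pp.
have [y [t [t2 dy dy' ydeg]]] := ext_arm E' E pp'.
rewrite ce in dy'; set c := d 0 p' in c0 dx dy'.
(* Otherwise s = c (t + 1) and t = c (s + 1), impossible for c >= 1. *)
have xy : x != y by apply/eqP => e; rewrite e in dx dx'; nia.
have [_ cY nd _] := E; have [d0 dY dn] := nd.
have [q [qY dq Aq Ajp]] := ext_neighbor sl E.
have dp0 : d 0 p = 0 by apply: dY; rewrite !inE eqxx.
have xp : x != p by apply/eqP => e; rewrite e dp0 in dx; nia.
have yp : y != p by apply/eqP => e; rewrite e dp0 in dy; lia.
have xq : x != q by apply/eqP => e; rewrite e dq in dx; nia.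
have yq : y != q by apply/eqP => e; rewrite e dq in dy; lia.
have xY : x \in I :\ p by rewrite !inE xp.
have yY : y \in I :\ p by rewrite !inE yp.
have dxY : 3 <= deg (I :\ p) x by move: xdeg; rewrite (deg_remove xp) Ajp // subr0.
have dyY : 3 <= deg (I :\ p) y by move: ydeg; rewrite (deg_remove yp) Ajp // subr0.
(* q has mark 1, while x has mark c (s + 1) >= 3. *)
have := two_branches sl cY nd xY yY xy dxY dyY qY.
by rewrite dq dx; nia.
Qed.
End Uniqueness.

(** * Isometric embeddings of root lattices *)

Lemma gramE m n (A : 'M[int]_n) (M : 'M[int]_(m, n)) i j :
  (M *m A *m M^T) i j = pairing A (row i M) (row j M).
Proof.
rewrite /pairing -row_mul mxE [RHS]mxE; apply: eq_bigr => k _.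
by rewrite !mxE.
Qed.

Section IsometricMap.
Variables (m n : nat) (N : 'M[int]_m) (A : 'M[int]_n) (M : 'M[int]_(m, n)).
Hypotheses (slN : simply_laced N) (sl : simply_laced A).
Hypothesis gram : M *m A *m M^T = N.

Lemma pairing_map x y : pairing A (x *m M) (y *m M) = pairing N x y.
Proof. by rewrite /pairing -gram trmx_mul !mulmxA. Qed.

Lemma simple_map i : simple i *m M = row i M.
Proof. by rewrite /simple -rowE. Qed.

Lemma refl_map i x : refl N i x *m M = x *m M - pairing A (row i M) (x *m M) *: row i M.
Proof. by rewrite /refl mulmxBl -scalemxAl simple_map -simple_map pairing_map. Qed.

Lemma real_root_map : (forall i, real_root A (row i M)) ->
  forall v, real_root N v -> real_root A (v *m M).
Proof.
move=> rM v [w [i ->]]; elim: w => [|j w IH] /=; first by rewrite simple_map.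
rewrite refl_map; have [u eu] := real_root_reflection sl (rM j).
by rewrite -eu; apply: real_root_weyl.
Qed.

Lemma weyl_map (f : 'I_m -> 'I_n) : (forall i, row i M = simple (f i)) ->
  forall w v, weyl N w v *m M = weyl A (map f w) (v *m M).
Proof.
move=> fM w v; elim: w => //= i w IH.
by rewrite refl_map fM IH /refl.
Qed.
End IsometricMap.

Section Embedding.
Variables (m n : nat) (N : 'M[int]_m) (A : 'M[int]_n) (f : 'I_m -> 'I_n) (Y : {set 'I_n}).
Hypothesis sl : simply_laced A.
Hypothesis finj : injective f.
Hypothesis NE : forall i j, N i j = A (f i) (f j).
Hypothesis YE : Y = [set f i | i in 'I_m].

(** f is the inclusion of a subdiagram or a diagram automorphism; in both cases this is the induced
    isometry of root lattices. *)
Definition emb : 'M[int]_(m, n) := \matrix_i simple (f i).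

Lemma row_emb i : row i emb = simple (f i).
Proof. by rewrite rowK. Qed.

Lemma emb_gram : emb *m A *m emb^T = N.
Proof.
by apply/matrixP => i j; rewrite gramE !row_emb pairing_simple NE.
Qed.

Lemma sl_emb : simply_laced N.
Proof.
split; first split.
- by move=> i; rewrite NE (sl_diag sl).
- by move=> i j ij; rewrite NE (sl_off sl) // (inj_eq finj).
- by move=> i j; rewrite !NE (sl_sym sl).
- by apply/matrixP => i j; rewrite mxE !NE (sl_sym sl).
Qed.

Lemma emb_coord (x : 'rV[int]_m) i : (x *m emb) 0 (f i) = x 0 i.
Proof.
rewrite mxE (bigD1 i) //= big1 ?addr0.
  by rewrite mxE simpleE eqxx mulr1.
by move=> k ki; rewrite mxE simpleE (inj_eq finj) eq_sym (negPf ki) mulr0.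
Qed.

Lemma emb_inside (x : 'rV[int]_m) : inside Y (x *m emb).
Proof.
move=> j jY; rewrite mxE big1 // => k _; rewrite mxE simpleE.
have [e|_] := eqVneq j (f k); last by rewrite mulr0.
by case/negP: jY; rewrite YE e imset_f.
Qed.

Definition unemb (x : 'rV[int]_n) : 'rV[int]_m := \row_i x 0 (f i).

Lemma unembK x : inside Y x -> unemb x *m emb = x.
Proof.
move=> xY; apply/rowP => j; have [|jY] := boolP (j \in Y).
  by rewrite YE => /imsetP[i _ ->]; rewrite emb_coord mxE.
by rewrite emb_inside // xY.
Qed.

Lemma emb_inj : injective (fun x : 'rV[int]_m => x *m emb).
Proof. by move=> x y e; apply/rowP => i; rewrite -!emb_coord /= e. Qed.

Lemma emb_conn (Z : {set 'I_m}) : conn A [set f i | i in Z] <-> conn N Z.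
Proof.
split=> c J JZ J0 JN.
  have sJ : [set f i | i in J] \subset [set f i | i in Z] by apply: imsetS.
  have nJ : [set f i | i in J] != finset.set0.
    by have [i iJ] := set0Pn _ J0; apply/set0Pn; exists (f i); apply: imset_f.
  have NJ : [set f i | i in J] != [set f i | i in Z].
    by apply: contraNneq JN => /(imset_inj finj) ->.
  have [_ [_ [/imsetP[i iJ ->] /imsetP[j jZ ->] jJ Aij]]] := c _ sJ nJ NJ.
  by exists i, j; rewrite NE; split=> //; apply: contra jJ; apply: imset_f.
pose J' := f @^-1: J.
have JE : J = [set f i | i in J'].
  apply/setP => j; apply/idP/imsetP => [jJ|[i iJ ->]]; last by rewrite inE in iJ.
  have /imsetP[i _ e] := fintype.subsetP JZ _ jJ.
  by exists i => //; rewrite inE -e.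
have sJ : J' \subset Z.
  apply/fintype.subsetP => i; rewrite inE => /(fintype.subsetP JZ) /imsetP[k kZ /finj ->] //.
have nJ : J' != finset.set0.
  by have [j jJ] := set0Pn _ J0; move: jJ; rewrite JE => /imsetP[i iJ _]; apply/set0Pn; exists i.
have NJ : J' != Z by apply: contraNneq JN; rewrite JE => ->.
have [i [j [iJ jZ jJ Nij]]] := c J' sJ nJ NJ.
exists (f i), (f j); rewrite -NE; split=> //; first by rewrite inE in iJ.
- exact: imset_f.
- by move: jJ; rewrite inE.
Qed.

Lemma pairing_emb (x y : 'rV[int]_m) : pairing A (x *m emb) (y *m emb) = pairing N x y.
Proof. exact/pairing_map/emb_gram. Qed.

Lemma pairing_emb_simple i (y : 'rV[int]_m) : pairing A (simple (f i)) (y *m emb) = pairing N (simple i) y.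
Proof. by rewrite -row_emb -simple_map pairing_emb. Qed.

Lemma emb_null (Z : {set 'I_m}) d : null_on A [set f i | i in Z] (d *m emb) <-> null_on N Z d.
Proof.
split=> -[d0 dZ dn]; split.
- by move=> i iZ; rewrite -emb_coord d0 // imset_f.
- by move=> i iZ; rewrite -emb_coord dZ // mem_imset.
- by move=> i iZ; rewrite -pairing_emb_simple dn // imset_f.
- by move=> _ /imsetP[i iZ ->]; rewrite emb_coord d0.
- move=> j jZ; have [|jY] := boolP (j \in Y); last by rewrite emb_inside.
  rewrite YE => /imsetP[i _ e]; rewrite e emb_coord dZ //.
  by apply: contra jZ => iZ; rewrite e imset_f.
- by move=> _ /imsetP[i iZ ->]; rewrite pairing_emb_simple dn.
Qed.

Lemma ext_in_emb p d : ext_in N [set: 'I_m] p d <-> ext_in A Y (f p) (d *m emb).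
Proof.
have e : Y :\ f p = [set f i | i in [set: 'I_m] :\ p].
  apply/setP => j; rewrite !inE; apply/andP/imsetP.
    rewrite YE => -[jp /imsetP[i _ e]]; exists i => //.
    by rewrite !inE andbT; apply: contraNneq jp => <-; rewrite e.
  case=> i; rewrite !inE andbT => ip ->; rewrite (inj_eq finj) ip YE.
  by split=> //; apply: imset_f.
rewrite /ext_in e pairing_emb_simple; split=> -[_ cN nN dp]; split=> //.
- by rewrite YE imset_f.
- exact/emb_conn.
- exact/emb_null.
- by rewrite inE.
- exact/emb_conn.
- exact/emb_null.
Qed.
End Embedding.

(** * Affine types and null roots in terms of null vectors *)

Section AffineType.
Variables (R : realType) (m : nat) (N : 'M[int]_m).
Hypothesis sl : simply_laced N.
Local Notation B := (pairing N).
Local Notation I := [set: 'I_m].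
Implicit Types (d : 'rV[int]_m) (i j q : 'I_m).
Let NR : 'M[R]_m := map_mx intr N.
Let a (i j : 'I_m) : R := (N i j)%:~R.

Let asym i j : a i j = a j i. Proof. by rewrite /a (sl_sym sl). Qed.
Let aoff i j : i != j -> a i j <= 0. Proof. by move=> ij; rewrite lerz0 (sl_off sl). Qed.

Lemma root_norm_le0 d : imaginary_root R N d -> B d d <= 0.
Proof. by case=> rd nd; have [//|//] := km_root_real_or sl rd. Qed.

Lemma root_norm_le2 d : Defs.root R N d -> B d d <= 2.
Proof.
by move=> rd; have [/(norm_real_root sl) ->|/le_trans -> //] := km_root_real_or sl rd.
Qed.

Lemma conn_indecomposable : conn N I <-> indecomposable N.
Proof.
split=> c J.
  move=> J0 JN; have [i [j [iJ _ jJ Nij]]] := c J (finset.subsetT J) J0 JN.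
  by exists i, j; split=> //; left; apply/eqP.
move=> _ J0 JN; have [i [j [iJ jJ Nij]]] := c J J0 JN.
exists i, j; rewrite inE; split=> //; apply/eqP.
by case: Nij => // ; rewrite (sl_sym sl).
Qed.

Lemma real_kernel (u v : 'I_m -> R) : conn N I -> (forall i, 0 < u i) ->
  (forall i, \sum_j a i j * u j = 0) ->
  \sum_i \sum_j a i j * v i * v j = 0 -> forall i j, v i * u j = v j * u i.
Proof.
move=> c u0 au v0 i j.
have sI (g : 'I_m -> R) : \sum_(i in I) g i = \sum_i g i by apply: eq_bigl => k; rewrite inE.
apply: (@psd_eq0 _ _ I a u v asym aoff); rewrite ?inE //.
- by move=> k _; rewrite sI.
- move=> J JI J0 JN; have [k [l [kJ lI lJ Nkl]]] := c J JI J0 JN.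
  by exists k, l; rewrite intr_eq0.
- by rewrite sI -[RHS]v0; apply: eq_bigr => k _; rewrite sI.
Qed.

(** Semidefiniteness makes the kernel the line of u, whence the rank; the last clause follows by
    pairing with u, which is positive and in the kernel. The vertex q witnesses that the diagram is
    nonempty. *)
Lemma affine_of_null d q : conn N I -> null_on N I d -> affine_type R N.
Proof.
move=> c [d0 _ dn].
pose u i : R := (d 0 i)%:~R.
have u0 i : 0 < u i by rewrite ltr0z d0 ?inE.
have au i : \sum_j a i j * u j = 0.
  have := dn i (finset.in_setT _); rewrite pairing_simple_coord // => e.
  by rewrite -[RHS](congr1 (intr : int -> R) e) rmorph_sum; apply: eq_bigr => j _; rewrite -intrM.
pose U : 'rV[R]_m := \row_i u i.
have NRU : NR *m U^T = 0.
  apply/matrixP => i j; rewrite !mxE -[RHS](au i); apply: eq_bigr => k _; by rewrite !mxE.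
have NRT : NR^T = NR by apply/matrixP => i j; rewrite !mxE (sl_sym sl).
have UNR : U *m NR = 0 by rewrite -[LHS]trmxK trmx_mul NRT NRU trmx0.
split.
- by case: sl.
- exact/conn_indecomposable.
- have kU : (kermx NR :=: U)%MS.
    apply/eqmxP/andP; split; last exact/sub_kermxP.
    apply/row_subP => k; set v := row k _.
    have vN : v *m NR = 0 by rewrite /v -row_mul mulmx_ker row0.
    move: v vN => v vN.
    have e := @real_kernel u (fun i => v 0 i) c u0 au.
    have -> : v = (v 0 q / u q) *: U; last exact: scalemx_sub.
    apply/rowP => i; rewrite !mxE.
    rewrite mulrAC -(e _ i q) ?mulfK ?gt_eqF //.
    have : (v *m NR *m v^T) 0 0 = 0 by rewrite vN mul0mx mxE.
    move=> E; rewrite -[RHS]E [RHS]mxE exchange_big; apply: eq_bigr => j _ /=.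
    rewrite [in RHS]mxE mulr_suml; apply: eq_bigr => l _.
    by rewrite [v^T _ _]mxE [NR _ _]mxE -/(a l j) (mulrC (v 0 l)).
  have := mxrank_ker NR; rewrite kU rank_rV.
  have -> : U != 0.
    by apply/eqP => /rowP /(_ q) /eqP; rewrite !mxE (gt_eqF (u0 q)).
  by have := rank_leq_row NR; rewrite -/NR; lia.
- exists U^T; split=> // i; by rewrite !mxE.
- move=> v v0; have s0 : \sum_i u i * (NR *m v) i 0 = 0.
    transitivity ((U *m (NR *m v)) 0 0); last by rewrite mulmxA UNR mul0mx mxE.
    by rewrite [RHS]mxE; apply: eq_bigr => i _; rewrite [U _ _]mxE.
  apply/matrixP => i j; rewrite (ord1 j) [RHS]mxE; apply/eqP.
  move/eqP: s0; rewrite psumr_eq0 => [/allP /(_ i (mem_index_enum _))|k _].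
    by rewrite /= mulf_eq0 (gt_eqF (u0 i)) => /eqP ->.
  by apply: mulr_ge0; [apply/ltW/u0|apply: v0].
Qed.

(** An imaginary root has norm at most 0 and the form is semidefinite, so d is isotropic, hence
    proportional to the positive kernel vector u. *)
Lemma null_of_affine d : affine_type R N -> imaginary_root R N d -> positive d ->
  conn N I /\ null_on N I d.
Proof.
move=> [_ /conn_indecomposable c _ [u [u0 NRu]] _] id [dn0 d0]; split=> //.
have au i : \sum_j a i j * u j 0 = 0.
  move/matrixP/(_ i 0): NRu; rewrite !mxE => e; rewrite -[RHS]e.
  by apply: eq_bigr => j _; rewrite mxE.
have sI (g : 'I_m -> R) : \sum_(i in I) g i = \sum_i g i by apply: eq_bigl => k; rewrite inE.
have sum_norm : (B d d)%:~R = \sum_i \sum_j a i j * (d 0 i)%:~R * (d 0 j)%:~R :> R.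
  rewrite pairing_coord rmorph_sum; apply: eq_bigr => i _.
  rewrite pairing_simple_coord // mulr_sumr rmorph_sum; apply: eq_bigr => j _.
  by rewrite /a -!intrM mulrCA mulrA.
have ge0 : 0 <= \sum_i \sum_j a i j * (d 0 i)%:~R * (d 0 j)%:~R :> R.
  have := @psd_ge0 _ _ I a (fun i => u i 0) (fun i => (d 0 i)%:~R) asym aoff.
  rewrite sI; under eq_bigr do rewrite sI; apply=> i _ //.
  by rewrite sI.
have dd0 : B d d = 0.
  apply/eqP; rewrite eq_le root_norm_le0 //= -(ler0z R) sum_norm //.
have e := real_kernel (u := fun i => u i 0) (v := fun i => (d 0 i)%:~R) c u0 au.
rewrite -sum_norm dd0 in e; have {}e := e erefl.
have [k dk] : exists k, 0 < d 0 k.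
  apply: contrapT => /forallNP none; apply: dn0; apply/rowP => i; rewrite mxE.
  by have := none i; have := d0 i; lia.
split.
- move=> i _; rewrite lt_def d0 andbT; apply/eqP => di.
  have /eqP := e i k; rewrite di mul0r eq_sym mulf_eq0 intr_eq0 !gt_eqF ?u0 //.
- by move=> i; rewrite inE.
- move=> i _; apply/eqP; rewrite -(intr_eq0 R) pairing_simple_coord // rmorph_sum /=.
  apply/eqP; apply: (mulfI (lt0r_neq0 (u0 k))); rewrite mulr0 mulr_sumr.
  have := au i => /(congr1 ( *%R (d 0 k)%:~R)); rewrite mulr0 mulr_sumr => E; rewrite -[RHS]E.
  by apply: eq_bigr => j _; rewrite intrM mulrCA [RHS]mulrCA e [_ * u k 0]mulrC.
Qed.

(** The vector d - alpha_q has norm 2, so it is a real root, and it pairs to -2 with alpha_q: hence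
    d is a root. A positive imaginary root b is isotropic, so b = b_q d with b_q >= 1. *)
Lemma null_root_of d q : conn N I -> null_on N I d -> d 0 q = 1 -> null_root R N d.
Proof.
move=> c nd dq; have [d0 _ dn] := nd.
have dd := null_on_norm nd.
have nI x : inside I x by move=> j; rewrite inE.
have dn0 : d <> 0 by move=> e; rewrite e mxE in dq.
have dpos : positive d by split=> // i; apply/ltW/d0; rewrite inE.
have dqq : B (simple q) d = 0 by apply: dn; rewrite inE.
have rd : Defs.root R N d.
  have -> : d = d - simple q + simple q by rewrite subrK.
  apply: km_root_add; rewrite ?subrK //.
    apply: (real_root_km sl); apply: (affine_norm2_real sl nd c) => //.
    by rewrite !pairingE dd (pairingC sl d) dqq norm_simple.
  by rewrite !pairingE dqq norm_simple.
split=> //; first by split=> // /(norm_real_root sl); rewrite dd.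
move=> b ib [b0 bge].
have bb : B b b = 0.
  by apply/eqP; rewrite eq_le root_norm_le0 // (affine_norm_ge0 sl nd).
have e := affine_norm0 sl nd c (nI b) bb.
have eb : b = b 0 q *: d by apply/rowP => i; rewrite mxE -e dq mulr1.
have hd := height_ge0 dpos.2.
rewrite eb heightZ; have := bge q.
rewrite le_eqVlt => /orP[/eqP b0'|bq]; first by case: b0; rewrite eb -b0' scale0r.
by nia.
Qed.
End AffineType.

Section ExtVertex.
Variables (R : realType) (m : nat) (M : 'M[int]_m).
Hypothesis sl : simply_laced M.

Lemma ext_vertexP p : ext_vertex R M p <-> exists d, ext_in M [set: 'I_m] p d.
Proof.
rewrite /ext_vertex; set Y := [set~ p].
pose f (i : 'I_#|Y|) : 'I_m := enum_val i.
have finj : injective f by apply: enum_val_inj.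
have NE i j : subdiagram M Y i j = M (f i) (f j) by rewrite mxE.
have YE : Y = [set f i | i in 'I_#|Y|].
  apply/setP => j; apply/idP/imsetP => [jY|[i _ ->]]; last exact: enum_valP.
  by exists (enum_rank_in jY j) => //; rewrite /f enum_rankK_in.
have slN := sl_emb sl finj NE.
have YT : [set: 'I_m] :\ p = [set f i | i in [set: 'I_#|Y|]].
  rewrite (_ : [set: 'I_m] :\ p = Y); last by apply/setP => j; rewrite !inE andbT.
  apply/setP => j; apply/idP/imsetP => [jY|[i _ ->]]; last exact: enum_valP.
  by exists (enum_rank_in jY j); rewrite ?inE /f ?enum_rankK_in.
have pE (d : 'rV_#|Y|) : \sum_(i < #|Y|) d 0 i * M (enum_val i) p =
    pairing M (simple p) (d *m emb f).
  rewrite pairingC // pairing_coord.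
  rewrite (bigID (mem Y)) /= [X in _ + X]big1 ?addr0 => [|j jY]; last first.
    by rewrite (emb_inside YE) // mul0r.
  rewrite (big_enum_val (fun j => (d *m emb f) 0 j * pairing M (simple j) (simple p))).
  by apply: eq_bigr => i _; rewrite emb_coord // pairing_simple.
split=> [[aff [d [nd dp]]]|[D Ep]].
  have [id pd _] := nd; have [cN nN] := null_of_affine slN aff id pd.
  exists (d *m emb f); split; rewrite ?inE // ?YT -?pE //.
    exact/(emb_conn finj NE).
  exact/(emb_null finj NE YE).
have [q [qY dq _ _]] := ext_neighbor sl Ep.
have [_ cY nD Dp] := Ep; rewrite YT in cY nD qY.
have DY : inside Y D by case: nD => _ + _; rewrite -YT (_ : _ :\ p = Y) //; apply/setP => j; rewrite !inE andbT.
have UD : unemb f D *m emb f = D by apply: (unembK finj YE DY).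
rewrite -UD in nD.
have cN := (emb_conn finj NE _).1 cY.
have nN := (emb_null finj NE YE _ _).1 nD.
have /imsetP[i _ qi] := qY; have {}dq : (unemb f D) 0 i = 1 by rewrite mxE -qi.
split; first exact: (affine_of_null R slN i cN nN).
exists (unemb f D); split; first exact: (null_root_of R slN cN nN dq).
by rewrite pE UD.
Qed.

Lemma ext_typeP : ext_type R M <-> exists p d, ext_in M [set: 'I_m] p d.
Proof.
split=> [[_ [p /ext_vertexP [d E]]]|[p [d E]]]; first by exists p, d.
by split=> //; exists p; apply/ext_vertexP; exists d.
Qed.

Lemma finite_verticesE p d q : ext_in M [set: 'I_m] p d -> q != p -> M q p <> 0 ->
  (forall j, j != p -> j != q -> M j p = 0) ->
  finite_vertices R M = [set r | (r != p) && (r != q)].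
Proof.
move=> E qp Mqp oth; apply/setP => r; rewrite !inE; apply/asboolP/andP.
  move=> /(_ p); case; first by apply/ext_vertexP; exists d.
  move=> /eqP rp Mrp; split=> //; apply/eqP => e; apply: Mqp; by rewrite -e.
move=> [rp rq] p' /ext_vertexP [d' E'].
have <- := ext_vertex_unique sl E E'.
by split; [apply/eqP|apply: oth].
Qed.
End ExtVertex.

(** * Normal form of a labelled pi-system *)

Lemma shift_gt0 (x c : int) (m : nat) : (absz x < m)%N -> 0 < c ->
  0 < x + (2 * m)%N%:Z * c.
Proof. by move=> xm c0; nia. Qed.

Lemma shift_lt0 (x c : int) (m : nat) : (absz x < m)%N -> c < 0 ->
  x + (2 * m)%N%:Z * c < 0.
Proof. by move=> xm c0; nia. Qed.

Section PiMatrices.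
Variables (n k : nat) (X : 'M[int]_n) (K : 'M[int]_k).
Hypotheses (slX : simply_laced X) (slK : simply_laced K).
Local Notation B := (pairing X).
Implicit Types (M : 'M[int]_(k, n)) (w : seq 'I_n) (j : 'I_n) (i : 'I_k).

(* A pi-system of type K with a labelling by the vertices of K, as the matrix of its rows. *)
Definition pi_mx M := (forall i, real_root X (row i M)) /\ M *m X *m M^T = K.

Definition weyl_mx w M : 'M[int]_(k, n) := \matrix_i weyl X w (row i M).

Lemma row_weyl_mx w M i : row i (weyl_mx w M) = weyl X w (row i M).
Proof. by rewrite rowK. Qed.

Lemma mulmx_rows (v : 'rV[int]_k) M : v *m M = \sum_i v 0 i *: row i M.
Proof. by rewrite mulmx_sum_row. Qed.

Lemma mul_weyl_mx (v : 'rV[int]_k) w M : v *m weyl_mx w M = weyl X w (v *m M).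
Proof.
rewrite !mulmx_rows weyl_sum //; apply: eq_bigr => i _.
by rewrite row_weyl_mx weylZ.
Qed.

Lemma pi_mx_weyl w M : pi_mx M -> pi_mx (weyl_mx w M).
Proof.
move=> [rM gM]; split=> [i|]; first by rewrite row_weyl_mx; apply: real_root_weyl.
apply/matrixP => i j; rewrite gramE !row_weyl_mx weyl_isom //.
by rewrite -gramE gM.
Qed.

Lemma row_opp M i : row i (- M) = - row i M.
Proof. by apply/rowP => j; rewrite !mxE. Qed.

Lemma pi_mx_opp M : pi_mx M -> pi_mx (- M).
Proof.
move=> [rM gM]; split=> [i|]; first by rewrite row_opp; apply: real_root_opp.
apply/matrixP => i j; rewrite gramE !row_opp pairingNl pairingNr opprK.
by rewrite -gramE gM.
Qed.

Variables (pK : 'I_k) (dK : 'rV[int]_k).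
Hypothesis EK : ext_in K [set: 'I_k] pK dK.

Section Translations.
Variable M : 'M[int]_(k, n).
Hypothesis HM : pi_mx M.
Let D := dK *m M.

Lemma pi_pairing x y : B (x *m M) (y *m M) = pairing K x y.
Proof. by apply: pairing_map; case: HM. Qed.

Lemma pi_null_norm : B D D = 0.
Proof. by case: EK => _ _ nK _; rewrite pi_pairing (null_on_norm nK). Qed.

Lemma pi_null_row i : B (row i M) D = - (i == pK)%:R.
Proof.
rewrite -simple_map pi_pairing; case: EK => _ _ [_ _ dn] dp.
by case: eqVneq => [->//|ip]; rewrite dn ?oppr0 // !inE ip.
Qed.

Lemma pi_null_neq0 : D <> 0.
Proof. by move=> D0; have := pi_null_row pK; rewrite D0 pairing0r eqxx. Qed.

(* b = row i M and c = D - b are real roots with (b|c) = -2; s_b s_c translates by 2 D. *)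
Lemma pi_translate i m : i != pK ->
  real_root X (row i M + (2 * m)%N%:Z *: D) /\ real_root X (- row i M + (2 * m)%N%:Z *: D).
Proof.
move=> ip; have [rM gM] := HM; have [_ cY nK dp] := EK; have [d0 dY dn] := nK.
set b := row i M; set c := D - b.
have ref v x : real_root X v -> real_root X x -> real_root X (x - B v x *: v).
  by move=> /(real_root_reflection slX) [w e] rx; rewrite -e; apply: real_root_weyl.
have bD : B b D = 0 by rewrite pi_null_row (negPf ip) oppr0.
have bb : B b b = 2 by apply: (norm_real_root slX (rM i)).
have DD := pi_null_norm.
(* delta - alpha_i has norm 2 in the affine part of K, so it is a real root there; M carries real
   roots to real roots. *)
have rc : real_root X c.
  have -> : c = (dK - simple i) *m M by rewrite mulmxBl simple_map.
  apply: (real_root_map slX gM rM); apply: (affine_norm2_real slK nK cY).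
    move=> j jY; rewrite mxE dY // mxE simpleE; case: eqVneq jY => [->|_ _].
      by rewrite !inE ip.
    by rewrite subr0.
  rewrite !pairingE (null_on_norm nK) (pairingC slK dK) dn ?inE ?ip //.
  by rewrite norm_simple.
elim: m => [|m [IH1 IH2]].
  by rewrite muln0 scale0r !addr0; split; [apply: rM|apply/real_root_opp/rM].
have r1 : real_root X (- b + (2 * m.+1)%N%:Z *: D).
  have := ref _ _ rc IH1; rewrite /c !pairingE bD bb DD (pairingC slX D b) bD.
  congr real_root; apply/rowP => j; rewrite !mxE; lia.
split=> //; have := ref _ _ (rM i) r1; rewrite -/b !pairingE bD bb.
by congr real_root; apply/rowP => j; rewrite !mxE; lia.
Qed.

Let q_exists : exists q, q != pK.
Proof. by have [q [qY _ _ _]] := ext_neighbor slK EK; exists q; move: qY; rewrite !inE andbT. Qed.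

Lemma pi_null_sign : nonneg D \/ nonneg (- D).
Proof.
have [|n1] := pselect (nonneg D); [by left|right=> a; rewrite mxE].
have [b Db] : exists b, D 0 b < 0.
  apply: contrapT => /forallNP none; apply: n1 => b; rewrite leNgt; apply/negP; exact: none.
rewrite oppr_ge0 leNgt; apply/negP => Da.
have [q qp] := q_exists.
(* m is so large that the a- and b-coordinates of the translate have the signs of those of D. *)
set m := (absz (row q M 0%R a) + absz (row q M 0%R b) + 1)%N.
have [r1 _] := pi_translate m qp.
have e l : (row q M + (2 * m)%N%:Z *: D) 0 l = row q M 0 l + (2 * m)%N%:Z * D 0 l.
  by rewrite !mxE.
have lb : row q M 0 b + (2 * m)%N%:Z * D 0 b < 0 by apply: shift_lt0 => //; rewrite /m; lia.
have la : 0 < row q M 0 a + (2 * m)%N%:Z * D 0 a by apply: shift_gt0 => //; rewrite /m; lia.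
have [/(_ b)|/(_ a)] := real_root_sign slX r1; first by rewrite e; lia.
by rewrite mxE e; lia.
Qed.

Hypothesis D0 : nonneg D.

Let pos_coord : exists a, 0 < D 0 a.
Proof.
apply: contrapT => /forallNP none; apply: pi_null_neq0; apply/rowP => a.
by rewrite [RHS]mxE -/D; apply/eqP; rewrite eq_le D0 andbT leNgt; apply/negP/none.
Qed.

(** Far translates of b and of -b by D are positive at a coordinate a with D_a > 0, so both are
    positive roots. Where D_j = 0 they have coordinates b_j and -b_j, which must both be
    nonnegative. *)
Lemma pi_row_inside i : i != pK -> inside (supp D) (row i M).
Proof.
move=> ip j; rewrite inE negbK => /eqP Dj; have [a Da] := pos_coord.
set m := (absz (row i M 0%R a) + 1)%N.
have [r1 r2] := pi_translate m ip.
have e1 : (row i M + (2 * m)%N%:Z *: D) 0 a = row i M 0 a + (2 * m)%N%:Z * D 0 a by rewrite !mxE.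
have e2 : (- row i M + (2 * m)%N%:Z *: D) 0 a = - row i M 0 a + (2 * m)%N%:Z * D 0 a by rewrite !mxE.
have e3 : (row i M + (2 * m)%N%:Z *: D) 0 j = row i M 0 j by rewrite mxE [X in _ + X]mxE Dj mulr0 addr0.
have e4 : (- row i M + (2 * m)%N%:Z *: D) 0 j = - row i M 0 j.
  by rewrite mxE [X in _ + X]mxE Dj mulr0 addr0 mxE.
have s x : real_root X x -> 0 < x 0 a -> 0 <= x 0 j.
  move=> /(real_root_sign slX) [x0 _|x0 xa]; first exact: x0.
  by have := x0 a; rewrite mxE oppr_ge0 leNgt xa.
have := s _ r1; have := s _ r2; rewrite e1 e2 e3 e4.
move=> s2 s1; have {}s1 : 0 <= row i M 0 j by apply: s1; apply: shift_gt0 => //; rewrite /m; lia.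
have {}s2 : 0 <= - row i M 0 j by apply: s2; apply: shift_gt0 => //; rewrite /m; lia.
by lia.
Qed.

(** A far translate of a row other than pK is a positive real root whose support is exactly that of
    D. *)
Lemma pi_null_conn : conn X (supp D).
Proof.
have [q qp] := q_exists.
pose S := (\sum_j absz (row q M 0%R j))%N.
have bS j : (absz (row q M 0%R j) <= S)%N by rewrite /S (bigD1 j) //= leq_addr.
have [r1 _] := pi_translate (S + 1) qp.
set x := row q M + _ in r1.
have xE j : x 0 j = row q M 0 j + (2 * (S + 1))%N%:Z * D 0 j by rewrite /x !mxE.
have sx j : (j \in supp D -> 0 < x 0 j) /\ (j \notin supp D -> x 0 j = 0).
  rewrite xE; split=> jD.
    have : 0 < D 0 j by rewrite lt_def D0 andbT; rewrite inE in jD.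
    by apply: shift_gt0; rewrite addn1 ltnS.
  rewrite pi_row_inside //; move: jD; rewrite inE negbK => /eqP ->; lia.
have -> : supp D = supp x.
  apply/setP => j; have [s1 s2] := sx j.
  have [/s1 xj|/s2 xj] := boolP (j \in supp D); rewrite [RHS]inE ?xj ?eqxx //.
  by rewrite gt_eqF.
apply: (real_root_conn slX r1) => j; have [s1 s2] := sx j.
by have [/s1/ltW|/s2 ->] := boolP (j \in supp D).
Qed.
End Translations.

(** A simple reflection turning D negative would make D a multiple of a simple root, and isotropy
    would give D = 0. So D behaves like a positive imaginary root and is not conjugate to -D. *)
Lemma pi_null_orbit w M : pi_mx M -> nonneg (dK *m M) -> nonneg (weyl X w (dK *m M)).
Proof.
move=> HM D0; elim: w => //= j w IH.
have HM' := pi_mx_weyl w HM.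
have := pi_null_sign (pi_mx_weyl (j :: w) HM); rewrite mul_weyl_mx /=.
set D := weyl X w _ in IH *; case=> // neg.
have DD : B D D = 0 by rewrite weyl_isom // (pi_null_norm HM).
have ev : D = D 0 j *: simple j.
  apply/rowP => l; rewrite mxE simpleE; case: (eqVneq l j) => [->|lj]; first by rewrite mulr1.
  rewrite mulr0; have := neg l; have := IH l.
  by rewrite mxE refl_coord (negPf lj); lia.
have Dj : D 0 j = 0 by move: DD; rewrite {1 2}ev pairingZl pairingZr norm_simple //; nia.
by have := pi_null_neq0 HM'; rewrite mul_weyl_mx -/D ev Dj scale0r.
Qed.

Lemma pi_null_chamber M : pi_mx M -> nonneg (dK *m M) ->
  exists w, forall j, B (simple j) (weyl X w (dK *m M)) <= 0.
Proof.
have [N] := ubnP (absz (height (dK *m M))); elim: N M => // N IH M hN HM D0.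
have [[j aj]|none] := pselect (exists j, 0 < B (simple j) (dK *m M)); last first.
  by exists [::] => j; rewrite leNgt; apply/negP => aj; apply: none; exists j.
have D1 := pi_null_orbit [:: j] HM D0.
have [|||w hw] := IH (weyl_mx [:: j] M).
- rewrite mul_weyl_mx /= height_refl; have := height_ge0 D1; have := height_ge0 D0.
  by rewrite /= height_refl; move: hN; lia.
- exact: pi_mx_weyl.
- by rewrite mul_weyl_mx.
exists (rcons w j) => l; rewrite weyl_rcons.
by have := hw l; rewrite mul_weyl_mx.
Qed.

End PiMatrices.

Section NormalForm.
Variables (n k : nat) (X : 'M[int]_n) (K : 'M[int]_k).
Hypotheses (slX : simply_laced X) (slK : simply_laced K).
Local Notation B := (pairing X).
Local Notation pi_mx := (pi_mx X K).
Local Notation weyl_mx := (weyl_mx X).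
Implicit Types (M : 'M[int]_(k, n)) (w : seq 'I_n) (i : 'I_k) (j p : 'I_n) (d : 'rV[int]_n).
Implicit Type Z : {set 'I_n}.
Variables (pK : 'I_k) (dK : 'rV[int]_k).
Hypothesis EK : ext_in K [set: 'I_k] pK dK.

Lemma weyl_fix w x : (forall j, j \in w -> B (simple j) x = 0) -> weyl X w x = x.
Proof.
elim: w => //= j w IH h; rewrite IH => [|l lw]; last by apply: h; rewrite inE lw orbT.
by rewrite /refl h ?mem_head // scale0r subr0.
Qed.

(** Since (D|D) = 0 is a sum of nonpositive terms, D is orthogonal to the simple roots of its
    support. Likewise the pairing -1 of [row pK M] with D has exactly one nonzero term, at p; this
    row is positive, for a negative root would pair to at least 0 with D. *)
Lemma pi_null_ext M : pi_mx M -> nonneg (dK *m M) ->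
  (forall j, B (simple j) (dK *m M) <= 0) ->
  exists p, [/\ ext_in X (p |: supp (dK *m M)) p (dK *m M), row pK M 0 p = 1 &
    forall j, j != p -> row pK M 0 j = 0 \/ B (simple j) (dK *m M) = 0].
Proof.
move=> HM D0 Dle; set D := dK *m M in D0 Dle *.
have [rM gM] := HM.
have DD : B D D = 0 := pi_null_norm EK HM.
have pD : B (row pK M) D = -1 by rewrite (pi_null_row EK HM) eqxx.
have nD : null_on X (supp D) D.
  split=> [j|j|j jD].
  - by rewrite inE => Dj; rewrite lt_def Dj D0.
  - by rewrite inE negbK => /eqP.
  - have Dj : D 0 j != 0 by rewrite inE in jD.
    move/eqP: DD; rewrite pairing_coord -oppr_eq0 -sumrN psumr_eq0 => [/allP /(_ j)|l _].
      by rewrite mem_index_enum oppr_eq0 mulf_eq0 (negPf Dj) => /(_ isT) /eqP.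
    by rewrite oppr_ge0 mulr_ge0_le0.
have b0 : nonneg (row pK M).
  have [//|bneg] := real_root_sign slX (rM pK).
  have : 0 <= B (row pK M) D.
    rewrite pairing_coord; apply: sumr_ge0 => j _; apply: mulr_le0 => //.
    by have := bneg j; rewrite mxE oppr_ge0.
  by rewrite pD.
set b := row pK M in pD b0 *.
have term j : b 0 j * B (simple j) D <= 0 by apply: mulr_ge0_le0.
have [p bp] : exists p, b 0 p * B (simple p) D != 0.
  apply: contrapT => /forallNP none; move: pD; rewrite pairing_coord big1 // => j _.
  exact/eqP/negPn/negP/none.
have e : b 0 p * B (simple p) D + \sum_(j | j != p) b 0 j * B (simple j) D = -1.
  by rewrite -pD [RHS]pairing_coord [RHS](bigD1 p).
have s0 : \sum_(j | j != p) b 0 j * B (simple j) D <= 0 by apply: sumr_le0.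
have z0 : \sum_(j | j != p) b 0 j * B (simple j) D = 0 by have := term p; move: bp; lia.
rewrite z0 addr0 in e.
have [bp1 Dp] : b 0 p = 1 /\ B (simple p) D = -1.
  have := b0 p; have := Dle p; move: e; move: (b 0 p) (B (simple p) D) => x y; clear.
  move=> e y0 x0; have y1 : y <= -1 by nia. have x1 : x = 1 by nia.
  by split=> //; rewrite x1 mul1r in e.
have pD' : p \notin supp D by apply/negP => ps; case: nD => _ _ /(_ p ps); rewrite Dp.
exists p; split=> //.
  split=> //; first by rewrite !inE eqxx.
  - by rewrite setU1K //; apply: (pi_null_conn slX slK EK HM).
  - by rewrite setU1K.
move=> j jp; move/eqP: z0; rewrite -oppr_eq0 -sumrN psumr_eq0 => [/allP /(_ j)|l _].
  by rewrite mem_index_enum jp oppr_eq0 mulf_eq0 => /(_ isT) /orP[/eqP|/eqP]; auto.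
by rewrite oppr_ge0.
Qed.

(* An element of minimal height in the orbit of b under the stabilizer of d is simple. *)
Lemma straighten d p b : real_root X b -> b 0 p = 1 -> B (simple p) d = -1 ->
  (forall j, j != p -> b 0 j = 0 \/ B (simple j) d = 0) ->
  exists w, (forall j, j \in w -> B (simple j) d = 0) /\ weyl X w b = simple p.
Proof.
move=> rb bp Dp; have [N] := ubnP (absz (height b)); elim: N b rb bp => // N IH b rb bp hN oth.
have b0 : nonneg b.
  by case: (real_root_sign slX rb) => // /(_ p); rewrite mxE bp.
have [[j [jJ aj]]|none] := pselect (exists j, B (simple j) d = 0 /\ 0 < B (simple j) b).
  have jp : j != p by apply/eqP => e; rewrite e Dp in jJ.
  have rb' := real_root_refl j rb.
  have bp' : refl X j b 0 p = 1 by rewrite refl_coord eq_sym (negPf jp) mulr0 subr0.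
  have b0' : nonneg (refl X j b).
    by case: (real_root_sign slX rb') => // /(_ p); rewrite mxE bp'.
  have hN' : (absz (height (refl X j b)) < N)%N.
    by have := height_ge0 b0; have := height_ge0 b0'; move: hN; rewrite height_refl; lia.
  have oth' l : l != p -> refl X j b 0 l = 0 \/ B (simple l) d = 0.
    move=> lp; rewrite refl_coord; case: eqVneq => [->|lj]; first by right.
    by rewrite mulr0 subr0; apply: oth.
  have [w [wJ ew]] := IH _ rb' bp' hN' oth'.
  exists (rcons w j); split=> [l|]; last by rewrite weyl_rcons.
  by rewrite mem_rcons inE => /orP[/eqP ->|/wJ].
(* No reflection lowers b any more. From 2 = (b|b) <= (alpha_p|b) = 2 + S with S <= 0 one gets S =
   0: p is joined to no other vertex of the connected support. *)
have le2 j : j != p -> X p j * b 0 j <= 0.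
  by move=> jp; apply: mulr_le0_ge0 => //; apply: (sl_off slX); rewrite eq_sym.
have e1 := norm_real_root slX rb.
rewrite pairing_coord (bigD1 p) //= bp mul1r in e1; move: e1; set S1 := (X in _ + X) => e1.
have le1 : S1 <= 0.
  apply: sumr_le0 => j jp; case: (oth j jp) => [->|dj]; first by rewrite mul0r.
  apply: mulr_ge0_le0; first exact: b0.
  by rewrite leNgt; apply/negP => aj; apply: none; exists j.
have e2 : B (simple p) b = 2 + \sum_(j | j != p) X p j * b 0 j.
  by rewrite pairing_simple_coord // (bigD1 p) //= (sl_diag slX) bp mulr1.
have z : \sum_(j | j != p) X p j * b 0 j = 0.
  apply/eqP; rewrite eq_le sumr_le0 //=.
  move: e2; set S2 : int := (X in _ + X) => e2; change (0 <= S2); move: le1 e1; rewrite e2; clear; lia.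
have zj j : j != p -> X p j * b 0 j = 0.
  move=> jp; move/eqP: z; rewrite -oppr_eq0 -sumrN psumr_eq0 => [/allP /(_ j)|l lp].
    by rewrite mem_index_enum jp oppr_eq0 => /(_ isT) /eqP.
  by rewrite oppr_ge0 le2.
have pb : p \in supp b by rewrite inE bp.
exists [::]; split=> //=.
suff sb : supp b = [set p].
  apply/rowP => j; rewrite simpleE; case: eqVneq => [->//|jp].
  have : j \notin supp b by rewrite sb inE.
  by rewrite inE negbK => /eqP.
apply/eqP; apply: contraT; rewrite eq_sym => bN.
have pN0 : [set p] != finset.set0 by apply/set0Pn; exists p; rewrite inE.
have psub : [set p] \subset supp b by rewrite finset.sub1set.
have [i [j [ip jb jp Xij]]] := real_root_conn slX rb b0 psub pN0 bN.
rewrite inE in ip; rewrite (eqP ip) in Xij; rewrite inE in jp.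
have /eqP := zj j jp; rewrite mulf_eq0 (negPf Xij) /=.
by rewrite inE in jb; rewrite (negPf jb).
Qed.

Definition normal_form Z p d M :=
  [/\ pi_mx M, ext_in X Z p d, dK *m M = d & row pK M = simple p].

Lemma normal_form_exists M : pi_mx M -> exists c w Z p d,
  (c = 1 \/ c = -1) /\ normal_form Z p d (weyl_mx w (c *: M)).
Proof.
move=> HM.
have [c [c1 HcM D0]] : exists c, [/\ c = 1 \/ c = -1, pi_mx (c *: M) & nonneg (dK *m (c *: M))].
  have [D0|D0] := pi_null_sign slX slK EK HM.
    by exists 1; split; rewrite ?scale1r; auto.
  exists (-1); split; rewrite ?scaleN1r ?mulmxN; auto.
  exact: pi_mx_opp.
exists c; move: (c *: M) HcM D0 => {HM} {}M HM D0.
have [w1 w1D] := pi_null_chamber slX slK EK HM D0.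
have HM1 := pi_mx_weyl slX w1 HM.
have D1 : nonneg (dK *m weyl_mx w1 M) by rewrite mul_weyl_mx; apply: (pi_null_orbit slX slK EK).
have [|p [E1 bp oth]] := pi_null_ext HM1 D1; first by move=> j; rewrite mul_weyl_mx.
have [_ _ _ Dp] := E1.
have [w2 [w2J e2]] := straighten (HM1.1 pK) bp Dp oth.
exists (w2 ++ w1), (p |: supp (dK *m weyl_mx w1 M)), p, (dK *m weyl_mx w1 M); split=> //.
have -> : weyl_mx (w2 ++ w1) M = weyl_mx w2 (weyl_mx w1 M).
  by apply/row_matrixP => i; rewrite !row_weyl_mx weyl_cat.
split=> //.
- exact: pi_mx_weyl.
- by rewrite mul_weyl_mx weyl_fix.
- by rewrite row_weyl_mx.
Qed.

(** For a row supported on the affine part, the inner product with alpha_p is minus the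
    q-coordinate, and it equals K i pK = 0. *)
Lemma normal_form_inside Z p d M q i : normal_form Z p d M ->
  X q p = -1 -> (forall j, j \in Z :\ p -> j != q -> X j p = 0) ->
  i != pK -> K i pK = 0 -> inside (Z :\ p :\ q) (row i M).
Proof.
move=> [HM [pZ cY nd dp] dM eM] Xq Xj ip Kip.
have d0 := null_on_ge0 nd.
have iY : inside (Z :\ p) (row i M).
  have -> : Z :\ p = supp d.
    apply/setP => j; have [d0' dY _] := nd; rewrite [RHS]inE.
    have [jY|jY] := boolP (j \in Z :\ p); first by rewrite gt_eqF // d0'.
    by rewrite dY // eqxx.
  by rewrite -dM; apply: (pi_row_inside slX slK EK HM); rewrite ?dM.
move=> j; rewrite inE negb_and negbK => /orP[|]; last exact: iY.
rewrite !inE => /eqP ->.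
have : B (row i M) (simple p) = 0 by rewrite -eM -gramE HM.2.
rewrite pairing_coord (bigD1 q) //= pairing_simple Xq big1 => [|l lq]; first by lia.
rewrite pairing_simple; have [lY|lY] := boolP (l \in Z :\ p); first by rewrite Xj ?mulr0.
by rewrite iY ?mul0r.
Qed.

(** The relabelling s preserves K and thus permutes its vertices; uniqueness of the extending vertex
    and of the null vector makes it fix both. *)
Lemma gram_perm (M1 M2 : 'M[int]_(k, n)) (s : 'I_k -> 'I_k) : pi_mx M1 -> pi_mx M2 ->
  (forall i, row i M1 = row (s i) M2) ->
  [/\ injective s, s pK = pK, dK *m emb s = dK & M1 = emb s *m M2].
Proof.
move=> [_ g1] [_ g2] es.
have Ks (i j : 'I_k) : K i j = K (s i) (s j) by rewrite -{1}g1 -{1}g2 !gramE !es.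
have sinj : injective s.
  move=> i j e; apply/eqP; apply: contraT => ij.
  by have := Ks i j; rewrite e (sl_diag slK); have := sl_off slK ij; lia.
have sT : [set: 'I_k] = [set s i | i in 'I_k].
  apply/setP => j; rewrite inE; apply/esym/imsetP.
  by exists (invF sinj j); rewrite ?f_invF.
have E2 := (ext_in_emb sinj Ks sT pK dK).1 EK.
have sp := ext_vertex_unique slK E2 EK.
split=> //; first by rewrite sp in E2; apply: (ext_null_unique slK E2 EK).
apply/row_matrixP => i; rewrite row_mul es /emb rowK.
by rewrite simple_map.
Qed.

(** A vertex j outside Y with (alpha_j|d) = 0 is joined to no vertex of Y, because d is positive
    there; so its reflection fixes everything inside Y. *)
Lemma weyl_restrict (Y : {set 'I_n}) d w x : null_on X Y d ->
  (forall j, j \in w -> B (simple j) d = 0) -> inside Y x ->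
  weyl X w x = weyl X [seq j <- w | j \in Y] x.
Proof.
move=> nd wd xY; have [d0 dY _] := nd.
have inY u : {subset u <= Y} -> inside Y (weyl X u x).
  by move=> uY j jY; rewrite weyl_coord ?xY //; apply: contra jY; apply: uY.
elim: w wd => //= j w IH wd.
rewrite IH => [|l lw]; last by apply: wd; rewrite inE lw orbT.
have [//|jY] := boolP (j \in Y).
set y := weyl X _ x.
have yY : inside Y y by apply: inY => l; rewrite mem_filter => /andP[].
rewrite /refl [B _ y](_ : _ = 0) ?scale0r ?subr0 //.
have := wd j (mem_head _ _); rewrite !pairing_simple_coord // => e.
have term l : X j l * d 0 l <= 0.
  have [->|lj] := eqVneq l j; first by rewrite dY ?mulr0.
  by apply: mulr_le0_ge0; [apply: (sl_off slX); rewrite eq_sym|apply: null_on_ge0 nd _].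
apply: big1 => l _; have [lY|lY] := boolP (l \in Y); last by rewrite yY ?mulr0.
suff -> : X j l = 0 by rewrite mul0r.
move/eqP: e; rewrite -oppr_eq0 -sumrN psumr_eq0 => [/allP /(_ l)|m _]; last by rewrite oppr_ge0.
by rewrite mem_index_enum oppr_eq0 mulf_eq0 (gt_eqF (d0 _ lY)) orbF => /(_ isT) /eqP.
Qed.

(** Once w fixes the antidominant d1, it can be written in simple reflections orthogonal to d1. For
    these alpha_p1 is antidominant, so w can be written in reflections that fix alpha_p1 too, and
    those at vertices outside Z1 act trivially inside the affine part. *)
Lemma normal_form_unique Z1 p1 d1 M1 Z2 p2 d2 M2 q c w (s : 'I_k -> 'I_k) :
  normal_form Z1 p1 d1 M1 -> normal_form Z2 p2 d2 M2 -> c = 1 \/ c = -1 ->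
  (forall i, weyl X w (c *: row i M1) = row (s i) M2) -> X q p1 = -1 ->
  [/\ c = 1, Z1 = Z2, p1 = p2 & exists w0, {subset w0 <= Z1 :\ p1 :\ q} /\
     forall x, inside (Z1 :\ p1 :\ q) x -> weyl X w x = weyl X w0 x].
Proof.
move=> [H1 E1 dM1 pM1] [H2 E2 dM2 pM2] c1 es Xq.
have Hc : pi_mx (weyl_mx w (c *: M1)).
  apply: pi_mx_weyl => //; case: c1 => ->; rewrite ?scale1r // scaleN1r.
  exact: pi_mx_opp.
have es' i : row i (weyl_mx w (c *: M1)) = row (s i) M2.
  by rewrite row_weyl_mx -es linearZ.
have [sinj sp ds eM] := gram_perm Hc H2 es'.
have wd : c *: weyl X w d1 = d2.
  rewrite -dM2 -[in RHS]ds -mulmxA -eM mul_weyl_mx -dM1 -weylZ //.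
  by rewrite -scalemxAr.
have wp : c *: weyl X w (simple p1) = simple p2.
  by rewrite -pM2 -[in RHS]sp -es -pM1 weylZ.
have [p1Z cY1 n1 dp1] := E1; have [p2Z cY2 n2 dp2] := E2.
have d10 : nonneg (weyl X w d1).
  rewrite -dM1; apply: (pi_null_orbit slX slK EK) => //.
  by rewrite dM1; apply: null_on_ge0 n1.
have d20 := null_on_ge0 n2.
(* For c = -1 both w d1 and d2 = - w d1 would be nonnegative, so d2 = 0. *)
have ce : c = 1.
  case: c1 => // ce; case: (pi_null_neq0 EK H2); rewrite dM2.
  apply/rowP => j; rewrite [RHS]mxE; have := d20 j; have := d10 j.
  have -> : d2 0 j = - weyl X w d1 0 j by rewrite -wd ce scaleN1r mxE.
  by move: (weyl X w d1 0 j) => t; clear; lia.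
rewrite ce !scale1r in wd wp.
have [||e1 [w1 [w1J ew1]]] := @weyl_stabilizer _ _ slX [set: 'I_n] w d1 (fun j _ => finset.in_setT j).
- by move=> j _; apply: null_on_antidominant n1.
- by move=> j _; rewrite wd; apply: null_on_antidominant n2.
have dd : d1 = d2 by rewrite -wd e1.
have w1d j : j \in w1 -> B (simple j) d1 = 0 by move=> /w1J; rewrite !inE => /eqP.
(* No letter of w1 is p1, so the p1-coordinate of alpha_p1 is unchanged. *)
have pp : p1 = p2.
  have : weyl X w1 (simple p1) 0 p1 = 1.
    rewrite weyl_coord ?simpleE ?eqxx //; apply/negP => /w1d; by rewrite dp1.
  by rewrite -ew1 wp simpleE; case: eqVneq.
have ZZ : Z1 = Z2.
  have ZE Z p d : ext_in X Z p d -> Z = p |: supp d.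
    move=> [pZ _ [d0 dY _] _]; apply/setP => j; rewrite !inE.
    have [->|jp] := eqVneq j p; first by rewrite pZ.
    have [jZ|jZ] := boolP (j \in Z); first by rewrite gt_eqF // d0 // !inE jp.
    by rewrite dY ?eqxx // !inE jp.
  by rewrite (ZE _ _ _ E1) (ZE _ _ _ E2) pp dd.
split=> //.
pose J := [set j | B (simple j) d1 == 0].
have Jp j : j \in J -> j != p1 by rewrite inE => /eqP dj; apply/eqP => e; rewrite e dp1 in dj.
have w1J' : {subset w1 <= J} by move=> j /w1d dj; rewrite inE dj.
have [||_ [w2 [w2J ew2]]] := @weyl_stabilizer _ _ slX J w1 (simple p1) w1J'.
- by move=> j /Jp jp; rewrite pairing_simple (sl_off slX).
- by move=> j /Jp jp; rewrite -ew1 wp -pp pairing_simple (sl_off slX).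
have w2d j : j \in w2 -> B (simple j) d1 = 0 by move=> /w2J; rewrite !inE => /andP[/eqP].
exists [seq j <- w2 | j \in Z1 :\ p1]; split.
  move=> j; rewrite mem_filter => /andP[jY /w2J]; rewrite inE => /andP[_].
  rewrite pairing_simple => /eqP jp; rewrite in_setD1 jY andbT.
  by apply/eqP => e; rewrite e Xq in jp.
move=> x xY; rewrite ew1 ew2 (weyl_restrict n1) //.
by move=> j jY; apply: xY; rewrite in_setD1 (negPf jY) andbF.
Qed.
End NormalForm.

(** * Finite parts *)

Section DominantRoot.
Variables (m : nat) (N : 'M[int]_m).
Hypothesis sl : simply_laced N.
Local Notation B := (pairing N).
Hypothesis definite : forall v, v <> 0 -> 0 < B v v.
Hypothesis norm2_signed : forall v, B v v = 2 -> signed v.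

(* (t|u) = 1 otherwise, so t - u is a root of height 0. *)
Lemma dominant_root_unique (t u : 'rV[int]_m) :
  (forall i, 0 < t 0 i) -> (forall i, 0 < u 0 i) -> B t t = 2 -> B u u = 2 ->
  (forall i, 0 <= B (simple i) t) -> (forall i, 0 <= B (simple i) u) ->
  height t = height u -> t = u.
Proof.
move=> t0 u0 tt uu tdom udom ht; apply/eqP; apply: contraT => /eqP tu.
have tu0 : t - u <> 0 by move/eqP; rewrite subr_eq0 => /eqP.
have := definite tu0; rewrite !pairingE tt uu (pairingC sl u t) => pos.
have [|i [ti ai]] := norm2_witness (A := N) (b := t) (fun i => ltW (t0 i)); first by rewrite tt.
have ge1 : 1 <= B t u.
  rewrite (pairingC sl) pairing_coord (bigD1 i) //=.
  apply: (@le_trans _ _ (u 0 i * B (simple i) t)); first by have := u0 i; nia.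
  by rewrite lerDl; apply: sumr_ge0 => j _; apply: mulr_ge0 => //; apply: ltW.
have tu2 : B (t - u) (t - u) = 2.
  by rewrite !pairingE tt uu (pairingC sl u t); lia.
have h0 : height (t - u) = 0 by rewrite heightD heightN ht subrr.
have z x : nonneg x -> height x = 0 -> x = 0.
  move=> x0 /eqP; rewrite /height psumr_eq0 => [/allP h|i0 _]; last exact: x0.
  by apply/rowP => j; rewrite mxE; apply/eqP/(h j); rewrite mem_index_enum.
case: tu0; case: (norm2_signed tu2) => s; first exact: z.
by apply/eqP; rewrite -oppr_eq0; apply/eqP/z; rewrite // heightN h0 oppr0.
Qed.
End DominantRoot.

Section FinitePart.
Variables (a k : nat) (K : 'M[int]_k) (pK qK : 'I_k) (dK : 'rV[int]_k).
Variables (KF : 'M[int]_a) (fK : 'I_a -> 'I_k).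
Hypotheses (slK : simply_laced K) (EK : ext_in K [set: 'I_k] pK dK).
Hypotheses (qpK : qK != pK) (KqpK : K qK pK = -1).
Hypothesis othK : forall j, j != pK -> j != qK -> K j pK = 0.
Hypotheses (fKinj : injective fK) (KFE : forall i j, KF i j = K (fK i) (fK j)).
Hypothesis fKE : forall j, (exists i, j = fK i) <-> j != pK /\ j != qK.

Let Y := [set: 'I_k] :\ pK.
Let nK : null_on K Y dK. Proof. by case: EK. Qed.
Let cK : conn K Y. Proof. by case: EK. Qed.
Let slKF : simply_laced KF := sl_emb slK fKinj KFE.

Lemma emb_fK_coord (v : 'rV[int]_a) j : j = pK \/ j = qK -> (v *m emb fK) 0 j = 0.
Proof.
move=> jpq; apply: (@emb_inside _ _ fK [set fK i | i in 'I_a] erefl).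
apply/imsetP => -[i _ e]; have [jp jq] := (fKE j).1 (ex_intro _ i e).
by case: jpq jp jq => ->; rewrite eqxx.
Qed.

Lemma emb_fK_inside (v : 'rV[int]_a) : inside Y (v *m emb fK).
Proof.
move=> j; rewrite !inE andbT negbK => /eqP ->; apply: emb_fK_coord; by left.
Qed.

Lemma null_q : dK 0 qK = 1.
Proof.
have [q [qY dq Aq Ajp]] := ext_neighbor slK EK.
suff -> : qK = q by [].
apply/eqP; apply: contraT => ne; have := Ajp qK.
by rewrite in_setD1 qpK inE ne KqpK => /(_ isT isT).
Qed.

(** An isotropic vector is proportional to dK, whose mark at qK is 1, while v has coordinate 0
    there. *)
Lemma finite_definite (v : 'rV[int]_a) : v <> 0 -> 0 < pairing KF v v.
Proof.
move=> v0; rewrite -(pairing_emb KFE) lt_def (affine_norm_ge0 slK nK (@emb_fK_inside v)) andbT.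
apply/eqP => vv; apply: v0; apply: (emb_inj fKinj); rewrite /= mul0mx.
have := affine_norm0 slK nK cK (@emb_fK_inside v) vv.
move=> e; apply/rowP => j; have := e j qK.
by rewrite null_q mulr1 (@emb_fK_coord v qK (or_intror erefl)) mul0r => ->; rewrite mxE.
Qed.

Lemma finite_norm2_signed (v : 'rV[int]_a) : pairing KF v v = 2 -> signed v.
Proof.
rewrite -(pairing_emb KFE) => /(affine_norm2_signed slK nK cK (@emb_fK_inside v)).
case=> s; [left|right] => i; have := s (fK i).
  by rewrite emb_coord.
by rewrite mxE emb_coord // mxE.
Qed.

(** The highest root of the finite part, as delta - alpha_q; see [theta_emb]. *)
Definition theta : 'rV[int]_a := unemb fK dK.

Lemma theta_emb : theta *m emb fK = dK - simple qK.
Proof.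
have [_ dY _] := nK.
apply/rowP => j; rewrite [RHS](_ : _ = dK 0 j - (j == qK)%:R); last by rewrite !mxE.
have [->|jp] := eqVneq j pK.
  by rewrite emb_fK_coord; [rewrite eq_sym (negPf qpK) dY ?subr0 // !inE eqxx|left].
have [->|jq] := eqVneq j qK; first by rewrite emb_fK_coord ?null_q ?subrr //; right.
have [i ->] := (fKE j).2 (conj jp jq).
by rewrite emb_coord // mxE subr0.
Qed.

Lemma theta_gt0 i : 0 < theta 0 i.
Proof.
have [d0 _ _] := nK; rewrite mxE d0 // !inE andbT.
by have [] := (fKE (fK i)).1 (ex_intro _ i erefl).
Qed.

Lemma theta_simple i : pairing KF (simple i) theta = - K (fK i) qK.
Proof.
have [ip iq] := (fKE (fK i)).1 (ex_intro _ i erefl).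
rewrite -(pairing_emb_simple KFE) theta_emb pairingDr pairingNr pairing_simple.
by have [_ _ dn] := nK; rewrite dn ?add0r // !inE ip.
Qed.

Lemma theta_norm : pairing KF theta theta = 2.
Proof.
rewrite -(pairing_emb KFE) theta_emb !pairingE (null_on_norm nK) (pairingC slK dK).
by have [_ _ dn] := nK; rewrite dn ?norm_simple // !inE qpK.
Qed.

(** The highest root is invariant under diagram automorphisms. This is why the row at qK depends
    only on the set of finite rows, not on their labelling. *)
Lemma theta_perm (s : 'I_a -> 'I_a) : injective s ->
  (forall i j, KF (s i) (s j) = KF i j) -> theta *m emb s = theta.
Proof.
move=> sinj Ks; have Ks' i j : KF i j = KF (s i) (s j) by rewrite Ks.
have ts i : (theta *m emb s) 0 (s i) = theta 0 i by rewrite emb_coord.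
apply: (dominant_root_unique slKF finite_definite finite_norm2_signed).
- by move=> i; rewrite -(f_invF sinj i) ts; apply: theta_gt0.
- exact: theta_gt0.
- by rewrite (pairing_emb Ks') theta_norm.
- exact: theta_norm.
- move=> i; rewrite -(f_invF sinj i) (pairing_emb_simple Ks') theta_simple oppr_ge0.
  have [_ iq] := (fKE (fK (invF sinj i))).1 (ex_intro _ _ erefl).
  exact: (sl_off slK).
- move=> i; rewrite theta_simple oppr_ge0.
  have [_ iq] := (fKE (fK i)).1 (ex_intro _ i erefl); exact: (sl_off slK).
- rewrite /height [LHS](reindex_inj sinj); apply: eq_bigr => i _; exact: ts.
Qed.

Lemma null_split n (M : 'M[int]_(k, n)) :
  dK *m M = theta *m (emb fK *m M) + row qK M.
Proof. by rewrite mulmxA theta_emb mulmxBl simple_map subrK. Qed.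

(** * Passage between pi-systems in Z^o and normal forms in X *)

Section Link.
Variables (n b : nat) (X : 'M[int]_n) (Z : {set 'I_n}) (p q : 'I_n) (d : 'rV[int]_n).
Variables (ZF : 'M[int]_b) (g : 'I_b -> 'I_n).
Hypotheses (slX : simply_laced X) (EZ : ext_in X Z p d).
Hypotheses (qpZ : q \in Z :\ p) (dq : d 0 q = 1) (Xqp : X q p = -1).
Hypothesis othZ : forall j, j \in Z :\ p -> j != q -> X j p = 0.
Hypotheses (ginj : injective g) (ZFE : forall i j, ZF i j = X (g i) (g j)).
Hypothesis gE : Z :\ p :\ q = [set g i | i in 'I_b].
Local Notation B := (pairing X).
Local Notation normal_form := (normal_form X K pK dK Z p d).
Let slZF : simply_laced ZF := sl_emb slX ginj ZFE.
Let nZ : null_on X (Z :\ p) d. Proof. by case: EZ. Qed.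
Let cZ : conn X (Z :\ p). Proof. by case: EZ. Qed.

Lemma emb_g_inside0 (v : 'rV[int]_b) : inside (Z :\ p :\ q) (v *m emb g).
Proof. exact: (emb_inside gE). Qed.

Lemma emb_g_inside (v : 'rV[int]_b) : inside (Z :\ p) (v *m emb g).
Proof. by move=> j jY; apply: emb_g_inside0; rewrite in_setD1 (negPf jY) andbF. Qed.

Lemma inside0_p x : inside (Z :\ p :\ q) x -> B x (simple p) = 0.
Proof.
move=> xZ; rewrite pairing_coord big1 // => j _; rewrite pairing_simple.
have [|jZ] := boolP (j \in Z :\ p :\ q); last by rewrite xZ ?mul0r.
by rewrite in_setD1 => /andP[jq jY]; rewrite othZ ?mulr0.
Qed.

Lemma inside_d x : inside (Z :\ p) x -> B x d = 0.
Proof.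
move=> xZ; rewrite pairing_coord big1 // => j _; have [_ _ dn] := nZ.
by have [jY|jY] := boolP (j \in Z :\ p); [rewrite dn ?mulr0|rewrite xZ ?mul0r].
Qed.

Lemma link_real (v : 'rV[int]_b) : pairing ZF v v = 2 -> real_root ZF v.
Proof.
move=> v2; apply: (@norm2_real _ ZF slZF [set: 'I_b]) => //; last by move=> j; rewrite inE.
move=> {v2} v _; rewrite -(pairing_emb ZFE) => /(affine_norm2_signed slX nZ cZ (@emb_g_inside v)).
case=> s; [left|right] => i; have := s (g i).
  by rewrite emb_coord.
by rewrite mxE emb_coord // mxE.
Qed.

(** For a root x of Z^o the vector d - x has norm 2, hence a sign, and its q-coordinate is d_q = 1;
    so it is nonnegative. The bound makes the roots of Z^o finite in number. *)
Lemma link_bound (v : 'rV[int]_b) : pairing ZF v v = 2 -> forall i, `|v 0 i| <= d 0 (g i).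
Proof.
have bnd (u : 'rV[int]_b) i : pairing ZF u u = 2 -> u 0 i <= d 0 (g i).
  move=> u2; set x := u *m emb g.
  have dxE j : (d - x) 0 j = d 0 j - x 0 j by rewrite !mxE.
  have [_ dY _] := nZ.
  have xY : inside (Z :\ p) (d - x).
    by move=> j jY; rewrite dxE (emb_g_inside u jY) subr0 dY.
  have n2 : B (d - x) (d - x) = 2.
    rewrite !pairingE (null_on_norm nZ) (pairingC slX d x) inside_d; last exact: emb_g_inside.
    by rewrite /x (pairing_emb ZFE) u2.
  have xq : x 0 q = 0 by apply: emb_g_inside0; rewrite !in_setD1 eqxx.
  case: (affine_norm2_signed slX nZ cZ xY n2) => s; last first.
    by have := s q; rewrite mxE dxE xq dq.
  by have := s (g i); rewrite dxE /x emb_coord // subr_ge0.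
move=> v2 i; rewrite ler_norml; apply/andP; split; last exact: bnd.
rewrite lerNl; have := @bnd (- v) i; rewrite mxE; apply.
by rewrite pairingNl pairingNr opprK.
Qed.

Lemma normal_form_finite M : normal_form M -> exists M0, pi_mx ZF KF M0 /\
  M0 *m emb g = emb fK *m M.
Proof.
move=> nf; have [[rM gM] _ _ _] := nf.
pose M0 : 'M[int]_(a, b) := \matrix_i unemb g (row (fK i) M).
have e : M0 *m emb g = emb fK *m M.
  apply/row_matrixP => i; rewrite row_mul rowK row_mul row_emb simple_map.
  apply: (unembK ginj gE).
  have [ip iq] := (fKE (fK i)).1 (ex_intro _ i erefl).
  by apply: (normal_form_inside slX slK EK nf Xqp othZ ip); apply: othK.
have gM0 : M0 *m ZF *m M0^T = KF.
  have -> : M0 *m ZF *m M0^T = (M0 *m emb g) *m X *m (M0 *m emb g)^T.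
    by rewrite trmx_mul -(emb_gram ZFE) !mulmxA.
  rewrite e trmx_mul -[RHS](emb_gram KFE) -gM !mulmxA //.
exists M0; split=> //; split=> // i; apply: link_real.
by rewrite -gramE gM0 (sl_diag slKF).
Qed.

(** The finite rows come from M0, the row pK is alpha_p, and the row qK is the only vector that
    makes dK times this matrix equal to d. *)
Definition extend_mx (M0 : 'M[int]_(a, b)) : 'M[int]_(k, n) :=
  (emb fK)^T *m (M0 *m emb g) + (simple pK)^T *m simple p
  + (simple qK)^T *m (d - theta *m (M0 *m emb g)).

Lemma extend_finite M0 : emb fK *m extend_mx M0 = M0 *m emb g.
Proof.
have eE i j : emb fK i j = (j == fK i)%:R by rewrite mxE simpleE.
have ff : emb fK *m (emb fK)^T = 1%:M :> 'M[int]_a.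
  apply/matrixP => i j; rewrite mxE [RHS]mxE (bigD1 (fK j)) //= big1 ?addr0 => [|l lj].
    by rewrite [_^T _ _]mxE !eE eqxx mulr1 (inj_eq fKinj) eq_sym.
  by rewrite [_^T _ _]mxE !eE (negPf lj) mulr0.
have fs j : j = pK \/ j = qK -> emb fK *m (simple j)^T = 0 :> 'M[int]_(a, 1).
  move=> jpq; apply/matrixP => i l; rewrite (ord1 l) [RHS]mxE /simple trmx_delta -colE mxE.
  rewrite eE; apply/eqP; rewrite pnatr_eq0 eqb0; apply/eqP => e.
  have [ip iq] := (fKE j).1 (ex_intro _ i e).
  by case: jpq ip iq => ->; rewrite eqxx.
by rewrite !mulmxDr !mulmxA ff mul1mx !fs ?mul0mx ?addr0; auto.
Qed.

Lemma row_extend M0 j : row j (extend_mx M0) = simple j *m (emb fK)^T *m (M0 *m emb g)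
   + (j == pK)%:R *: simple p + (j == qK)%:R *: (d - theta *m (M0 *m emb g)).
Proof.
have ss (i : 'I_k) : simple j *m (simple i)^T = (j == i)%:R%:M :> 'M[int]_1.
  apply/matrixP => x y; rewrite (ord1 x) (ord1 y) /simple -rowE trmx_delta mxE mxE eqxx andbT.
  by rewrite mxE.
by rewrite -simple_map /extend_mx 2!mulmxDr !mulmxA !ss !mul_scalar_mx.
Qed.

Lemma simple_fK0 j : j = pK \/ j = qK -> simple j *m (emb fK)^T = 0 :> 'rV[int]_a.
Proof.
move=> jpq; apply/rowP => i; rewrite simple_map [RHS]mxE mxE mxE mxE simpleE.
apply/eqP; rewrite pnatr_eq0 eqb0; apply/eqP => e.
have [ip iq] := (fKE j).1 (ex_intro _ i e).
by case: jpq ip iq => ->; rewrite eqxx.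
Qed.

Lemma row_extend_p M0 : row pK (extend_mx M0) = simple p.
Proof.
rewrite row_extend simple_fK0; last by left.
by rewrite mul0mx eqxx eq_sym (negPf qpK) scale1r scale0r add0r addr0.
Qed.

Lemma row_extend_q M0 : row qK (extend_mx M0) = d - theta *m (M0 *m emb g).
Proof.
rewrite row_extend simple_fK0; last by right.
by rewrite mul0mx eqxx (negPf qpK) scale1r scale0r !add0r.
Qed.

Lemma row_extend_f M0 i : row (fK i) (extend_mx M0) = row i M0 *m emb g.
Proof. by rewrite -row_mul -extend_finite row_mul row_emb simple_map. Qed.

Lemma extend_normal_form M0 : pi_mx ZF KF M0 -> normal_form (extend_mx M0).
Proof.
move=> [r0 g0]; have [pZ _ _ dp] := EZ.
set t := theta *m (M0 *m emb g).
have tE : t = (theta *m M0) *m emb g by rewrite /t mulmxA.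
have t2 : B t t = 2 by rewrite tE (pairing_emb ZFE) (pairing_map g0) theta_norm.
have tY : inside (Z :\ p) t by rewrite tE; apply: emb_g_inside.
have fY i : inside (Z :\ p) (row i M0 *m emb g) by apply: emb_g_inside.
have qq : B (d - t) (d - t) = 2.
  by rewrite !pairingE (null_on_norm nZ) (pairingC slX d t) inside_d // t2.
have tri j : [\/ j = pK, j = qK | exists i, j = fK i].
  have [->|jp] := eqVneq j pK; first exact: Or31.
  have [->|jq] := eqVneq j qK; first exact: Or32.
  by apply: Or33; apply/fKE.
have Gpp : B (simple p) (simple p) = K pK pK by rewrite norm_simple // (sl_diag slK).
have Gqq : B (d - t) (d - t) = K qK qK by rewrite qq (sl_diag slK).
(* t lies in the lattice of Z^o, hence is orthogonal to alpha_p; only (d|alpha_p) = -1 remains. *)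
have Gqp : B (d - t) (simple p) = K qK pK.
  rewrite KqpK !pairingE (pairingC slX d) dp tE inside0_p ?subr0 //.
  exact: emb_g_inside0.
have Gfp i : B (row i M0 *m emb g) (simple p) = K (fK i) pK.
  rewrite inside0_p; last exact: emb_g_inside0.
  have [ip iq] := (fKE (fK i)).1 (ex_intro _ i erefl); by rewrite othK.
have Gfq i : B (row i M0 *m emb g) (d - t) = K (fK i) qK.
  rewrite pairingDr pairingNr inside_d // add0r tE (pairing_emb ZFE).
  by rewrite -simple_map (pairing_map g0) theta_simple opprK.
have Gff i j : B (row i M0 *m emb g) (row j M0 *m emb g) = K (fK i) (fK j).
  by rewrite (pairing_emb ZFE) -gramE g0 KFE.
split=> //.
- split=> [j|].
    have [->|->|[i ->]] := tri j.
    + by rewrite row_extend_p; apply: real_root_simple.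
    + rewrite row_extend_q; apply: (affine_norm2_real slX nZ cZ) => //.
      by move=> l lY; rewrite mxE [X in _ + X]mxE tY // subr0; case: nZ => _ dY _; apply: dY.
    + by rewrite row_extend_f; apply: (real_root_map slX (emb_gram ZFE)) => // l;
        rewrite row_emb; apply: real_root_simple.
  apply/matrixP => i j; rewrite gramE.
  have [->|->|[i' ->]] := tri i; have [->|->|[j' ->]] := tri j;
    rewrite ?row_extend_p ?row_extend_q ?row_extend_f //.
  + by rewrite (pairingC slX) (sl_sym slK).
  + by rewrite (pairingC slX) (sl_sym slK).
  + by rewrite (pairingC slX) (sl_sym slK).
- by rewrite null_split extend_finite row_extend_q addrC subrK.
- exact: row_extend_p.
Qed.

(** Vectors inside Z^o are orthogonal to alpha_p, whereas the rows pK and qK pair to 2 and -1 with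
    it. *)
Lemma normal_form_row_inside M j : normal_form M -> inside (Z :\ p :\ q) (row j M) ->
  exists i, j = fK i.
Proof.
move=> [[rM gM] _ dM pM] jY; apply/fKE.
have := inside0_p jY; rewrite -pM -gramE gM => Kj.
by split; apply/eqP => e; move: Kj; rewrite e ?(sl_diag slK) // KqpK.
Qed.

(** The finite rows match through an automorphism s of the finite part; [theta_perm] then gives
    equal rows at qK, since both null vectors are d. *)
Lemma normal_form_rows M1 M2 : normal_form M1 -> normal_form M2 ->
  (forall x, inside (Z :\ p :\ q) x -> (exists i, x = row i M1) -> exists i, x = row i M2) ->
  forall i, exists j, row i M1 = row j M2.
Proof.
move=> nf1 nf2 sub.
have [[r1 g1] _ dM1 pM1] := nf1; have [[r2 g2] _ dM2 pM2] := nf2.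
have /choice[s es] : forall i, exists j, row (fK i) M1 = row (fK j) M2.
  move=> i; have [ip iq] := (fKE (fK i)).1 (ex_intro _ i erefl).
  have iI : inside (Z :\ p :\ q) (row (fK i) M1).
    by apply: (normal_form_inside slX slK EK nf1 Xqp othZ ip); apply: othK.
  have [j ej] := sub _ iI (ex_intro _ _ erefl).
  rewrite ej in iI *; have [l jl] := normal_form_row_inside nf2 iI.
  by exists l; rewrite jl.
have Ks i j : KF (s i) (s j) = KF i j.
  by rewrite !KFE -{1}g2 -{1}g1 !gramE !es.
have sinj : injective s.
  move=> i j e; apply/eqP; apply: contraT => ij.
  by have := Ks i j; rewrite e (sl_diag slKF) => e2; have := sl_off slKF ij; rewrite -e2.
have eq_mx : emb fK *m M1 = emb s *m (emb fK *m M2).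
  by apply/row_matrixP => i; rewrite !row_mul !row_emb !simple_map es row_mul row_emb simple_map.
have eq_q : row qK M1 = row qK M2.
  have e1 := null_split M1; have e2 := null_split M2; rewrite dM1 in e1; rewrite dM2 in e2.
  have : theta *m (emb fK *m M1) = theta *m (emb fK *m M2).
    by rewrite eq_mx mulmxA theta_perm.
  by move=> e; move: e1; rewrite e2 e => /addrI.
move=> j; have [->|jp] := eqVneq j pK; first by exists pK; rewrite pM1 pM2.
have [->|jq] := eqVneq j qK; first by exists qK.
by have [i ->] := (fKE j).2 (conj jp jq); exists (fK (s i)).
Qed.

Lemma normal_form_weyl w M : normal_form M -> normal_form (weyl_mx X (map g w) M).
Proof.
move=> [HM _ dM pM].
have wg j : j \in map g w -> j \in Z :\ p :\ q.
  by rewrite gE => /mapP[i _ ->]; apply: imset_f.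
split=> //; first exact: pi_mx_weyl.
- rewrite mul_weyl_mx // dM; apply: weyl_fix => j /wg; rewrite in_setD1 => /andP[_ jY].
  by case: nZ => _ _ ->.
- rewrite row_weyl_mx pM; apply: weyl_fix => j /wg; rewrite in_setD1 => /andP[jq jY].
  by rewrite pairing_simple othZ.
Qed.
End Link.
End FinitePart.

(** * Counting orbits *)

Section PiSystems.
Variables (n k : nat) (X : 'M[int]_n) (K : 'M[int]_k).
Hypotheses (slX : simply_laced X) (slK : simply_laced K).
Implicit Types (M : 'M[int]_(k, n)) (S : {fset 'rV[int]_n}).

Definition rowset (m l : nat) (M : 'M[int]_(m, l)) : {fset 'rV[int]_l} := [fset row i M | i in 'I_m]%fset.

Lemma rowsetP (m l : nat) (M : 'M[int]_(m, l)) x : reflect (exists i, x = row i M) (x \in rowset M).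
Proof.
apply: (iffP (imfsetP _ _ _ _)) => [[i _ ->]|[i ->]]; first by exists i.
by exists i.
Qed.

(** For a symmetric matrix [refl] and [corefl] are the same map, so a coroot has the coordinates of
    its root. *)
Lemma is_corootE b c : is_coroot X b c <-> real_root X b /\ c = b.
Proof.
have e w y : coweyl X w y = weyl X w y.
  by elim: w => //= i w ->; rewrite /corefl /refl (pairingC slX).
split=> [[w [i [-> ->]]]|[[w [i ->]] ->]]; first by rewrite e; split=> //; exists w, i.
by exists w, i; rewrite e.
Qed.

Lemma pi_systemsP (R : realType) S : pi_systems R K X S <-> exists M, pi_mx X K M /\ S = rowset M.
Proof.
split=> [[_ [b [binj Sb bK]]]|[M [[rM gM] ->]]].
  exists (\matrix_i b i); split; last first.
    apply/fsetP => x; apply/idP/rowsetP => [/Sb [i ->]|[i ->]]; first by exists i; rewrite rowK.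
    by apply/Sb; exists i; rewrite rowK.
  split=> [i|]; first by rewrite rowK; have [c /is_corootE[]] := bK i i.
  apply/matrixP => i j; rewrite gramE !rowK.
  by have [c /is_corootE[_ ->]] := bK i j.
split; last first.
  exists (fun i => row i M); split.
  - move=> i j e; apply/eqP; apply: contraT => ij.
    have := sl_off slK ij; rewrite -gM gramE e norm_real_root //.
  - by move=> x; split=> [/rowsetP|h]; last exact/rowsetP.
  - move=> i j; exists (row i M); first exact/is_corootE.
    by rewrite -gramE gM.
split=> [_ /rowsetP[i ->] //|_ _ /rowsetP[i ->] /rowsetP[j ->] ij rij].
have {}ij : i != j by apply: contra_notN ij => /eqP ->.
(* This norm is at least 4, since K i j <= 0, while roots have norm at most 2. *)
have e : pairing X (row i M - row j M) (row i M - row j M) = 4 - 2 * K i j.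
  rewrite !pairingE !norm_real_root // (pairingC slX (row j M)) -gramE gM opprK.
  by move: (K i j) => t; clear; lia.
by have := root_norm_le2 slX rij; rewrite e; have := sl_off slK ij; lia.
Qed.

Lemma rowset_weyl_mx w M : rowset (weyl_mx X w M) = [fset weyl X w b | b in rowset M]%fset.
Proof.
apply/fsetP => x; apply/rowsetP/imfsetP => [[i ->]|[y /rowsetP[i ->] ->]].
  by exists (row i M); [apply/rowsetP; exists i|rewrite row_weyl_mx].
by exists i; rewrite row_weyl_mx.
Qed.
End PiSystems.

Section WeylOrbits.
Variables (n : nat) (X : 'M[int]_n).
Hypothesis slX : simply_laced X.
Implicit Types S T : {fset 'rV[int]_n}.

Lemma weyl_orbit_refl S : weyl_orbit X S S.
Proof.
exists [::]; apply/fsetP => x; apply/idP/imfsetP => [xS|[y yS ->] //]; by exists x.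
Qed.

Lemma weyl_orbit_trans S T U : weyl_orbit X S T -> weyl_orbit X T U -> weyl_orbit X S U.
Proof.
move=> [w ->] [u ->]; exists (u ++ w); apply/fsetP => x.
apply/imfsetP/imfsetP => [[y /imfsetP[z zS ->] ->]|[z zS ->]].
  by exists z => //; rewrite weyl_cat.
by exists (weyl X w z); rewrite ?weyl_cat //; apply/imfsetP; exists z.
Qed.

Lemma weyl_orbit_sym S T : weyl_orbit X S T -> weyl_orbit X T S.
Proof.
move=> [w ->]; exists (rev w); apply/fsetP => x.
apply/idP/imfsetP => [xS|[_ /imfsetP[z zS ->] ->]]; last by rewrite weyl_revK.
by exists (weyl X w x); rewrite ?weyl_revK //; apply/imfsetP; exists x.
Qed.

Lemma weyl_orbit_eq S T : weyl_orbit X S T -> weyl_orbit X S = weyl_orbit X T.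
Proof.
move=> ST; apply/seteqP; split=> U; last exact: weyl_orbit_trans.
by apply: weyl_orbit_trans; apply: weyl_orbit_sym.
Qed.
End WeylOrbits.

Lemma enum_val_image (n : nat) (Z : {set 'I_n}) : Z = [set enum_val i | i in 'I_#|Z|].
Proof.
apply/setP => j; apply/idP/imsetP => [jZ|[i _ ->]]; last exact: enum_valP.
by exists (enum_rank_in jZ j); rewrite // enum_rankK_in.
Qed.

Section FiniteParts.
Variables (R : realType) (n : nat) (X : 'M[int]_n).
Hypothesis slX : simply_laced X.
Implicit Types (Z : {set 'I_n}) (p q : 'I_n) (d : 'rV[int]_n).

Definition sub_vertex Z (i : 'I_#|Z|) : 'I_n := enum_val i.

Definition finite_vertex Z (i : 'I_#|finite_vertices R (subdiagram X Z)|) : 'I_n :=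
  sub_vertex (enum_val i).

Lemma sub_vertex_inj Z : injective (@sub_vertex Z).
Proof. exact: enum_val_inj. Qed.

Lemma finite_vertex_inj Z : injective (@finite_vertex Z).
Proof. by move=> i j /sub_vertex_inj/enum_val_inj. Qed.

Lemma finite_partE Z i j : finite_part R (subdiagram X Z) i j = X (finite_vertex i) (finite_vertex j).
Proof. by rewrite !mxE. Qed.

Lemma sub_ext Z (p' : 'I_#|Z|) (d' : 'rV[int]_#|Z|) : ext_in (subdiagram X Z) [set: 'I_#|Z|] p' d' <->
  ext_in X Z (sub_vertex p') (d' *m emb (@sub_vertex Z)).
Proof.
apply: ext_in_emb; [exact: sub_vertex_inj|by move=> i j; rewrite mxE|exact: enum_val_image].
Qed.

Lemma sl_sub Z : simply_laced (subdiagram X Z).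
Proof. by apply: (sl_emb slX (@sub_vertex_inj Z)) => i j; rewrite mxE. Qed.

Lemma sub_ext_lift Z p d : ext_in X Z p d -> exists (p' : 'I_#|Z|) (d' : 'rV[int]_#|Z|),
  [/\ p = sub_vertex p', d = d' *m emb (@sub_vertex Z) & ext_in (subdiagram X Z) [set: 'I_#|Z|] p' d'].
Proof.
move=> E; have [pZ _ [_ dY _] _] := E.
pose p' := enum_rank_in pZ p; have ep : p = sub_vertex p' by rewrite /sub_vertex enum_rankK_in.
have dZ : inside Z d by move=> j jZ; apply: dY; rewrite in_setD1 (negPf jZ) andbF.
have ed := unembK (@sub_vertex_inj Z) (enum_val_image Z) dZ.
exists p', (unemb (@sub_vertex Z) d); split=> //.
by apply/sub_ext; rewrite ed -ep.
Qed.

Lemma ext_type_sub Z : ext_type R (subdiagram X Z) <-> exists p d, ext_in X Z p d.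
Proof.
rewrite (ext_typeP R (sl_sub Z)); split=> [[p' [d' /sub_ext E]]|[p [d /sub_ext_lift[p' [d' [_ _ E]]]]]].
  by do 2 eexists; apply: E.
by exists p', d'.
Qed.

Lemma finite_vertex_image Z p q d : ext_in X Z p d -> q \in Z :\ p -> X q p = -1 ->
  (forall j, j \in Z :\ p -> j != q -> X j p = 0) ->
  Z :\ p :\ q = [set finite_vertex i | i in 'I_#|finite_vertices R (subdiagram X Z)|].
Proof.
move=> E qZ Xqp oth; have [p' [d' [ep ed E']]] := sub_ext_lift E.
have /andP[qp qZ'] : (q != p) && (q \in Z) by rewrite -in_setD1.
pose q' := enum_rank_in qZ' q; have eq : q = sub_vertex q' by rewrite /sub_vertex enum_rankK_in.
have inj := @sub_vertex_inj Z.
have FE := finite_verticesE R (sl_sub Z) E' (q := q').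
have {}FE : finite_vertices R (subdiagram X Z) = [set r | (r != p') && (r != q')].
  apply: FE.
  - by apply: contraNneq qp; rewrite ep eq => ->.
  - by rewrite mxE -/(sub_vertex q') -/(sub_vertex p') -eq -ep Xqp.
  - move=> j jp jq; rewrite mxE -/(sub_vertex j) -/(sub_vertex p') -ep; apply: oth.
      by rewrite in_setD1 ep (inj_eq inj) jp; apply: enum_valP.
    by rewrite eq (inj_eq inj).
apply/setP => j; rewrite !in_setD1; apply/idP/imsetP => [/and3P[jq jp jZ]|[i _ ->]].
  pose j' := enum_rank_in jZ j; have ej : j = sub_vertex j' by rewrite /sub_vertex enum_rankK_in.
  have jF : j' \in finite_vertices R (subdiagram X Z).
    by rewrite FE inE -!(inj_eq inj) -ej -ep -eq jp jq.
  by exists (enum_rank_in jF j') => //; rewrite /finite_vertex enum_rankK_in.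
have := enum_valP i; rewrite {2}FE inE => /andP[ip iq].
rewrite /finite_vertex ep eq !(inj_eq inj) ip iq; exact: enum_valP.
Qed.
End FiniteParts.

Lemma card_bigcup_disjoint (T I : choiceType) (s : seq I) (F : I -> set T) :
  uniq s -> (forall i, i \in s -> finite_set (F i)) ->
  (forall i j x, i \in s -> j \in s -> F i x -> F j x -> i = j) ->
  finite_set (\big[setU/set0]_(i <- s) F i)%classic /\
  #|` fset_set (\big[setU/set0]_(i <- s) F i)%classic| = (\sum_(i <- s) #|` fset_set (F i)|)%N.
Proof.
elim: s => [|i s IH] /=; first by rewrite !big_nil fset_set0 cardfs0; split=> //; apply: finite_set0.
move=> /andP[is_ us] fF dF; rewrite !big_cons.
have [|| fU cU] := IH us.
- by move=> j js; apply: fF; rewrite inE js orbT.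
- by move=> j l x js ls; apply: dF; rewrite inE ?js ?ls orbT.
have fi : finite_set (F i) by apply: fF; rewrite mem_head.
split; first by rewrite finite_setU.
rewrite fset_setU // cardfsU -cU [X in (_ - X)%N](_ : _ = 0%N) ?subn0 //.
apply/eqP; rewrite cardfs_eq0; apply/eqP/fsetP => x; rewrite inE in_fset0.
apply/negbTE/negP => /andP[]; rewrite !in_fset_set // !inE => Fi.
rewrite -bigcup_seq => -[j /= js Fj].
by move: is_; rewrite (dF i j x) ?inE ?eqxx ?js ?orbT.
Qed.

Lemma absz_shift_lt (t : int) (c : nat) : `|t| <= c%:Z -> (absz (t + c%:Z)%R < (2 * c).+1)%N.
Proof. by lia. Qed.

Lemma absz_shiftE (t : int) (c : nat) : `|t| <= c%:Z -> t = (absz (t + c%:Z)%R)%:Z - c%:Z.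
Proof. by lia. Qed.

(** * Orbits in Z^o and orbits in X *)

Section Orbits.
Variables (R : realType) (n k : nat) (X : 'M[int]_n) (K : 'M[int]_k).
Variables (pK qK : 'I_k) (dK : 'rV[int]_k).
Hypotheses (slX : simply_laced X) (slK : simply_laced K).
Hypotheses (EK : ext_in K [set: 'I_k] pK dK) (qpK : qK != pK) (KqpK : K qK pK = -1).
Hypothesis othK : forall j, j != pK -> j != qK -> K j pK = 0.
Local Notation KF := (finite_part R K).
Local Notation FK := (finite_vertices R K).
Local Notation ZF Z := (finite_part R (subdiagram X Z)).
Local Notation nf := (normal_form X K pK dK).
Local Notation g Z := (@finite_vertex R n X Z).
Local Notation bZ Z := #|finite_vertices R (subdiagram X Z)|.
Implicit Types (Z : {set 'I_n}) (e : bool) (M : 'M[int]_(k, n)) (w : seq 'I_n).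
Let fK (i : 'I_#|FK|) : 'I_k := enum_val i.

Let fKinj : injective fK. Proof. exact: enum_val_inj. Qed.
Let KFE i j : KF i j = K (fK i) (fK j). Proof. by rewrite mxE. Qed.
Let FKE : FK = [set r | (r != pK) && (r != qK)].
Proof. by apply: (finite_verticesE R slK EK) => //; rewrite KqpK. Qed.
Let fKE j : (exists i, j = fK i) <-> j != pK /\ j != qK.
Proof.
split=> [[i ->]|[jp jq]]; first by have := enum_valP i; rewrite {2}FKE inE => /andP.
have jF : j \in FK by rewrite FKE inE jp jq.
by exists (enum_rank_in jF j); rewrite /fK enum_rankK_in.
Qed.
Let slKF : simply_laced KF := sl_emb slK fKinj KFE.
Let slZF Z : simply_laced (ZF Z) := sl_emb slX (@finite_vertex_inj R n X Z) (@finite_partE R n X Z).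

Lemma ext_in_unique Z p d p' d' : ext_in X Z p d -> ext_in X Z p' d' -> p = p' /\ d = d'.
Proof.
move=> E E'.
have [u [x [eu _ Eu]]] := sub_ext_lift E; have [v [y [ev _ Ev]]] := sub_ext_lift E'.
have uv := ext_vertex_unique (sl_sub slX Z) Eu Ev.
have pp : p = p' by rewrite eu ev uv.
by split=> //; rewrite -pp in E'; apply: (ext_null_unique slX E E').
Qed.

Lemma ext_in_neighbor Z p d : ext_in X Z p d -> exists q,
  [/\ q \in Z :\ p, d 0 q = 1, X q p = -1, forall j, j \in Z :\ p -> j != q -> X j p = 0
    & Z :\ p :\ q = [set g Z i | i in 'I_(bZ Z)]].
Proof.
move=> E; have [q [qZ dq Xq oth]] := ext_neighbor slX E.
by exists q; split=> //; apply: finite_vertex_image E qZ Xq oth.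
Qed.

(** S0 is the trace of the rows of M on the root lattice of Z^o. *)
Definition link Z (S0 : {fset 'rV[int]_(bZ Z)}) M :=
  forall y, (y \in S0) = (y *m emb (g Z) \in rowset M).
Arguments link : clear implicits.

Lemma link_rowset Z p d M (M0 : 'M[int]_(#|FK|, bZ Z)) : nf Z p d M -> M0 *m emb (g Z) = emb fK *m M ->
  link Z (rowset M0) M.
Proof.
move=> nfM e y; have [_ E _ _] := nfM; have [q [qZ dq Xq oth gE]] := ext_in_neighbor E.
have re i : row i M0 *m emb (g Z) = row (fK i) M.
  by rewrite -row_mul e row_mul row_emb simple_map.
apply/rowsetP/rowsetP => [[i ->]|[j ej]]; first by exists (fK i).
have yI : inside (Z :\ p :\ q) (row j M) by rewrite -ej; apply: (emb_inside gE).
have [i ji] := normal_form_row_inside slK KqpK fKE oth nfM yI.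
exists i; apply: (emb_inj (@finite_vertex_inj R n X Z)); by rewrite /= re ej ji.
Qed.

Lemma link_exists Z p d S0 : ext_in X Z p d -> pi_systems R KF (ZF Z) S0 ->
  exists M, nf Z p d M /\ link Z S0 M.
Proof.
move=> E /(pi_systemsP (slZF Z) slKF) [M0 [HM0 ->]].
have [q [qZ dq Xq oth gE]] := ext_in_neighbor E.
have nfM := extend_normal_form slK EK qpK KqpK othK fKinj KFE fKE slX E oth
  (@finite_partE R n X Z) gE HM0.
by eexists; split; [apply: nfM|apply: (link_rowset nfM); rewrite extend_finite].
Qed.

Lemma link_system Z p d M : nf Z p d M -> exists S0, pi_systems R KF (ZF Z) S0 /\ link Z S0 M.
Proof.
move=> nfM; have [_ E _ _] := nfM; have [q [qZ dq Xq oth gE]] := ext_in_neighbor E.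
have [M0 [HM0 e]] := normal_form_finite slK EK othK fKinj KFE fKE slX E Xq oth
  (@finite_vertex_inj R n X Z) (@finite_partE R n X Z) gE nfM.
exists (rowset M0); split; last exact: link_rowset nfM e.
by apply/(pi_systemsP (slZF Z) slKF); exists M0.
Qed.

Lemma link_unique Z p d S0 M1 M2 : nf Z p d M1 -> nf Z p d M2 -> link Z S0 M1 -> link Z S0 M2 ->
  rowset M1 = rowset M2.
Proof.
suff sub (N1 N2 : 'M[int]_(k, n)) : nf Z p d N1 -> nf Z p d N2 -> link Z S0 N1 -> link Z S0 N2 ->
    forall x, x \in rowset N1 -> x \in rowset N2.
  by move=> nf1 nf2 l1 l2; apply/fsetP => x; apply/idP/idP; apply: sub.
move=> nf1 nf2 l1 l2 _ /rowsetP[i ->].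
have [_ E _ _] := nf1; have [q [qZ dq Xq oth gE]] := ext_in_neighbor E.
apply/rowsetP.
apply: (normal_form_rows slK EK qpK KqpK othK fKinj KFE fKE slX Xq oth nf1 nf2).
move=> x xI [j xj]; apply/rowsetP.
rewrite -(unembK (@finite_vertex_inj R n X Z) gE xI) -l2 l1.
by rewrite (unembK (@finite_vertex_inj R n X Z) gE xI); apply/rowsetP; exists j.
Qed.

Lemma rowset_act w c M :
  rowset (weyl_mx X w (c *: M)) = [fset weyl X w (c *: x) | x in rowset M]%fset.
Proof.
have rs i : row i (c *: M) = c *: row i M by rewrite linearZ.
apply/fsetP => x; apply/rowsetP/imfsetP => [[i ->]|[y /rowsetP[i ->] ->]].
  by exists (row i M); [apply/rowsetP; exists i|rewrite row_weyl_mx rs].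
by exists i; rewrite row_weyl_mx rs.
Qed.

Lemma weyl_emb Z (w0 : seq 'I_(bZ Z)) (x : 'rV[int]_(bZ Z)) :
  weyl (ZF Z) w0 x *m emb (g Z) = weyl X (map (g Z) w0) (x *m emb (g Z)).
Proof. by apply: (weyl_map (emb_gram (@finite_partE R n X Z))) => i; rewrite row_emb. Qed.

Lemma link_weyl Z (w0 : seq 'I_(bZ Z)) (S0 : {fset 'rV[int]_(bZ Z)}) M : link Z S0 M ->
  link Z [fset weyl (ZF Z) w0 b | b in S0]%fset (weyl_mx X (map (g Z) w0) M).
Proof.
move=> l y; rewrite rowset_weyl_mx; apply/imfsetP/imfsetP => -[x /= xS e].
  by exists (x *m emb (g Z)); rewrite /= -?l // e weyl_emb.
exists (weyl (ZF Z) (rev w0) y); last by rewrite weylK.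
by rewrite /= l weyl_emb map_rev e weyl_revK.
Qed.

(** The Boolean e is the sign of D. All p, d, M, w and S0 are quantified, so that nothing is chosen;
    by [orbit_mapE] the result is a single W(X)-orbit. *)
Definition orbit_map e Z (O : set {fset 'rV[int]_(bZ Z)}) : set {fset 'rV[int]_n} :=
  [set T | exists p d M w S0,
    [/\ nf Z p d M, O S0, link Z S0 M & T = rowset (weyl_mx X w ((-1) ^+ e *: M))]]%classic.
Arguments orbit_map : clear implicits.

Lemma weyl_orbit_rowset M w : weyl_orbit X (rowset M) (rowset (weyl_mx X w M)).
Proof. by exists w; rewrite rowset_weyl_mx. Qed.

(** Moving S0 by an element of W(Z^o) moves M by its image in W(X), which fixes d and alpha_p and so
    preserves the normal form; the row set linked to a given system is unique. *)
Lemma orbit_mapE e Z p d S0 M : nf Z p d M -> link Z S0 M ->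
  orbit_map e Z (weyl_orbit (ZF Z) S0) = weyl_orbit X (rowset ((-1) ^+ e *: M)).
Proof.
move=> nfM l; apply/seteqP; split=> T; last first.
  move=> [w ->]; exists p, d, M, w, S0; split=> //; last by rewrite rowset_weyl_mx.
  exact: weyl_orbit_refl.
move=> [p2 [d2 [M2 [w [S1 [nf2 [w0 eS1] l2 ->]]]]]].
have [_ E _ _] := nfM; have [_ E2 _ _] := nf2.
have [ep ed] := ext_in_unique E2 E; rewrite {}ep {}ed in nf2.
have [q [qZ dq Xq oth gE]] := ext_in_neighbor E.
have nfM' := normal_form_weyl slX E oth gE w0 nfM.
have l' : link Z S1 (weyl_mx X (map (g Z) w0) M) by rewrite eS1; apply: link_weyl.
rewrite rowset_act (link_unique nf2 nfM' l2 l') -rowset_act.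
have -> : weyl_mx X w ((-1) ^+ e *: weyl_mx X (map (g Z) w0) M) =
    weyl_mx X (w ++ map (g Z) w0) ((-1) ^+ e *: M).
  by apply/row_matrixP => i; rewrite !row_weyl_mx !linearZ /= row_weyl_mx weyl_cat !weylZ.
exact: weyl_orbit_rowset.
Qed.

Lemma sign_choice (c : int) : c = 1 \/ c = -1 -> exists e : bool, c = (-1) ^+ e.
Proof. by case=> ->; [exists false|exists true]. Qed.

Lemma sign_pm e : (-1) ^+ e = 1 :> int \/ (-1) ^+ e = -1 :> int.
Proof. by case: e; [right|left]. Qed.

Lemma pi_mx_sign e M : pi_mx X K M -> pi_mx X K ((-1) ^+ e *: M).
Proof. by case: e => HM; rewrite ?expr1 ?expr0 ?scale1r ?scaleN1r //; apply: pi_mx_opp. Qed.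

Lemma pi_orbits_cover O : pi_orbits R K X O <-> exists e Z p d S0 M,
  [/\ nf Z p d M, pi_systems R KF (ZF Z) S0, link Z S0 M & O = orbit_map e Z (weyl_orbit (ZF Z) S0)].
Proof.
split=> [[S /(pi_systemsP slX slK) [M [HM ->]] <-]|[e [Z [p [d [S0 [M [nfM S0p l ->]]]]]]]].
  have [c [w [Z [p [d [/sign_choice[e ->] nfM]]]]]] := normal_form_exists slX slK EK HM.
  have [S0 [S0p l]] := link_system nfM.
  exists e, Z, p, d, S0; eexists; split; [exact: nfM|exact: S0p|exact: l|].
  rewrite (orbit_mapE e nfM l); apply: weyl_orbit_eq => //.
  have -> : (-1) ^+ e *: weyl_mx X w ((-1) ^+ e *: M) = weyl_mx X w M.
    apply/row_matrixP => i; rewrite linearZ /= !row_weyl_mx linearZ /= weylZ scalerA.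
    by rewrite -signr_addb addbb scale1r.
  exact: weyl_orbit_rowset.
rewrite (orbit_mapE e nfM l); exists (rowset ((-1) ^+ e *: M)) => //.
apply/(pi_systemsP slX slK); exists ((-1) ^+ e *: M); split=> //.
by apply: pi_mx_sign; case: nfM.
Qed.

Lemma orbit_map_disjoint e1 e2 Z1 Z2 p1 p2 d1 d2 M1 M2 w q :
  nf Z1 p1 d1 M1 -> nf Z2 p2 d2 M2 -> X q p1 = -1 ->
  rowset ((-1) ^+ e2 *: M2) = rowset (weyl_mx X w ((-1) ^+ e1 *: M1)) ->
  [/\ e1 = e2, Z1 = Z2 & exists w0, {subset w0 <= Z1 :\ p1 :\ q} /\
     forall x, inside (Z1 :\ p1 :\ q) x -> weyl X w x = weyl X w0 x].
Proof.
move=> nf1 nf2 Xq es.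
have /choice[s hs] : forall i, exists j,
    weyl X w (((-1) ^+ e2 * (-1) ^+ e1) *: row i M1) = row j M2.
  move=> i; have : weyl X w ((-1) ^+ e1 *: row i M1) \in rowset ((-1) ^+ e2 *: M2).
    by rewrite es; apply/rowsetP; exists i; rewrite row_weyl_mx linearZ.
  move=> /rowsetP[j ej]; exists j; rewrite -scalerA weylZ ej linearZ /= scalerA.
  by rewrite -signr_addb addbb scale1r.
have c1 : (-1) ^+ e2 * (-1) ^+ e1 = 1 :> int \/ (-1) ^+ e2 * (-1) ^+ e1 = -1 :> int.
  by rewrite -signr_addb; apply: sign_pm.
have [ce ZZ _ w0P] := normal_form_unique slX slK EK nf1 nf2 c1 hs Xq.
by split=> //; move: ce; case: (e1) (e2) => -[].
Qed.

(** An element w matching the row sets acts inside Z^o as some element of W(Z^o), which then matches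
    the traces. *)
Lemma orbit_map_inj e Z p1 p2 d1 d2 M1 M2 S1 S2 :
  nf Z p1 d1 M1 -> nf Z p2 d2 M2 -> link Z S1 M1 -> link Z S2 M2 ->
  weyl_orbit X (rowset ((-1) ^+ e *: M1)) (rowset ((-1) ^+ e *: M2)) ->
  weyl_orbit (ZF Z) S1 S2.
Proof.
move=> nf1 nf2 l1 l2 [w]; rewrite -rowset_weyl_mx => es.
have [_ E _ _] := nf1; have [q [qZ dq Xq oth gE]] := ext_in_neighbor E.
have [_ _ [w0 [w0Z ew]]] := orbit_map_disjoint nf1 nf2 Xq es.
have [u0 eu] : exists u0, w0 = map (g Z) u0.
  elim: w0 w0Z {ew} => [_|j w0 IH w0Z]; first by exists [::].
  have [u0 ->] : exists u0, w0 = map (g Z) u0.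
    by apply: IH => l lw; apply: w0Z; rewrite inE lw orbT.
  have := w0Z j (mem_head _ _); rewrite gE => /imsetP[i _ ->].
  by exists (i :: u0).
have em x : (weyl X w x \in rowset M2) = (x \in rowset M1).
  have cc : ((-1) ^+ e * (-1) ^+ e : int) = 1 by rewrite -signr_addb addbb.
  have step y : (y \in rowset M2) = ((-1) ^+ e *: y \in rowset (weyl_mx X w ((-1) ^+ e *: M1))).
    rewrite -es; apply/rowsetP/rowsetP => -[i ei]; exists i; first by rewrite linearZ ei.
    by rewrite -[y]scale1r -cc -scalerA ei linearZ /= scalerA cc scale1r.
  rewrite step rowset_act -weylZ; apply/imfsetP/idP => [[y yM]|xM]; last by exists x.
  move=> /(weyl_inj slX) /(congr1 (fun z => (-1) ^+ e *: z)); rewrite !scalerA cc !scale1r.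
  by move=> ->.
exists u0; apply/fsetP => y; rewrite l2; apply/idP/imfsetP => [yM|[x /= xS ->]].
  exists (weyl (ZF Z) (rev u0) y); last by rewrite weylK.
  rewrite /= l1 -em ew; last exact: (emb_inside gE).
  by rewrite eu -weyl_emb weylK.
rewrite weyl_emb -eu -ew; last exact: (emb_inside gE).
by rewrite em -l1.
Qed.

Lemma finite_pi_systems Z p d : ext_in X Z p d -> finite_set (pi_systems R KF (ZF Z)).
Proof.
move=> E; have [q [qZ dq Xq oth gE]] := ext_in_neighbor E.
(* All marks of d are at most c, so roots of Z^o have coordinates in [-c, c]; adding c turns these
   into ordinals below 2 c + 1. *)
pose c := (\sum_j absz (d 0%R j))%N.
pose h (f : {ffun 'I_(bZ Z) -> 'I_(2 * c).+1}) : 'rV[int]_(bZ Z) :=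
  \row_i ((f i : nat)%:Z - c%:Z).
pose box : {fset 'rV[int]_(bZ Z)} :=
  [fset h f | f in enum {: {ffun 'I_(bZ Z) -> 'I_(2 * c).+1}}]%fset.
apply: (@sub_finite_set _ _ [set` fpowerset box]%classic); last exact: finite_fset.
move=> S [[rS _] _] /=; rewrite fpowersetE; apply/fsubsetP => v /rS /(norm_real_root (slZF Z)) v2.
have bound := link_bound slX E dq (@finite_vertex_inj R n X Z) (@finite_partE R n X Z) gE v2.
have bc i : `|v 0 i| <= c%:Z.
  apply: (le_trans (bound i)); apply: (@le_trans _ _ (absz (d 0 (g Z i)))%:Z); first by rewrite abszE ler_norm.
  by rewrite lez_nat /c (bigD1 (g Z i)) //= leq_addr.
have lt i : (absz (v 0 i + c%:Z)%R < (2 * c).+1)%N by apply: absz_shift_lt.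
apply/imfsetP; exists [ffun i => Ordinal (lt i)]; first by rewrite /= mem_enum.
by apply/rowP => i; rewrite mxE ffunE /=; apply: absz_shiftE.
Qed.
End Orbits.

Section Counting.
Variables (R : realType) (n k : nat) (X : 'M[int]_n) (K : 'M[int]_k).
Variables (pK qK : 'I_k) (dK : 'rV[int]_k).
Hypotheses (slX : simply_laced X) (slK : simply_laced K).
Hypotheses (EK : ext_in K [set: 'I_k] pK dK) (qpK : qK != pK) (KqpK : K qK pK = -1).
Hypothesis othK : forall j, j != pK -> j != qK -> K j pK = 0.
Local Notation KF := (finite_part R K).
Local Notation ZF Z := (finite_part R (subdiagram X Z)).
Local Notation G e Z := (@orbit_map R n k X K pK dK e Z).
Implicit Types (Z : {set 'I_n}) (e : bool).
Local Notation isExt Z := (ext_type R (subdiagram X Z)).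

Lemma finite_pi_orbits Z : isExt Z -> finite_set (pi_orbits R KF (ZF Z)).
Proof.
move=> /(ext_type_sub R slX) [p [d E]]; apply: finite_image.
exact: (finite_pi_systems R K slX E).
Qed.

Lemma orbit_map_injective e Z O1 O2 : isExt Z ->
  pi_orbits R KF (ZF Z) O1 -> pi_orbits R KF (ZF Z) O2 -> G e Z O1 = G e Z O2 -> O1 = O2.
Proof.
move=> /(ext_type_sub R slX) [p [d E]] [S1 S1p <-] [S2 S2p <-].
have [M1 [nf1 l1]] := link_exists slX slK EK qpK KqpK othK E S1p.
have [M2 [nf2 l2]] := link_exists slX slK EK qpK KqpK othK E S2p.
rewrite (orbit_mapE slX slK EK qpK KqpK othK e nf1 l1) (orbit_mapE slX slK EK qpK KqpK othK e nf2 l2).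
move=> eG; apply: weyl_orbit_eq.
  exact: (sl_emb slX (@finite_vertex_inj R n X Z) (@finite_partE R n X Z)).
apply: (orbit_map_inj slX slK EK nf1 nf2 l1 l2 (e := e)); rewrite eG; exact: weyl_orbit_refl.
Qed.

Lemma orbit_map_index e1 e2 Z1 Z2 O1 O2 : isExt Z1 -> isExt Z2 ->
  pi_orbits R KF (ZF Z1) O1 -> pi_orbits R KF (ZF Z2) O2 -> G e1 Z1 O1 = G e2 Z2 O2 ->
  (e1, Z1) = (e2, Z2).
Proof.
move=> /(ext_type_sub R slX) [p1 [d1 E1]] /(ext_type_sub R slX) [p2 [d2 E2]] [S1 S1p <-] [S2 S2p <-].
have [M1 [nf1 l1]] := link_exists slX slK EK qpK KqpK othK E1 S1p.
have [M2 [nf2 l2]] := link_exists slX slK EK qpK KqpK othK E2 S2p.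
rewrite (orbit_mapE slX slK EK qpK KqpK othK e1 nf1 l1) (orbit_mapE slX slK EK qpK KqpK othK e2 nf2 l2).
move=> eG.
have [w] : weyl_orbit X (rowset ((-1) ^+ e1 *: M1)) (rowset ((-1) ^+ e2 *: M2)).
  by rewrite eG; apply: weyl_orbit_refl.
rewrite -rowset_weyl_mx => es.
have [q [_ _ Xq _]] := ext_neighbor slX E1.
by have [-> -> _] := orbit_map_disjoint slX slK EK nf1 nf2 Xq es.
Qed.

(** The Boolean records the sign of D and produces the factor 2. *)
Let index := [seq i <- enum {: bool * {set 'I_n}} | `[< isExt i.2 >]].
Let F (i : bool * {set 'I_n}) := [set G i.1 i.2 O | O in pi_orbits R KF (ZF i.2)]%classic.

Let indexP i : i \in index -> isExt i.2.
Proof. by rewrite mem_filter => /andP[/asboolP]. Qed.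

Let pi_orbits_union : pi_orbits R K X = (\big[setU/set0]_(i <- index) F i)%classic.
Proof.
rewrite -bigcup_seq; apply/seteqP; split=> O.
  move=> /(pi_orbits_cover R slX slK EK qpK KqpK othK) [e [Z [p [d [S0 [M [nfM S0p l ->]]]]]]].
  exists (e, Z) => /=; last by exists (weyl_orbit (ZF Z) S0) => //; exists S0.
  rewrite mem_filter mem_enum andbT; apply/asboolP/(ext_type_sub R slX).
  by have [_ E _ _] := nfM; exists p, d.
move=> [[e Z] /= /indexP /= EZ [_ [S0 S0p <-] <-]].
apply/(pi_orbits_cover R slX slK EK qpK KqpK othK).
have [p [d E]] := (ext_type_sub R slX Z).1 EZ.
have [M [nfM l]] := link_exists slX slK EK qpK KqpK othK E S0p.
by exists e, Z, p, d, S0, M.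
Qed.

Let F_finite i : i \in index -> finite_set (F i).
Proof. by move=> /indexP EZ; apply/finite_image/finite_pi_orbits. Qed.

Let F_disjoint i j O : i \in index -> j \in index -> F i O -> F j O -> i = j.
Proof.
case: i j => [e1 Z1] [e2 Z2] /indexP /= E1 /indexP /= E2 [O1 O1p <-] [O2 O2p /esym].
exact: orbit_map_index.
Qed.

Let F_card i : i \in index -> #|` fset_set (F i)| = mult R KF (ZF i.2).
Proof.
move=> /indexP EZ; have fO := finite_pi_orbits EZ.
rewrite /mult fset_set_image // card_in_imfset //= => O1 O2.
rewrite !in_fset_set // !inE => h1 h2; exact: orbit_map_injective.
Qed.

Lemma finite_pi_orbits_ext : finite_set (pi_orbits R K X).
Proof.
have u : uniq index by rewrite filter_uniq // enum_uniq.
by rewrite pi_orbits_union; have [] := card_bigcup_disjoint u F_finite F_disjoint.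
Qed.

Lemma mult_ext : mult R K X =
  (2 * \sum_(Z : {set 'I_n} | `[< isExt Z >]) mult R KF (ZF Z))%N.
Proof.
have u : uniq index by rewrite filter_uniq // enum_uniq.
rewrite {1}/mult pi_orbits_union; have [_ ->] := card_bigcup_disjoint u F_finite F_disjoint.
rewrite big_seq (eq_bigr _ F_card) -big_seq big_filter big_enum_cond /=.
rewrite -(pair_big_dep xpredT (fun _ Z => `[< isExt Z >]) (fun _ Z => mult R KF (ZF Z))) /=.
by rewrite sum_nat_const card_bool.
Qed.

Lemma pi_systems_ext : (exists S, pi_systems R K X S) <->
  exists Z, isExt Z /\ exists S, pi_systems R KF (ZF Z) S.
Proof.
split=> [[S Sp]|[Z [/(ext_type_sub R slX) [p [d E]] [S Sp]]]].
  have : pi_orbits R K X (weyl_orbit X S) by exists S.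
  move=> /(pi_orbits_cover R slX slK EK qpK KqpK othK) [e [Z [p [d [S0 [M [nfM S0p l _]]]]]]].
  exists Z; split; last by exists S0.
  by apply/(ext_type_sub R slX); have [_ E _ _] := nfM; exists p, d.
have [M [[HM _ _ _] _]] := link_exists slX slK EK qpK KqpK othK E Sp.
by exists (rowset M); apply/(pi_systemsP slX slK); exists M.
Qed.
End Counting.

Theorem theorem7p1 (R : realType) (n : nat) (X : 'M[int]_n)
    (k : nat) (K : 'M[int]_k)
    (hX : simply_laced X) (hK : ext_type R K) :
  ((exists S, pi_systems R K X S) <->
   (exists Z : {set 'I_n}, ext_type R (subdiagram X Z) /\
      exists S, pi_systems R (finite_part R K)
                             (finite_part R (subdiagram X Z)) S)) /\
  [/\ finite_set (pi_orbits R K X),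
      forall Z : {set 'I_n}, ext_type R (subdiagram X Z) ->
        finite_set (pi_orbits R (finite_part R K)
                                (finite_part R (subdiagram X Z))) &
      mult R K X =
        (2 * \sum_(Z : {set 'I_n} | `[< ext_type R (subdiagram X Z) >])
               mult R (finite_part R K) (finite_part R (subdiagram X Z)))%N].
Proof.
have slK : simply_laced K by case: hK.
have [pK [dK EK]] := (ext_typeP R slK).1 hK.
have [qK [qY _ KqpK oth]] := ext_neighbor slK EK.
have qpK : qK != pK by move: qY; rewrite in_setD1 => /andP[].
have othK j : j != pK -> j != qK -> K j pK = 0.
  by move=> jp jq; apply: oth => //; rewrite in_setD1 jp inE.
split; first exact: (pi_systems_ext R hX slK EK qpK KqpK othK).
split; first exact: (finite_pi_orbits_ext R hX slK EK qpK KqpK othK).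
  exact: (finite_pi_orbits K hX).
exact: (mult_ext R hX slK EK qpK KqpK othK).
Qed.
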